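(* Let $q$ be a prime power and let $\Gamma$ be a centrally rigid subgroup of $PGL(2,\mathbb{F}_q[t])$, acting on the $(q+1)$-regular Bruhat–Tits tree $\mathcal{T}_{q+1}$ of $PGL(2,\mathbb{F}_q((t^{-1})))$. Let $\mathbf{X}=(X,\mathcal{G})$ be the quotient graph of groups of this action (a $(q+1)$-regular graph of groups) and let $\mathbf{A}=(X,w)$ be the associated weighted graph. Then \[Z_{\mathbf{X}}(u)=Z_{\mathbf{A}}(u)^{c_\Gamma}.\]
   Context: Graphs have oriented edges $e$ with source $s(e)$, target $t(e)$ and inverse $\overline{e}\neq e$, $\overline{\overline e}=e$, $s(e)=t(\overline e)$. A graph of groups $(X,\mathcal{G})$ is a graph $X$ with groups $G_x$ (vertices), $G_e=G_{\overline e}$ (edges) and monomorphisms $G_e\to G_{t(e)}$. For a group $\Gamma$ acting on a tree without inversions, the quotient graph of groups is $X=\Gamma\backslash\mathcal{T}$ with vertex and edge groups the stabilizers of lifts (Bass–Serre theory); its fundamental group is $\Gamma$. Vertex stabilizers are assumed finite (discreteness). An element $\gamma$ is hyperbolic if it fixes no vertex of $\mathcal{T}$ (acting without inversions). Its translation length is $\ell(\gamma)=\min_x d(x,\gamma x)$ over vertices $x$, and $\mathrm{Axis}(\gamma)$ is the bi-infinite path of vertices attaining the minimum. A hyperbolic $\gamma$ is primitive (in $\Gamma$) if $\gamma\neq h^r$ for all $h\in\Gamma$, $r>1$. $P(\Gamma)$ is the set of primitive hyperbolic elements (up to conjugacy). $\Gamma_{\mathrm{Axis}(\gamma)}$ is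 the subgroup of $\Gamma$ fixing $\mathrm{Axis}(\gamma)$ pointwise, and $\mathrm{Cent}(\gamma,\Gamma_{\mathrm{Axis}(\gamma)})$ is the set of elements of $\Gamma_{\mathrm{Axis}(\gamma)}$ commuting with $\gamma$. A discrete group $\Gamma$ acting on $\mathcal{T}_{q+1}$ is centrally rigid if $|\mathrm{Cent}(\gamma,\Gamma_{\mathrm{Axis}(\gamma)})|$ takes the same value for all $\gamma\in P(\Gamma)$; this value is denoted $c_\Gamma$. Selberg zeta function of $\mathbf{X}=(X,\mathcal{G})$ with $\Gamma=\pi_1(X,\mathcal{G})$: $Z_{\mathbf X}(u)=\prod_{[\gamma]}(1-u^{\ell(\gamma)})^{-1}$, the product over $\Gamma$-conjugacy classes of primitive hyperbolic elements. Associated weighted graph $\mathbf{A}=(X,w)$: $w(e)=|G_{s(e)}|/|G_e|$. For edges $e,e'$ with $t(e)=s(e')$ put $w(e,e')=w(e')$ if $e'\neq\overline e$ and $w(e,e')=w(e')-1$ if $e'=\overline e$. For a closed path $c=(e_1,\dots,e_n)$ (so $t(e_i)=s(e_{i+1})$, indices mod $n$), $\ell(c)=n$ and $w(c)=\prod_{j\in\mathbb{Z}/n}w(e_j,e_{j+1})$. A cycle is an equivalence class of closed paths under cyclic rotation; it is prime (primitive) if it is not a proper power. The Bass–Ihara zeta function is $Z_{\mathbf A}(u)=\prod_{[c]}(1-w(c)u^{\ell(c)})^{-1}$ over prime cycles $[c]$ of $X$. Both zeta functions are considered as power series in $u$ (for $|u|$ small). *)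

(* Defs.v *)
From HB Require Import structures.
From mathcomp Require Import all_boot all_order all_algebra finmap.
From mathcomp Require Import mathcomp_extra boolp classical_sets functions cardinality.

Set Implicit Arguments.
Unset Strict Implicit.
Unset Printing Implicit Defensive.

Import GRing.Theory.
Local Open Scope classical_set_scope.
Local Open Scope ring_scope.

(** * Formal power series *)

Record fps (R : Type) := Fps { coefs :> nat -> R }.
Arguments Fps {R}.
Notation "{ 'fps' R }" := (fps R) (format "{ 'fps'  R }") : type_scope.

HB.instance Definition _ R := gen_eqMixin {fps R}.
HB.instance Definition _ R := gen_choiceMixin {fps R}.

Lemma fpsP R (f g : {fps R}) : coefs f =1 coefs g <-> f = g.
Proof. by split=> [|->//]; case: f g => f [g] /= /funext ->. Qed.

Section FpsRing.
Variable R : comNzRingType.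
Implicit Types f g h : {fps R}.

Definition fpsC (a : R) : {fps R} := Fps (fun n => if n == 0%N then a else 0).
Definition fpsX : {fps R} := Fps (fun n => (n == 1%N)%:R).

Definition fps_add f g := Fps (fun n => f n + g n).
Definition fps_opp f := Fps (fun n => - f n).
Definition fps_mul f g := Fps (fun n => \sum_(i < n.+1) f i * g (n - i)%N).

Fact fps_addA : associative fps_add.
Proof. by move=> f g h; apply/fpsP => n /=; rewrite addrA. Qed.
Fact fps_addC : commutative fps_add.
Proof. by move=> f g; apply/fpsP => n /=; rewrite addrC. Qed.
Fact fps_add0 : left_id (fpsC 0) fps_add.
Proof. by move=> f; apply/fpsP => n /=; case: ifP => _; rewrite add0r. Qed.
Fact fps_addN : left_inverse (fpsC 0) fps_opp fps_add.
Proof. by move=> f; apply/fpsP => n /=; rewrite addNr if_same. Qed.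

HB.instance Definition _ :=
  GRing.isZmodule.Build {fps R} fps_addA fps_addC fps_add0 fps_addN.

Let fps_mul_rev f g n : fps_mul f g n = \sum_(j < n.+1) f (n - j)%N * g j.
Proof.
rewrite /= (reindex_inj rev_ord_inj) /=.
by apply: eq_bigr => j _; rewrite (sub_ordK j).
Qed.

Fact fps_mulC : commutative fps_mul.
Proof.
move=> f g; apply/fpsP => n; rewrite fps_mul_rev /=.
by apply: eq_bigr => i _; rewrite mulrC.
Qed.

Fact fps_mulA : associative fps_mul.
Proof.
move=> p q r; apply/fpsP=> i; rewrite [RHS]fps_mul_rev.
pose coef3 j k := p j * (q (i - j - k)%N * r k).
transitivity (\sum_(j < i.+1) \sum_(k < i.+1 | (k <= i - j)%N) coef3 j k).
  apply: eq_bigr => j _; rewrite fps_mul_rev.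
  by rewrite big_distrr /= (big_ord_narrow_leq (leq_subr _ _)).
rewrite (exchange_big_dep predT) //=; apply: eq_bigr => k _.
transitivity (\sum_(j < i.+1 | (j <= i - k)%N) coef3 j k).
  apply: eq_bigl => j; rewrite -ltnS -(ltnS j) -!subSn ?leq_ord //.
  by rewrite -subn_gt0 -(subn_gt0 j) -!subnDA addnC.
rewrite (big_ord_narrow_leq (leq_subr _ _)) big_distrl /=.
by apply: eq_bigr => j _; rewrite /coef3 -!subnDA addnC mulrA.
Qed.

Fact fps_mul1 : left_id (fpsC 1) fps_mul.
Proof.
move=> f; apply/fpsP => n /=; rewrite big_ord_recl /= mul1r subn0.
by rewrite big1 ?addr0 // => i _; rewrite mul0r.
Qed.

Fact fps_mulDl : left_distributive fps_mul fps_add.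
Proof.
move=> f g h; apply/fpsP => n /=; rewrite -big_split /=.
by apply: eq_bigr => i _; rewrite mulrDl.
Qed.

Fact fps_1neq0 : fpsC 1 != fpsC 0.
Proof. by apply/eqP => -[/(congr1 (@^~ 0%N))] /= /eqP; rewrite oner_eq0. Qed.

HB.instance Definition _ := GRing.Zmodule_isComNzRing.Build {fps R}
  fps_mulA fps_mulC fps_mul1 fps_mulDl fps_1neq0.

Lemma fpsE0 n : (0 : {fps R}) n = 0. Proof. by rewrite /= if_same. Qed.
Lemma fpsE1 n : (1 : {fps R}) n = (n == 0%N)%:R.
Proof. by rewrite /=; case: eqP. Qed.
Lemma fpsED f g n : (f + g) n = f n + g n. Proof. by []. Qed.
Lemma fpsEM f g n : (f * g) n = \sum_(i < n.+1) f i * g (n - i)%N.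
Proof. by []. Qed.

(* Units and inverses are taken classically: [f^-1] is the inverse of [f] when
   there is one, and [f] itself otherwise. *)
Definition fps_unit : {pred {fps R}} := fun f => `[< exists g, g * f = 1 >].
Definition fps_inv f := xget f [set g | g * f = 1].

Fact fps_mulV : {in fps_unit, left_inverse 1 fps_inv *%R}.
Proof.
move=> f /asboolP ex; rewrite /fps_inv.
by case: xgetP => [g _ //|nex]; case: ex => g /nex.
Qed.
Fact fps_unitP f g : g * f = 1 -> fps_unit f.
Proof. by move=> gf; apply/asboolP; exists g. Qed.
Fact fps_inv_out : {in [predC fps_unit], fps_inv =1 id}.
Proof.
move=> f /negP nf; rewrite /fps_inv; case: xgetP => [g _ gf|//].
by case: nf; apply: fps_unitP gf.
Qed.

HB.instance Definition _ :=
  GRing.ComNzRing_hasMulInverse.Build {fps R} fps_mulV fps_unitP fps_inv_out.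

Fact fpsC_zmod_morphism : zmod_morphism fpsC.
Proof.
by move=> a b; apply/fpsP => n /=; case: ifP => _; rewrite ?subr0.
Qed.
Fact fpsC_monoid_morphism : monoid_morphism fpsC.
Proof.
split=> [|a b]; first exact: erefl.
apply/fpsP => n; rewrite fpsEM big_ord_recl subn0 big1 => [|i _].
  by rewrite addr0 /=; case: ifP => _; rewrite ?mulr0.
by rewrite [X in X * _]/= mul0r.
Qed.
HB.instance Definition _ :=
  GRing.isZmodMorphism.Build R {fps R} fpsC fpsC_zmod_morphism.
HB.instance Definition _ :=
  GRing.isMonoidMorphism.Build R {fps R} fpsC fpsC_monoid_morphism.

End FpsRing.

Arguments fpsC {R}.
Arguments fpsX {R}.

Section FpsIdomain.
Variable R : idomainType.
Implicit Types f g h : {fps R}.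

Definition fps_ord_is f n := (f n != 0) /\ forall m, (m < n)%N -> f m = 0.

Lemma fps_ordP f : f != 0 -> exists n, fps_ord_is f n.
Proof.
move=> f0; have ex : exists n, f n != 0.
  apply: contrapT => nex; case/eqP: f0; apply/fpsP => n.
  rewrite fpsE0; apply/eqP; apply: contrapT => /negP fn; apply: nex.
  by exists n.
exists (ex_minn ex); case: ex_minnP => n fn min; split=> // m mn.
by apply/eqP; apply: contraTT mn => /min; rewrite -leqNgt.
Qed.

Lemma fps_ord_uniq f m n : fps_ord_is f m -> fps_ord_is f n -> m = n.
Proof.
move=> [fm mP] [fn nP]; apply/eqP; rewrite eqn_leq.
apply/andP; split; rewrite leqNgt; apply/negP => lt.
  by move/eqP: fn; apply; apply: mP.
by move/eqP: fm; apply; apply: nP.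
Qed.

Lemma fps_ordM f g m n :
  fps_ord_is f m -> fps_ord_is g n -> fps_ord_is (f * g) (m + n).
Proof.
move=> [fm mP] [gn nP]; split.
  have mlt : (m < (m + n).+1)%N by rewrite ltnS leq_addr.
  rewrite fpsEM (bigD1 (Ordinal mlt)) //= addKn big1 ?addr0 ?mulf_neq0 //.
  move=> i; rewrite -val_eqE /= => im.
  have [/mP->|mi] := ltnP i m; first by rewrite mul0r.
  rewrite nP ?mulr0 //; have {mi}im : (m < i)%N by rewrite ltn_neqAle eq_sym im.
  have := ltn_ord i; rewrite ltnS => imn.
  by rewrite ltn_subLR // ltn_add2r.
move=> k kmn; rewrite fpsEM big1 // => i _.
have [/mP->|mi] := ltnP i m; first by rewrite mul0r.
rewrite nP ?mulr0 //; have := ltn_ord i; rewrite ltnS => ik.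
by rewrite ltn_subLR // (leq_trans kmn) // leq_add2r.
Qed.

Fact fps_integral : GRing.integral_domain_axiom {fps R}.
Proof.
move=> f g fg0; apply: contraT; rewrite negb_or => /andP[].
move=> /fps_ordP[m fm] /fps_ordP[n gn].
by have [] := fps_ordM fm gn; rewrite fg0 fpsE0 eqxx.
Qed.

HB.instance Definition _ := GRing.ComUnitRing_isIntegral.Build {fps R} fps_integral.

Lemma fps_ord_unit f : f \is a GRing.unit -> fps_ord_is f 0.
Proof.
move=> /mulVr fV; split=> //; apply/eqP => f0.
have := congr1 (fun h : {fps R} => h 0%N) fV.
by rewrite fpsEM big_ord1 f0 mulr0 fpsE1 => /esym/eqP; rewrite oner_eq0.
Qed.

Lemma fps_ordX : fps_ord_is fpsX 1.
Proof. by split=> [|[]//]; rewrite /= oner_eq0. Qed.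

End FpsIdomain.

Lemma fps_unitE (F : fieldType) (f : {fps F}) : f 0%N != 0 -> f \is a GRing.unit.
Proof.
move=> f0.
pose next (s : seq F) :=
  rcons s ((f 0%N)^-1 * ((size s == 0%N)%:R -
            \sum_(i < size s) s`_i * f (size s - i)%N)).
pose s n := iter n next [::].
have szs n : size (s n) = n by elim: n => //= n IH; rewrite size_rcons IH.
pose g := Fps (fun n => (s n.+1)`_n).
have sE n i : (i < n)%N -> (s n)`_i = g i.
  elim: n => // n IH; rewrite ltnS leq_eqVlt => /predU1P[->//|lt].
  by rewrite /s iterS -/(s n) nth_rcons szs lt IH.
apply/unitrPr; exists g; rewrite mulrC; apply/fpsP => n; rewrite fpsEM fpsE1.
rewrite big_ord_recr /= subnn.
have -> : (s n.+1)`_n = (f 0%N)^-1 * ((n == 0%N)%:R -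
            \sum_(i < n) g i * f (n - i)%N).
  rewrite /s iterS -/(s n) nth_rcons szs ltnn eqxx; congr (_ * (_ - _)).
  by apply: eq_bigr => i _; rewrite sE.
by rewrite mulrC mulVKf // addrCA subrr addr0.
Qed.

(** ** Infinite products
    [Z] is the product of the family [f] over [A]: every coefficient of the
    finite subproducts is eventually constant along the finite subsets of [A]. *)

Section FpsProd.
Variables (R : comNzRingType) (I : choiceType) (A : set I) (f : I -> {fps R}).

Definition is_fps_prod (Z : {fps R}) := forall n,
  exists2 J0 : {fset I}, [set` J0] `<=` A &
  forall J : {fset I}, (J0 `<=` J)%fset -> [set` J] `<=` A ->
    coefs (\prod_(i <- J) f i) n = coefs Z n.

Definition fps_multipliable := exists Z, is_fps_prod Z.

(* Junk value 1 when the family is not multipliable. *)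
Definition fps_prod : {fps R} := xget 1 is_fps_prod.

End FpsProd.

(** * Groups acting on graphs *)

Section Subgroup.
Variables (G : groupType) (H : groupClosed G).

Definition subg : Type := {x : G | x \in H}.
HB.instance Definition _ := SubChoice.on subg.

Fact subg_closed : group_closed (mem H).
Proof. by split=> [|x y]; [exact: gpred1 | exact: gpredF]. Qed.
HB.instance Definition _ :=
  SubChoice_isSubGroup.Build G (fun x => x \in H) subg subg_closed.
End Subgroup.

Section PackSubgroup.
Variables (G : groupType) (S : {pred G}) (clS : group_closed S).
Definition pack_subgroup : groupClosed G :=
  GroupClosed.Pack (GroupClosed.Class
    (isInvClosed.Build G S (group_closedV clS))
    (isMul1Closed.Build G S clS.1)
    (isMulClosed.Build G S (group_closedM clS))).
End PackSubgroup.

Lemma groupClosed_eq (G : groupType) (H K : groupClosed G) :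
  H = K :> {pred G} -> H = K.
Proof.
case: H K => [H [[h1] [h2] [h3]]] [K [[k1] [k2] [k3]]] /= HK.
case: _ / HK in k1 k2 k3 *.
by rewrite (Prop_irrelevance h1 k1) (Prop_irrelevance h2 k2) (Prop_irrelevance h3 k3).
Qed.

(* For infinite [T] this is the junk value 0. *)
Definition ncard (T : choiceType) : nat := #|` fset_set [set: T]|%fset.

Record graph := Graph {
  vert : choiceType;
  edge : choiceType;
  src : edge -> vert;
  tgt : edge -> vert;
  einv : edge -> edge;
  einv_neq : forall e, einv e != e;
  einvK : involutive einv;
  src_einv : forall e, src (einv e) = tgt e }.

Lemma tgt_einv (T : graph) (e : edge T) : tgt (einv e) = src e.
Proof. by rewrite -src_einv einvK. Qed.

(** Actions without inversions; [vactM] and [eactM] make them left actions. *)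
Record action (G : groupType) (T : graph) := Action {
  vact : G -> vert T -> vert T;
  eact : G -> edge T -> edge T;
  vact1 : forall x, vact 1%g x = x;
  vactM : forall g h x, vact (g * h)%g x = vact g (vact h x);
  eact1 : forall e, eact 1%g e = e;
  eactM : forall g h e, eact (g * h)%g e = eact g (eact h e);
  src_eact : forall g e, src (eact g e) = vact g (src e);
  einv_eact : forall g e, einv (eact g e) = eact g (einv e);
  no_inversion : forall g e, eact g e != einv e }.

Definition res_action (G : groupType) (T : graph) (a : action G T)
    (H : groupClosed G) : action (subg H) T :=
  @Action (subg H) T
    (fun g => vact a (val g)) (fun g => eact a (val g))
    (fun x => vact1 a x) (fun g h x => vactM a (val g) (val h) x)
    (fun e => eact1 a e) (fun g h e => eactM a (val g) (val h) e)
    (fun g e => src_eact a (val g) e) (fun g e => einv_eact a (val g) e)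
    (fun g e => no_inversion a (val g) e).

Record graph_of_groups := GraphOfGroups {
  gog_graph :> graph;
  vgroup : vert gog_graph -> groupType;
  egroup : edge gog_graph -> groupType;
  egroup_einv : forall e, egroup (einv e) = egroup e;
  gmono : forall e, egroup e -> vgroup (tgt e);
  gmonoM : forall e, {morph @gmono e : x y / (x * y)%g};
  gmono_inj : forall e, injective (@gmono e) }.

(** ** The quotient graph of groups *)

Section Quotient.
Variables (G : groupType) (T : graph) (a : action G T).

Lemma tgt_eact g e : tgt (eact a g e) = vact a g (tgt e).
Proof. by rewrite -src_einv einv_eact src_eact src_einv. Qed.

Definition vorbit (x : vert T) : set (vert T) := range (fun g => vact a g x).
Definition eorbit (e : edge T) : set (edge T) := range (fun g => eact a g e).

Lemma vorbit_refl x : vorbit x x. Proof. by exists 1%g; rewrite ?vact1. Qed.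
Lemma eorbit_refl e : eorbit e e. Proof. by exists 1%g; rewrite ?eact1. Qed.
Lemma vorbit_eq x y : vorbit x y -> vorbit y = vorbit x.
Proof.
move=> [g _ <-]; apply/seteqP; split=> z [h _ <-].
  by exists (h * g)%g; rewrite ?vactM.
by exists (h * g^-1)%g => //; rewrite -vactM mulgVK.
Qed.
Lemma eorbit_eq e f : eorbit e f -> eorbit f = eorbit e.
Proof.
move=> [g _ <-]; apply/seteqP; split=> z [h _ <-].
  by exists (h * g)%g; rewrite ?eactM.
by exists (h * g^-1)%g => //; rewrite -eactM mulgVK.
Qed.

Definition qvert : choiceType := set_type (range vorbit).
Definition qedge : choiceType := set_type (range eorbit).

Lemma src_eorbit e : [set src f | f in eorbit e] = vorbit (src e).
Proof.
apply/seteqP; split=> x.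
  by move=> [_ [g _ <-] <-]; exists g; rewrite ?src_eact.
by move=> [g _ <-]; exists (eact a g e); [exists g|rewrite src_eact].
Qed.
Lemma tgt_eorbit e : [set tgt f | f in eorbit e] = vorbit (tgt e).
Proof.
apply/seteqP; split=> x.
  by move=> [_ [g _ <-] <-]; exists g; rewrite ?tgt_eact.
by move=> [g _ <-]; exists (eact a g e); [exists g|rewrite tgt_eact].
Qed.
Lemma einv_eorbit e : [set einv f | f in eorbit e] = eorbit (einv e).
Proof.
apply/seteqP; split=> x.
  by move=> [_ [g _ <-] <-]; exists g; rewrite ?einv_eact.
by move=> [g _ <-]; exists (eact a g e); [exists g|rewrite einv_eact].
Qed.

Lemma qedgeP (E : qedge) : exists e, eorbit e = val E.
Proof. by have /set_mem[e _ <-] := valP E; exists e. Qed.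

Fact qsrc_subproof (E : qedge) : [set src e | e in val E] \in range vorbit.
Proof. by have [e <-] := qedgeP E; rewrite src_eorbit; apply/mem_set; exists (src e). Qed.
Fact qtgt_subproof (E : qedge) : [set tgt e | e in val E] \in range vorbit.
Proof. by have [e <-] := qedgeP E; rewrite tgt_eorbit; apply/mem_set; exists (tgt e). Qed.
Fact qinv_subproof (E : qedge) : [set einv e | e in val E] \in range eorbit.
Proof. by have [e <-] := qedgeP E; rewrite einv_eorbit; apply/mem_set; exists (einv e). Qed.

Definition qsrc (E : qedge) : qvert := SigSub (qsrc_subproof E).
Definition qtgt (E : qedge) : qvert := SigSub (qtgt_subproof E).
Definition qinv (E : qedge) : qedge := SigSub (qinv_subproof E).

Fact qinv_neq E : qinv E != E.
Proof.
apply/eqP => /(congr1 val) /=; have [e <-] := qedgeP E; rewrite einv_eorbit => eE.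
have := eorbit_refl (einv e); rewrite eE => -[g _ ge].
by have := no_inversion a g e; rewrite ge eqxx.
Qed.
Fact qinvK : involutive qinv.
Proof.
move=> E; apply: val_inj => /=; have [e <-] := qedgeP E.
by rewrite !einv_eorbit einvK.
Qed.
Fact qsrc_qinv E : qsrc (qinv E) = qtgt E.
Proof.
apply: val_inj => /=; have [e <-] := qedgeP E.
by rewrite einv_eorbit src_eorbit tgt_eorbit src_einv.
Qed.

Definition quotient_graph := Graph qinv_neq qinvK qsrc_qinv.

(* A lift of each vertex, and of each edge, the latter compatible with
   inversion: lift one chosen edge of each pair {E, qinv E}. *)
Fact qvert_ex (X : qvert) : exists x, val X x.
Proof. by have /set_mem[x _ <-] := valP X; exists x; apply: vorbit_refl. Qed.
Fact qedge_ex (E : qedge) : exists e, val E e.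
Proof. by have [e <-] := qedgeP E; exists e; apply: eorbit_refl. Qed.

Definition vlift (X : qvert) : vert T := projT1 (cid (qvert_ex X)).
Definition erep (E : qedge) : edge T := projT1 (cid (qedge_ex E)).
Definition chosen (E : qedge) : qedge := xget E [set E; qinv E].
Definition elift (E : qedge) : edge T :=
  if E == chosen E then erep E else einv (erep (qinv E)).

Lemma vliftP X : val X (vlift X).
Proof. exact: projT2 (cid (qvert_ex X)). Qed.
Lemma erepP E : val E (erep E).
Proof. exact: projT2 (cid (qedge_ex E)). Qed.
Lemma vlift_orbit X : vorbit (vlift X) = val X.
Proof.
have := vliftP X; have /set_mem[x _ <-] := valP X; exact: vorbit_eq.
Qed.
Lemma eliftP E : val E (elift E).
Proof.
rewrite /elift; case: eqP => _; first exact: erepP.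
have := erepP (qinv E); rewrite -[in val E](qinvK E) /=.
by move=> inE; exists (erep (qinv E)).
Qed.
Lemma elift_orbit E : eorbit (elift E) = val E.
Proof.
have := eliftP E; have [e <-] := qedgeP E; exact: eorbit_eq.
Qed.

Lemma chosen_qinv E : chosen (qinv E) = chosen E.
Proof.
rewrite /chosen qinvK setUC /xget; case: pselect => // nex.
by case: nex; exists E; apply/asboolP; left.
Qed.
Lemma chosenP E : chosen E = E \/ chosen E = qinv E.
Proof.
by rewrite /chosen; case: xgetP => [_ _ //|/(_ E)[]]; left.
Qed.
Lemma elift_qinv E : elift (qinv E) = einv (elift E).
Proof.
rewrite /elift chosen_qinv qinvK; have [-> | ->] := chosenP E.
  by rewrite eqxx (negbTE (qinv_neq E)).
by rewrite eqxx eq_sym (negbTE (qinv_neq E)) einvK.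
Qed.

(* Stabilizers *)
Definition vstab (x : vert T) : {pred G} := fun g => vact a g x == x.
Definition estab (e : edge T) : {pred G} := fun g => eact a g e == e.

Fact vstab_closed x : group_closed (vstab x).
Proof.
split=> [|g h /eqP gx /eqP hx]; apply/eqP; first exact: vact1.
by rewrite vactM -[X in vact a _ (vact a _ X)]hx -(vactM a h^-1) mulVg vact1.
Qed.
Fact estab_closed e : group_closed (estab e).
Proof.
split=> [|g h /eqP gx /eqP hx]; apply/eqP; first exact: eact1.
by rewrite eactM -[X in eact a _ (eact a _ X)]hx -(eactM a h^-1) mulVg eact1.
Qed.

Definition qvgroup (X : qvert) : groupType := subg (pack_subgroup (vstab_closed (vlift X))).
Definition qegroup (E : qedge) : groupType := subg (pack_subgroup (estab_closed (elift E))).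

Lemma estab_einv e : estab (einv e) = estab e.
Proof.
apply/funext => g; rewrite /estab -einv_eact.
by rewrite (inj_eq (can_inj (@einvK T))).
Qed.

Fact qegroup_qinv E : qegroup (qinv E) = qegroup E.
Proof.
rewrite /qegroup; congr (subg _ : groupType).
by apply: groupClosed_eq; rewrite /= elift_qinv estab_einv.
Qed.

(* An element carrying the target of the lift of [E] to the lift of the target
   of [E]; the edge group is embedded by conjugation by this element. *)
Fact elift_tgt_ex (E : qedge) :
  exists k, vact a k (tgt (elift E)) = vlift (qtgt E).
Proof.
have : vorbit (tgt (elift E)) (vlift (qtgt E)).
  by rewrite -tgt_eorbit elift_orbit; apply: vliftP (qtgt E).
by move=> [k _ <-]; exists k.
Qed.
Definition econj (E : qedge) : G := projT1 (cid (elift_tgt_ex E)).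
Lemma econjP E : vact a (econj E) (tgt (elift E)) = vlift (qtgt E).
Proof. exact: projT2 (cid (elift_tgt_ex E)). Qed.

Fact qmono_subproof E (g : qegroup E) :
  ((val g) ^ (econj E)^-1)%g \in pack_subgroup (vstab_closed (vlift (qtgt E))).
Proof.
have /eqP ge := valP g; apply/eqP.
rewrite conjgE invgK vactM vactM -(econjP E) -(vactM a (econj E)^-1) mulVg vact1.
by rewrite -tgt_eact ge.
Qed.
Definition qmono (E : qedge) (g : qegroup E) : qvgroup (qtgt E) :=
  exist (fun h => h \in pack_subgroup (vstab_closed (vlift (qtgt E))))
    ((val g) ^ (econj E)^-1)%g (qmono_subproof g).

Fact qmonoM E : {morph @qmono E : x y / (x * y)%g}.
Proof. by move=> x y; apply: val_inj; rewrite /= conjMg. Qed.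
Fact qmono_inj E : injective (@qmono E).
Proof. by move=> x y /(congr1 val) /= /conjg_inj/val_inj. Qed.

Definition quotient_gog : graph_of_groups :=
  @GraphOfGroups quotient_graph qvgroup qegroup qegroup_qinv qmono qmonoM qmono_inj.

End Quotient.

(** * Hyperbolic elements and the Selberg zeta function *)

Fixpoint is_path (T : graph) (x : vert T) (p : seq (edge T)) (y : vert T) : Prop :=
  if p is e :: p' then src e = x /\ is_path (tgt e) p' y else x = y.

(* The least element of [A], 0 if [A] is empty. *)
Definition natmin (A : set nat) : nat :=
  xget 0%N [set n | A n /\ forall m, A m -> (n <= m)%N].

Definition dist (T : graph) (x y : vert T) : nat :=
  natmin [set size p | p in [set p | is_path x p y]].

Definition conj_class (G : groupType) (g : G) : set G :=
  range (fun h => g ^ h)%g.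

Section Selberg.
Variables (G : groupType) (T : graph) (a : action G T).
Implicit Type g : G.

Definition hyperbolic g := forall x, vact a g x <> x.

Definition translation_length g : nat :=
  natmin (range (fun x => dist x (vact a g x))).

Definition axis g : set (vert T) :=
  [set x | dist x (vact a g x) = translation_length g].

Definition primitive_hyperbolic g :=
  hyperbolic g /\ forall h r, (1 < r)%N -> g <> (h ^+ r)%g.

Definition axis_fixator g : set G :=
  [set h | forall x, axis g x -> vact a h x = x].

Definition axis_centralizer g : set G :=
  [set h | axis_fixator g h /\ commute h g].

(** [c] is the common cardinality of the centralizers; it is uniquely determined
    as soon as there are primitive hyperbolic elements. *)
Definition centrally_rigid (c : nat) :=
  forall g, primitive_hyperbolic g -> (axis_centralizer g #= `I_c)%card.

Definition primitive_classes : set (set G) :=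
  [set conj_class g | g in primitive_hyperbolic].

(* All elements of a conjugacy class have the same translation length, so any
   representative will do. *)
Definition selberg_factor (C : set G) : {fps rat} :=
  (1 - fpsX ^+ translation_length (xget 1%g C))^-1.

(** The product over the conjugacy classes of primitive hyperbolic elements;
    [G] is the fundamental group of the quotient graph of groups. *)
Definition selberg_multipliable := fps_multipliable primitive_classes selberg_factor.
Definition selberg_zeta := fps_prod primitive_classes selberg_factor.

End Selberg.

(** * Weighted graphs and the Bass-Ihara zeta function *)

Record weighted_graph := WeightedGraph {
  wg_graph :> graph;
  weight : edge wg_graph -> rat }.

Definition assoc_weighted_graph (X : graph_of_groups) : weighted_graph :=
  @WeightedGraph X
    (fun e => (ncard (vgroup (src e)))%:R / (ncard (egroup e))%:R).

Section BassIhara.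
Variable A : weighted_graph.

Definition weight2 (e e' : edge A) : rat :=
  if e' == einv e then weight e' - 1 else weight e'.

Definition closed_path (c : seq (edge A)) :=
  c != [::] /\ cycle (fun e e' => tgt e == src e') c.

(* The pairs (e_j, e_(j+1)), with j modulo the length, are those of [zip c (rot 1 c)]. *)
Definition path_weight (c : seq (edge A)) : rat :=
  \prod_(p <- zip c (rot 1 c)) weight2 p.1 p.2.

Definition prime_path (c : seq (edge A)) :=
  closed_path c /\
  forall d r, closed_path d -> (1 < r)%N -> c <> flatten (nseq r d).

Definition rot_class (c : seq (edge A)) : set (seq (edge A)) :=
  range (fun k => rot k c).

Definition prime_cycles : set (set (seq (edge A))) :=
  [set rot_class c | c in prime_path].

(* Length and weight are invariant under rotation: any representative will do. *)
Definition bass_ihara_factor (C : set (seq (edge A))) : {fps rat} :=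
  let c := xget [::] C in (1 - fpsC (path_weight c) * fpsX ^+ size c)^-1.

Definition bass_ihara_multipliable := fps_multipliable prime_cycles bass_ihara_factor.
Definition bass_ihara_zeta := fps_prod prime_cycles bass_ihara_factor.

End BassIhara.

(** * The projective linear group *)

Section GL2.
Variable R : comUnitRingType.

Record gl2 := GL2 { gl_mx :> 'M[R]_2; gl_unit : gl_mx \in unitmx }.
HB.instance Definition _ := [isSub for gl_mx].
HB.instance Definition _ := [Choice of gl2 by <:].

Fact gl2_mul_subproof (g h : gl2) : g *m h \in unitmx.
Proof. by rewrite unitmx_mul !gl_unit. Qed.
Fact gl2_inv_subproof (g : gl2) : invmx g \in unitmx.
Proof. by rewrite unitmx_inv gl_unit. Qed.
Definition gl2_one := GL2 (unitmx1 R 2).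
Definition gl2_mul g h := GL2 (gl2_mul_subproof g h).
Definition gl2_inv g := GL2 (gl2_inv_subproof g).

Fact gl2_mulA : associative gl2_mul.
Proof. by move=> g h k; apply: val_inj; rewrite /= mulmxA. Qed.
Fact gl2_mul1 : left_id gl2_one gl2_mul.
Proof. by move=> g; apply: val_inj; rewrite /= mul1mx. Qed.
Fact gl2_1mul : right_id gl2_one gl2_mul.
Proof. by move=> g; apply: val_inj; rewrite /= mulmx1. Qed.
Fact gl2_mulV : left_inverse gl2_one gl2_inv gl2_mul.
Proof. by move=> g; apply: val_inj; rewrite /= mulVmx ?gl_unit. Qed.
Fact gl2_Vmul : right_inverse gl2_one gl2_inv gl2_mul.
Proof. by move=> g; apply: val_inj; rewrite /= mulmxV ?gl_unit. Qed.

HB.instance Definition _ := isGroup.Build gl2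
  gl2_mulA gl2_mul1 gl2_1mul gl2_mulV gl2_Vmul.

Definition gl2_scalar_eq (g h : gl2) : bool :=
  `[< exists2 c, c \is a GRing.unit & gl_mx g = c *: gl_mx h >].

Fact gl2_scalar_refl : reflexive gl2_scalar_eq.
Proof. by move=> g; apply/asboolP; exists 1; rewrite ?unitr1 ?scale1r. Qed.
Fact gl2_scalar_sym : symmetric gl2_scalar_eq.
Proof.
suff sub g h : gl2_scalar_eq g h -> gl2_scalar_eq h g.
  by move=> g h; apply/idP/idP => /sub.
move=> /asboolP[c cU gh]; apply/asboolP; exists c^-1; rewrite ?unitrV // gh.
by rewrite scalerA mulVr ?scale1r.
Qed.
Fact gl2_scalar_trans : transitive gl2_scalar_eq.
Proof.
move=> h g k /asboolP[c cU gh] /asboolP[d dU hk]; apply/asboolP.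
by exists (c * d); rewrite ?unitrM ?cU // gh hk scalerA.
Qed.

Canonical gl2_scalar_equiv :=
  EquivRel gl2_scalar_eq gl2_scalar_refl gl2_scalar_sym gl2_scalar_trans.

Local Open Scope quotient_scope.

Definition pgl2 := {eq_quot gl2_scalar_eq}.
HB.instance Definition _ : EqQuotient _ gl2_scalar_eq pgl2 := EqQuotient.on pgl2.
HB.instance Definition _ := Choice.on pgl2.

Lemma pgl2_eqP (g h : gl2) :
  reflect (exists2 c, c \is a GRing.unit & gl_mx g = c *: gl_mx h)
          (g == h %[mod pgl2]).
Proof. by rewrite eqmodE; apply: asboolP. Qed.

Lemma repr_pgl2 (g : gl2) :
  exists2 c, c \is a GRing.unit & gl_mx (repr (\pi_pgl2 g)) = c *: gl_mx g.
Proof. by apply/pgl2_eqP; rewrite reprK. Qed.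

Definition pgl2_one : pgl2 := \pi_pgl2 gl2_one.
Definition pgl2_mul (x y : pgl2) : pgl2 := \pi_pgl2 (gl2_mul (repr x) (repr y)).
Definition pgl2_inv (x : pgl2) : pgl2 := \pi_pgl2 (gl2_inv (repr x)).

Lemma pi_pgl2_mul g h : pgl2_mul (\pi_pgl2 g) (\pi_pgl2 h) = \pi_pgl2 (gl2_mul g h).
Proof.
apply/eqP/pgl2_eqP => /=.
have [c cU ->] := repr_pgl2 g; have [d dU ->] := repr_pgl2 h.
by exists (c * d); rewrite ?unitrM ?cU // -scalemxAl -scalemxAr scalerA.
Qed.
Lemma pi_pgl2_inv g : pgl2_inv (\pi_pgl2 g) = \pi_pgl2 (gl2_inv g).
Proof.
apply/eqP/pgl2_eqP => /=.
have [c cU ->] := repr_pgl2 g; exists c^-1; rewrite ?unitrV // invmxZ //.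
by rewrite unitmxE detZ unitrM unitrX //= -unitmxE gl_unit.
Qed.

Fact pgl2_mulA : associative pgl2_mul.
Proof.
move=> x y z; rewrite -[x]reprK -[y]reprK -[z]reprK.
move: (repr x) (repr y) (repr z) => g h k.
by rewrite (pi_pgl2_mul h k) (pi_pgl2_mul g h) !pi_pgl2_mul gl2_mulA.
Qed.
Fact pgl2_mul1 : left_id pgl2_one pgl2_mul.
Proof. by move=> x; rewrite -[x]reprK pi_pgl2_mul gl2_mul1. Qed.
Fact pgl2_1mul : right_id pgl2_one pgl2_mul.
Proof. by move=> x; rewrite -[x]reprK pi_pgl2_mul gl2_1mul. Qed.
Fact pgl2_mulV : left_inverse pgl2_one pgl2_inv pgl2_mul.
Proof. by move=> x; rewrite -[x]reprK pi_pgl2_inv pi_pgl2_mul gl2_mulV. Qed.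
Fact pgl2_Vmul : right_inverse pgl2_one pgl2_inv pgl2_mul.
Proof. by move=> x; rewrite -[x]reprK pi_pgl2_inv pi_pgl2_mul gl2_Vmul. Qed.

HB.instance Definition _ := isGroup.Build pgl2
  pgl2_mulA pgl2_mul1 pgl2_1mul pgl2_mulV pgl2_Vmul.

End GL2.

Lemma fractionP (R : idomainType) (a : {fraction R}) :
  exists p q, q != 0 /\ a * FracField.tofrac q = FracField.tofrac p.
Proof.
elim/quotW: a => x; exists \n_x, \d_x; split; first exact: denom_ratioP.
unlock FracField.tofrac; rewrite -[LHS]FracField.pi_mul.
apply/eqmodP; rewrite /= FracField.equivfE /FracField.mulf.
by rewrite !numden_Ratio ?mulr1 ?mulf_neq0 ?oner_eq0 ?denom_ratioP // mulrC.
Qed.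


(** * Lattices and the action of [PGL(2)] on their homothety classes *)

Section Lattices.
(* To be used with [O] a discrete valuation ring with uniformizer [pi] and
   fraction field [K]. *)
Variables (O : idomainType) (K : fieldType) (iota : {rmorphism O -> K}) (pi : O).
Hypothesis iota_inj : injective iota.
Hypothesis pi_neq0 : pi != 0.

(** The [O]-lattice of K^2 spanned by the columns of [h]. *)
Definition lattice (h : 'M[K]_2) : set 'cV[K]_2 :=
  range (fun v : 'cV[O]_2 => h *m map_mx iota v).
Definition is_lattice (L : set 'cV[K]_2) :=
  exists2 h : 'M[K]_2, h \in unitmx & L = lattice h.

Definition scale (c : K) (L : set 'cV[K]_2) : set 'cV[K]_2 := [set c *: v | v in L].
Definition homothety_class (L : set 'cV[K]_2) : set (set 'cV[K]_2) :=
  [set scale c L | c in [set c | c != 0]].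

Definition bt_vert : choiceType := set_type [set homothety_class L | L in is_lattice].

(* Two classes are adjacent when they have representatives L, L' with
   pi L < L' < L (proper inclusions), that is, L / L' is a simple O-module. *)
Definition bt_adj (x y : bt_vert) := exists L L' : set 'cV[K]_2,
  [/\ val x L, val y L', scale (iota pi) L `<` L' & L' `<` L].

Definition bt_edge : choiceType :=
  set_type [set p : bt_vert * bt_vert | bt_adj p.1 p.2].

Let unif := iota pi.

Let unif_neq0 : unif != 0.
Proof. by rewrite -(rmorph0 iota) (inj_eq iota_inj). Qed.

Lemma scale_scale c d L : scale c (scale d L) = scale (c * d) L.
Proof.
apply/seteqP; split=> v.
  by move=> [_ [w Lw <-] <-]; exists w; rewrite ?scalerA.
by move=> [w Lw <-]; exists (d *: w); [exists w|rewrite scalerA].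
Qed.
Lemma scale1 L : scale 1 L = L.
Proof.
apply/seteqP; split=> v; first by move=> [w Lw <-]; rewrite scale1r.
by move=> Lv; exists v; rewrite ?scale1r.
Qed.
Lemma scale_lattice c h : scale c (lattice h) = lattice (c *: h).
Proof.
apply/seteqP; split=> v.
  by move=> [_ [w _ <-] <-]; exists w; rewrite // scalemxAl.
by move=> [w _ <-]; exists (h *m map_mx iota w); [exists w|rewrite scalemxAl].
Qed.
Lemma scale_sub c L L' : L `<=` L' -> scale c L `<=` scale c L'.
Proof. by move=> sub _ [v Lv <-]; exists v => //; apply: sub. Qed.
Lemma scale_proper c L L' : c != 0 -> L `<` L' -> scale c L `<` scale c L'.
Proof.
move=> c0 [sub nsub]; split; first exact: scale_sub.
by move=> /(scale_sub (c := c^-1)); rewrite !scale_scale mulVf // !scale1.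
Qed.

Lemma homothety_class_refl L : homothety_class L L.
Proof. by exists 1; rewrite ?scale1 //= oner_neq0. Qed.
Lemma homothety_class_scale c L : c != 0 ->
  homothety_class (scale c L) = homothety_class L.
Proof.
move=> c0; apply/seteqP; split=> _ [d /= d0 <-].
  by exists (d * c); rewrite ?scale_scale //= mulf_neq0.
by exists (d / c); rewrite ?scale_scale ?divfK //= mulf_neq0 ?invr_neq0.
Qed.

Lemma bt_vertP (x : bt_vert) L :
  val x L -> is_lattice L /\ val x = homothety_class L.
Proof.
have /set_mem[_ [h hU ->] <-] := valP x; move=> [c c0 <-]; split.
  by exists (c *: h); rewrite ?scale_lattice // unitmxE detZ unitrM -unitmxE hU
    unitfE expf_neq0.
by rewrite homothety_class_scale.
Qed.

Lemma bt_adj_sym x y : bt_adj x y -> bt_adj y x.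
Proof.
move=> [L [L' [xL yL' lt lt']]]; exists L', (scale unif L); split=> //.
  by have [_ ->] := bt_vertP xL; exists unif => //; apply: unif_neq0.
exact/scale_proper/lt'/unif_neq0.
Qed.

Definition bt_src (e : bt_edge) : bt_vert := (val e).1.
Definition bt_tgt (e : bt_edge) : bt_vert := (val e).2.
Fact bt_inv_subproof (e : bt_edge) :
  ((val e).2, (val e).1) \in [set p : bt_vert * bt_vert | bt_adj p.1 p.2].
Proof. by have /set_mem adj := valP e; apply/mem_set; apply: bt_adj_sym. Qed.
Definition bt_inv (e : bt_edge) : bt_edge := SigSub (bt_inv_subproof e).

(** ** Adjacent vertices are not in the same orbit *)

Lemma lattice_subP h k : lattice h `<=` lattice k ->
  exists N, h = k *m map_mx iota N.
Proof.
move=> sub.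
have ex j : exists v : 'cV[O]_2, k *m map_mx iota v = col j h.
  have [|v _ vE] := sub (col j h); last by exists v.
  by exists (delta_mx j 0) => //; rewrite map_delta_mx -colE.
pose v j := projT1 (cid (ex j)).
exists (\matrix_(i, j) v j i 0); apply/matrixP => i j.
have := congr1 (fun w : 'cV_2 => w i 0) (projT2 (cid (ex j))).
rewrite -/(v j) !mxE => <-; apply: eq_bigr => l _.
by rewrite !mxE.
Qed.

Lemma lattice_mulS k N : lattice (k *m map_mx iota N) `<=` lattice k.
Proof. by move=> _ [v _ <-]; exists (N *m v) => //; rewrite map_mxM mulmxA. Qed.

Lemma lattice_mul_unit k N : N \in unitmx -> lattice (k *m map_mx iota N) = lattice k.
Proof.
move=> NU; apply/seteqP; split; first exact: lattice_mulS.
rewrite -{1}[k]mulmx1 -(map_mx1 iota) -(mulmxV NU) map_mxM mulmxA.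
exact: lattice_mulS.
Qed.

Lemma lattice_proper_det h k : h \in unitmx ->
  scale unif (lattice h) `<` lattice k -> lattice k `<` lattice h ->
  exists n n', [/\ \det k = \det h * iota n, n * n' = pi ^+ 2,
    n \isn't a GRing.unit & n' \isn't a GRing.unit].
Proof.
rewrite scale_lattice => hU [sub1 nsub1] [sub2 nsub2].
have [N kE] := lattice_subP sub2; have [N' hE] := lattice_subP sub1.
have dh0 : \det h != 0 by rewrite -unitfE -unitmxE.
have kn : \det k = \det h * iota (\det N) by rewrite kE det_mulmx det_map_mx.
exists (\det N), (\det N'); split=> //.
- apply: iota_inj; apply: (mulfI dh0).
  by rewrite rmorphM rmorphXn mulrA -kn -det_map_mx -det_mulmx -hE detZ mulrC.
- apply/negP => NU; apply: nsub2.
  by rewrite kE lattice_mul_unit.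
- apply/negP => NU; apply: nsub1.
  by rewrite hE lattice_mul_unit.
Qed.

Definition mx_act (g : 'M[K]_2) (L : set 'cV[K]_2) : set 'cV[K]_2 :=
  [set g *m v | v in L].
Definition class_act (g : 'M[K]_2) (X : set (set 'cV[K]_2)) : set (set 'cV[K]_2) :=
  [set mx_act g L | L in X].

Lemma mx_act_mul g h L : mx_act (g *m h) L = mx_act g (mx_act h L).
Proof.
apply/seteqP; split=> v.
  by move=> [w Lw <-]; exists (h *m w); [exists w|rewrite mulmxA].
by move=> [_ [w Lw <-] <-]; exists w; rewrite ?mulmxA.
Qed.
Lemma mx_act_scalar c L : mx_act c%:M L = scale c L.
Proof. by apply/seteqP; split=> v [w Lw <-]; exists w; rewrite ?mul_scalar_mx. Qed.
Lemma mx_act_lattice g h : mx_act g (lattice h) = lattice (g *m h).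
Proof.
apply/seteqP; split=> v.
  by move=> [_ [w _ <-] <-]; exists w; rewrite // mulmxA.
by move=> [w _ <-]; exists (h *m map_mx iota w); [exists w|rewrite mulmxA].
Qed.
Lemma mx_act_scale g c L : mx_act g (scale c L) = scale c (mx_act g L).
Proof. by rewrite -!mx_act_scalar -!mx_act_mul scalar_mxC. Qed.
Lemma mx_act_proper g L L' : g \in unitmx -> L `<` L' -> mx_act g L `<` mx_act g L'.
Proof.
have sub k A B : A `<=` B -> mx_act k A `<=` mx_act k B.
  by move=> AB _ [v Av <-]; exists v => //; apply: AB.
move=> gU [LL' nLL']; split; first exact: sub.
by move=> /(sub (invmx g)); rewrite -!mx_act_mul mulVmx // !mx_act_scalar !scale1.
Qed.
Lemma class_act_homothety g L :
  class_act g (homothety_class L) = homothety_class (mx_act g L).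
Proof.
apply/seteqP; split=> M.
  by move=> [_ [c c0 <-] <-]; exists c; rewrite ?mx_act_scale.
by move=> [c c0 <-]; exists (scale c L); [exists c|rewrite mx_act_scale].
Qed.

(** ** The action of [PGL(2, R)] through a ring morphism from [R] to [K] *)

Variables (R : comUnitRingType) (rho : {rmorphism R -> K}).
Local Notation PGL := (pgl2 R).

Definition pglK (g : PGL) : 'M[K]_2 := map_mx rho (repr g).

Lemma pglK_unit g : pglK g \in unitmx.
Proof.
by rewrite unitmxE det_map_mx rmorph_unit // -unitmxE gl_unit.
Qed.

Lemma pglK_mul g h : exists2 c, c != 0 & pglK (g * h)%g = c *: (pglK g *m pglK h).
Proof.
have [c cU gh] := repr_pgl2 (gl2_mul (repr g) (repr h)).
exists (rho c); first by rewrite -unitfE rmorph_unit.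
by rewrite /pglK [X in map_mx _ (X : 'M_2)]gh map_mxZ map_mxM.
Qed.
Lemma pglK_1 : exists2 c, c != 0 & pglK 1%g = c%:M.
Proof.
have [c cU gh] := repr_pgl2 (gl2_one R).
exists (rho c); first by rewrite -unitfE rmorph_unit.
by rewrite /pglK [X in map_mx _ (X : 'M_2)]gh map_mxZ map_mx1 scalemx1.
Qed.

Fact bt_vact_subproof (g : PGL) (x : bt_vert) :
  class_act (pglK g) (val x) \in [set homothety_class L | L in is_lattice].
Proof.
have /set_mem[_ [h hU ->] <-] := valP x.
rewrite class_act_homothety mx_act_lattice; apply/mem_set.
by exists (lattice (pglK g *m h)) => //; exists (pglK g *m h);
  rewrite // unitmx_mul pglK_unit.
Qed.
Definition bt_vact (g : PGL) (x : bt_vert) : bt_vert := SigSub (bt_vact_subproof g x).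

Fact bt_eact_subproof (g : PGL) (e : bt_edge) :
  (bt_vact g (val e).1, bt_vact g (val e).2)
    \in [set p : bt_vert * bt_vert | bt_adj p.1 p.2].
Proof.
have /set_mem[L [L' [xL yL' lt lt']]] := valP e; apply/mem_set.
exists (mx_act (pglK g) L), (mx_act (pglK g) L'); split.
- by exists L.
- by exists L'.
- by rewrite -mx_act_scale; apply/mx_act_proper/lt/pglK_unit.
- exact/mx_act_proper/lt'/pglK_unit.
Qed.
Definition bt_eact (g : PGL) (e : bt_edge) : bt_edge := SigSub (bt_eact_subproof g e).

Fact bt_vact1 x : bt_vact 1%g x = x.
Proof.
apply: val_inj => /=; have /set_mem[L _ <-] := valP x.
have [c c0 ->] := pglK_1.
by rewrite class_act_homothety mx_act_scalar homothety_class_scale.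
Qed.
Fact bt_vactM g h x : bt_vact (g * h)%g x = bt_vact g (bt_vact h x).
Proof.
apply: val_inj => /=; have /set_mem[L _ <-] := valP x.
have [c c0 ->] := pglK_mul g h; rewrite !class_act_homothety -mul_scalar_mx.
by rewrite !mx_act_mul mx_act_scalar homothety_class_scale.
Qed.
Fact bt_eact1 e : bt_eact 1%g e = e.
Proof. by apply: val_inj; rewrite /= !bt_vact1 -surjective_pairing. Qed.
Fact bt_eactM g h e : bt_eact (g * h)%g e = bt_eact g (bt_eact h e).
Proof. by apply: val_inj; rewrite /= !bt_vactM. Qed.

Lemma bt_adj_orbit g x y : bt_adj x y -> bt_vact g x = y ->
  exists a n n' u, [/\ \det (pglK g) = a ^+ 2 * iota n * iota u,
    n * n' = pi ^+ 2, n \isn't a GRing.unit, n' \isn't a GRing.unit &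
    u \is a GRing.unit].
Proof.
move=> [L [L' [xL yL' lt lt']]] /(congr1 val) /=.
have [[h hU LE] ->] := bt_vertP xL; have [[k kU LE'] ->] := bt_vertP yL'.
rewrite class_act_homothety LE mx_act_lattice LE' => cE.
have := homothety_class_refl (lattice (pglK g *m h)); rewrite cE => -[a /= a0].
rewrite scale_lattice => gE.
have [U UE] : exists U, a *: k = pglK g *m h *m map_mx iota U.
  by apply: lattice_subP; rewrite gE.
have [V VE] : exists V, pglK g *m h = a *: k *m map_mx iota V.
  by apply: lattice_subP; rewrite gE.
rewrite LE LE' in lt lt'.
have [n [n' [kn nn' nU n'U]]] := lattice_proper_det hU lt lt'.
have dh0 : \det h != 0 by rewrite -unitfE -unitmxE.
have dk0 : \det (a *: k) != 0 by rewrite detZ mulf_neq0 ?expf_neq0 // -unitfE -unitmxE.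
exists a, n, n', (\det V); split=> //.
  apply: (mulIf dh0); rewrite -det_mulmx VE det_mulmx detZ kn det_map_mx.
  by rewrite [\det h * _]mulrC !mulrA mulrAC.
apply/unitrPr; exists (\det U); apply: iota_inj; apply: (mulfI dk0).
rewrite rmorphM rmorph1 mulr1 -!det_map_mx mulrA -det_mulmx -VE -det_mulmx -UE.
by [].
Qed.

End Lattices.

(** * The Bruhat-Tits tree of [PGL(2, F((1/t)))] *)

Lemma fps_ord_nonunit (F : fieldType) (n n' : {fps F}) :
  n * n' = fpsX ^+ 2 -> n \isn't a GRing.unit -> n' \isn't a GRing.unit ->
  fps_ord_is n 1.
Proof.
move=> nn' nU n'U.
have ordX2 := fps_ordM (fps_ordX F) (fps_ordX F).
have : n * n' != 0.
  by rewrite nn' expr2; apply/eqP => X0; have := ordX2.1; rewrite X0 fpsE0 eqxx.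
rewrite mulf_eq0 negb_or => /andP[/fps_ordP[a na] /fps_ordP[b n'b]].
have := fps_ordM na n'b; rewrite nn' => /(fps_ord_uniq ordX2) ab.
have a_gt0 : (0 < a)%N.
  rewrite lt0n; apply/eqP => a0; move/negP: nU; apply.
  by apply: fps_unitE; move: na; rewrite a0 => -[].
have b_gt0 : (0 < b)%N.
  rewrite lt0n; apply/eqP => b0; move/negP: n'U; apply.
  by apply: fps_unitE; move: n'b; rewrite b0 => -[].
suff a1 : a = 1%N by rewrite a1 in na.
apply/eqP; rewrite eqn_leq a_gt0 andbT.
by rewrite -(leq_add2r b) -ab leq_add2l.
Qed.

Section BruhatTits.
Variable F : fieldType.

(** The field F((1/t)) and its ring of integers F[[1/t]]: [fpsX] stands for 1/t. *)
Definition laurent := {fraction {fps F}}.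
Local Notation K := laurent.
Local Notation iota := (@FracField.tofrac {fps F}).

(** The embedding of F[t], evaluating [t] at the inverse of [fpsX]. *)
Definition polyK : {poly F} -> K :=
  horner_eval (iota fpsX)^-1 \o map_poly (iota \o fpsC).
HB.instance Definition _ := GRing.RMorphism.copy polyK
  (horner_eval (iota fpsX)^-1 \o map_poly (iota \o fpsC)).

Lemma no_square_unif (d n u : {fps F}) (a : K) :
  fps_ord_is d 0 -> fps_ord_is n 1 -> fps_ord_is u 0 ->
  iota d <> a ^+ 2 * iota n * iota u.
Proof.
move=> od on ou E; have [p [q [q0 aq]]] := fractionP a.
have pq : q * q * d = p * p * n * u.
  apply/eqP; rewrite -tofrac_eq !tofracM E -aq expr2; apply/eqP.
  rewrite (mulrACA a); move: (a * a) (iota q * iota q) => A Q.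
  by rewrite !mulrA [Q * A]mulrC.
have [m oq] := fps_ordP q0.
have oqd := fps_ordM (fps_ordM oq oq) od.
have : p != 0.
  by apply/eqP => p0; move: oqd.1; rewrite pq p0 !mul0r fpsE0 eqxx.
move=> /fps_ordP[l op].
have := fps_ordM (fps_ordM (fps_ordM op op) on) ou; rewrite -pq.
move=> /(fps_ord_uniq oqd)/(congr1 odd).
by rewrite !addn0 addn1 /= !addnn !odd_double.
Qed.


Lemma polyK_C c : polyK c%:P = iota (fpsC c).
Proof.
rewrite /polyK -[LHS]/(horner_eval _ (map_poly (iota \o fpsC) c%:P)).
by rewrite map_polyC /horner_eval hornerC.
Qed.

Fact laurent_iota_inj : injective iota.
Proof. by move=> x y /eqP; rewrite tofrac_eq => /eqP. Qed.
Fact fpsX_neq0 : (fpsX : {fps F}) != 0.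
Proof. by apply/eqP => /fpsP/(_ 1%N)/eqP; rewrite fpsE0 oner_eq0. Qed.

Local Notation vertT := (bt_vert iota).
Local Notation edgeT := (bt_edge iota fpsX).
Local Notation PGL := (pgl2 {poly F}).

Lemma bt_no_fold (g : PGL) (x y : vertT) : bt_adj fpsX x y -> bt_vact polyK g x <> y.
Proof.
move=> adj /(bt_adj_orbit laurent_iota_inj adj)[a [n [n' [u [dE nn' nU n'U uU]]]]].
have [c c0 dc] : exists2 c, c != 0 & \det (gl_mx (repr g)) = c%:P.
  have := gl_unit (repr g); rewrite unitmxE poly_unitE => /andP[/size_poly1P[c c0 ->] _].
  by exists c.
apply: (@no_square_unif (fpsC c) n u a) (fps_ord_nonunit nn' nU n'U) (fps_ord_unit uU) _.
  by split.
by rewrite -dE /pglK det_map_mx dc /= polyK_C.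
Qed.

Fact bt_inv_neq (e : edgeT) : bt_inv laurent_iota_inj fpsX_neq0 e != e.
Proof.
apply/eqP => /(congr1 (fun f : edgeT => (val f).1)) /= eE.
have /set_mem adj := valP e.
by apply: (@bt_no_fold 1%g _ _ adj); rewrite bt_vact1.
Qed.
Fact bt_invK : involutive (bt_inv laurent_iota_inj fpsX_neq0).
Proof. by move=> e; apply: val_inj; rewrite /= -surjective_pairing. Qed.

Definition bruhat_tits_tree : graph :=
  @Graph vertT edgeT (@bt_src _ _ _ _) (@bt_tgt _ _ _ _)
    (bt_inv laurent_iota_inj fpsX_neq0) bt_inv_neq bt_invK (fun _ => erefl).

Fact bt_no_inversion (g : PGL) (e : edgeT) :
  bt_eact polyK g e != bt_inv laurent_iota_inj fpsX_neq0 e.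
Proof.
apply/eqP => /(congr1 (fun f : edgeT => (val f).1)) /= e1.
have /set_mem adj := valP e.
exact: (@bt_no_fold g _ _ adj).
Qed.

Fact bt_src_eact (g : PGL) (e : edgeT) :
  bt_src (bt_eact polyK g e) = bt_vact polyK g (bt_src e).
Proof. by []. Qed.
Fact bt_inv_eact (g : PGL) (e : edgeT) :
  bt_inv laurent_iota_inj fpsX_neq0 (bt_eact polyK g e) =
  bt_eact polyK g (bt_inv laurent_iota_inj fpsX_neq0 e).
Proof. exact: val_inj. Qed.

Definition bt_action : action PGL bruhat_tits_tree :=
  @Action PGL bruhat_tits_tree (bt_vact polyK) (bt_eact polyK)
    (bt_vact1 polyK) (bt_vactM polyK) (bt_eact1 polyK) (bt_eactM polyK)
    bt_src_eact bt_inv_eact bt_no_inversion.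

End BruhatTits.

(* Main.v *)
(* Let [h] fix the axis of a hyperbolic [g] in PGL(2, F_q[t]). Some power of [g]
   commutes with [h] in GL(2, F_q[t]), because vertex stabilizers are finite. If [h]
   is not trivial, then this power lies in F_q(t)[h] with [h] of finite order, and this
   forces its trace to be constant, so [g] has finite order: a
   contradiction. Hence axes have trivial pointwise stabilizers. In particular
   c = 1 as soon as there are hyperbolic elements, and both zeta functions are 1
   otherwise.
   Every hyperbolic element is then a power of a unique primitive one, so that
   primitive classes correspond to oriented axes modulo Gamma. Let [d] be a prime
   cycle of the quotient with length [l] and [e] an edge over its first edge.
   Each [g] mapping [e] to the end of a reduced path over [d^k] has an axis through
   [e]; there are [w(d)^k |Gamma_e|] such [g], and each primitive class [C] over [d]
   with [l(C) | k l] contributes [(l(C) / l) |Gamma_e|] of them through its powers.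
   Hence [sum_C l(C) = l w(d)^k], which is the equality of the logarithmic
   derivatives of the two Euler products, cycle by cycle. *)
Require Import Defs.
From HB Require Import structures.
From mathcomp Require Import all_boot all_order all_algebra finmap.
From mathcomp Require Import mathcomp_extra boolp classical_sets functions cardinality.
From mathcomp Require Import zify ring.

Set Implicit Arguments.
Unset Strict Implicit.
Unset Printing Implicit Defensive.

Import GRing.Theory.
Local Open Scope classical_set_scope.
Local Open Scope ring_scope.

(** * Formal power series and infinite products *)

(** The index sets may be infinite and neither product is assumed to converge, so the products are
    compared modulo [u^(n+1)]. A factor is invisible there if it is long or has weight 0;
    convergence therefore means that each length has finitely many indices of nonzero weight, and
    the count over each cycle transfers this finiteness in both directions. If it fails, both
    products take the same default value. Cycles of weight 0, which backtrack along an edge of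
    weight 1, carry no class. The exactness of the count rests on the trivial stabilizers of axes:
    an element is determined by its effect on a ray. Rays are one-sided sequences of edges; their
    direction keeps [g] and [g^-1] apart. The triviality itself splits into two cases. A nonscalar
    matrix with constant trace and determinant either has an eigenvalue in [F_q] or has an
    anisotropic norm form; a matrix of unit determinant commuting with it has constant trace for a
    different reason in each case. *)

Section FpsLemmas.
Variable R : comNzRingType.
Implicit Types f g : {fps R}.

Lemma fpsE_sub f g n : (f - g) n = f n - g n. Proof. by []. Qed.

Lemma fpsE_sum (I : Type) (s : seq I) (F : I -> {fps R}) n :
  coefs (\sum_(i <- s) F i) n = \sum_(i <- s) coefs (F i) n.
Proof. by elim: s => [|i s IH]; rewrite ?big_nil ?fpsE0 // !big_cons fpsED IH. Qed.

Lemma fpsE_CM c f n : (fpsC c * f) n = c * f n.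
Proof.
rewrite fpsEM big_ord_recl /= subn0 big1 ?addr0 // => i _.
by rewrite mul0r.
Qed.

Lemma fpsE_XM f n : (fpsX * f) n = if n is m.+1 then f m else 0.
Proof.
rewrite fpsEM; case: n => [|n]; first by rewrite big_ord1 /= mul0r.
rewrite big_ord_recl /= mul0r add0r big_ord_recl /= mul1r subn1 big1 ?addr0 //.
by move=> i _; rewrite mul0r.
Qed.

Lemma fpsE_XnM l f n : (fpsX ^+ l * f) n = if (n < l)%N then 0 else f (n - l)%N.
Proof.
elim: l n => [|l IH] n; first by rewrite expr0 mul1r subn0.
rewrite exprS -mulrA fpsE_XM; by case: n.
Qed.

(** Inverses of series are chosen classically, so the coefficients of an Euler factor are reached
    through this explicit geometric series. *)
Definition fps_geom (w : R) (l : nat) : {fps R} :=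
  Fps (fun n => if (l %| n)%N then w ^+ (n %/ l) else 0).

Lemma fps_geomE w l : (0 < l)%N ->
  (1 - fpsC w * fpsX ^+ l) * fps_geom w l = 1.
Proof.
move=> l0; apply/fpsP => n; rewrite mulrBl mul1r -mulrA fpsE_sub fpsE_CM fpsE_XnM fpsE1 /=.
case: ltnP => ln.
  rewrite mulr0 subr0; case: n ln => [|n] ln; first by rewrite dvdn0 div0n.
  by rewrite gtnNdvd.
have [m ->] : exists m, n = (l + m)%N by exists (n - l)%N; rewrite subnKC.
rewrite addKn dvdn_addr // divnDl // divnn l0 add1n addn_eq0 eqn0Ngt l0 /=.
by case: ifP => _; rewrite ?mulr0 ?exprS subrr.
Qed.

Lemma fps_geom_inv w l : (0 < l)%N ->
  (1 - fpsC w * fpsX ^+ l)^-1 = fps_geom w l.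
Proof.
move=> l0; have E := fps_geomE w l0.
have U : (1 - fpsC w * fpsX ^+ l) \is a GRing.unit by apply/unitrPr; exists (fps_geom w l).
by apply: (mulrI U); rewrite E mulrV.
Qed.

Definition fps_eq_upto n f g := forall i, (i <= n)%N -> coefs f i = coefs g i.

Lemma fps_eq_upto_mul n f f' g g' :
  fps_eq_upto n f f' -> fps_eq_upto n g g' -> fps_eq_upto n (f * g) (f' * g').
Proof.
move=> ff gg i le; rewrite !fpsEM; apply: eq_bigr => -[j /= lt] _.
by rewrite ff ?gg // ?(leq_trans _ le) // leq_subr.
Qed.

(** These are the two ways in which an Euler factor is congruent to 1 modulo [u^(n+1)]. *)
Lemma fps_geom_upto n w l : (n < l)%N \/ (w = 0 /\ (0 < l)%N) ->
  fps_eq_upto n (fps_geom w l) 1.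
Proof.
move=> H [|i] le; rewrite fpsE1 /= ?dvdn0 ?div0n //.
case: H => [lt|[-> l0]]; first by rewrite gtnNdvd // (leq_ltn_trans le).
case: ifP => // /dvdnP[m E]; rewrite E mulnK // expr0n; case: m E => //.
Qed.

Lemma fps_geom0 w l : fps_geom w l 0%N = 1.
Proof. by rewrite /= dvdn0 div0n. Qed.

Lemma fps_prod_geom0 (I : Type) (s : seq I) (w : I -> R) (l : I -> nat) :
  coefs (\prod_(i <- s) fps_geom (w i) (l i)) 0%N = 1.
Proof.
elim: s => [|i s IH]; first by rewrite big_nil fpsE1.
by rewrite big_cons fpsEM big_ord1 subn0 IH fps_geom0 mulr1.
Qed.

(** The derivation [u d/du], which preserves degrees, unlike [d/du]. *)
Definition fps_theta f : {fps R} := Fps (fun n => n%:R * f n).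

Lemma fpsE_theta f n : fps_theta f n = n%:R * f n. Proof. by []. Qed.

Lemma fps_thetaM f g : fps_theta (f * g) = fps_theta f * g + f * fps_theta g.
Proof.
apply/fpsP => n; rewrite fpsED !fpsEM /= mulr_sumr -big_split /=.
apply: eq_bigr => -[i /= lt] _.
have {1}-> : n = (i + (n - i))%N by rewrite subnKC.
by rewrite natrD mulrDl !mulrA [f i * _]mulrC.
Qed.

Lemma fps_theta_sub f g : fps_theta (f - g) = fps_theta f - fps_theta g.
Proof. by apply/fpsP => n; rewrite fpsE_sub /= mulrBr. Qed.

(** The logarithmic derivative [l w u^l / (1 - w u^l)] of a geometric factor; it has no constant
    term. *)
Definition fps_lambert (w : R) (l : nat) : {fps R} :=
  Fps (fun n => if (0 < n)%N && (l %| n)%N then l%:R * w ^+ (n %/ l) else 0).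

Lemma fps_theta_geom w l : (0 < l)%N ->
  fps_theta (fps_geom w l) = fps_lambert w l * fps_geom w l.
Proof.
move=> l0; set P := fpsC w * fpsX ^+ l; set g := fps_geom w l.
have E : (1 - P) * g = 1 := fps_geomE w l0.
have tP : fps_theta P = fpsC l%:R * P.
  apply/fpsP => n; rewrite fpsE_theta /P !fpsE_CM -[fpsX ^+ l]mulr1 fpsE_XnM fpsE1.
  case: ltnP => ln; first by rewrite !mulr0.
  have [->|ne] := eqVneq n l; first by [].
  by rewrite subn_eq0 leqNgt ltn_neqAle eq_sym ne ln /= !mulr0.
have L : fps_lambert w l = fpsC l%:R * P * g.
  apply/fpsP => n; rewrite /P -!mulrA !fpsE_CM fpsE_XnM /=.
  case: (ltnP n l) => ln.
    rewrite !mulr0; case: n ln => // n ln; by rewrite gtnNdvd.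
  have [m ->] : exists m, n = (l + m)%N by exists (n - l)%N; rewrite subnKC.
  rewrite addKn addn_gt0 l0 /= dvdn_addr // divnDl // divnn l0 add1n.
  by case: ifP => _; rewrite ?mulr0 // exprS.
have t1 : fps_theta 1 = 0 :> {fps R}.
  by apply/fpsP => -[|n]; rewrite fpsE0 /= ?mul0r ?mulr0.
have D := congr1 fps_theta E; rewrite fps_thetaM fps_theta_sub t1 sub0r tP in D.
have D' : (1 - P) * fps_theta g = fpsC l%:R * P * g.
  by apply/eqP; rewrite -subr_eq0 addrC -mulNr D.
by rewrite L -D' mulrAC E mul1r.
Qed.

Lemma fps_theta_prod (I : eqType) (s : seq I) (w : I -> R) (l : I -> nat) :
  (forall i, i \in s -> (0 < l i)%N) ->
  fps_theta (\prod_(i <- s) fps_geom (w i) (l i)) =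
  (\sum_(i <- s) fps_lambert (w i) (l i)) * \prod_(i <- s) fps_geom (w i) (l i).
Proof.
elim: s => [|i s IH] l0.
  rewrite !big_nil mul0r.
  by apply/fpsP => -[|n]; rewrite fpsE0 /= ?mul0r ?mulr0.
rewrite !big_cons fps_thetaM fps_theta_geom ?l0 ?mem_head // IH => [|j js].
  by rewrite mulrDl -!mulrA [X in _ + X]mulrCA.
by apply: l0; rewrite inE js orbT.
Qed.

End FpsLemmas.

(** As [S] has no constant term, [theta f = S f] expresses [n f_n] through earlier coefficients of
    [f], and characteristic 0 allows the cancellation of [n]. *)
Lemma fps_theta_inj_upto (R : numDomainType) (f g S S' : {fps R}) n :
  fps_theta f = S * f -> fps_theta g = S' * g -> f 0%N = g 0%N ->
  S 0%N = 0 -> fps_eq_upto n S S' -> fps_eq_upto n f g.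
Proof.
move=> tf tg fg0 S0 SS; elim/ltn_ind => -[|i] IH le //.
have /(congr1 (fun h : {fps R} => coefs h i.+1)) := tf.
have /(congr1 (fun h : {fps R} => coefs h i.+1)) := tg.
rewrite !fpsEM /= => Eg Ef; apply: (@mulfI R i.+1%:R); first by rewrite Num.Theory.pnatr_eq0.
rewrite Ef Eg; apply: eq_bigr => -[[|j] /= lt] _.
  by rewrite -(SS 0%N) // S0 !mul0r.
rewrite SS ?(leq_trans _ le) // IH ?(leq_trans (leq_subr _ _)) //.
  by rewrite subSS ltnS leq_subr.
Qed.

(** * Finite cardinalities and counting by fibers *)

Section SetSize.
Implicit Types T U : eqType.

Definition set_size T (A : set T) (n : nat) :=
  exists s : seq T, [/\ uniq s, size s = n & forall x, A x <-> x \in s].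

Lemma set_size_uniq T (A : set T) m n : set_size A m -> set_size A n -> m = n.
Proof.
move=> [s [us <- sA]] [t [ut <- tA]]; apply/perm_size/uniq_perm => // x.
by apply/idP/idP => [/sA/tA|/tA/sA].
Qed.

Lemma set_size_finite T (A : set T) n : set_size A n -> finite_set A.
Proof.
move=> [s [_ _ sA]]; apply/finite_seqP; exists s.
by apply/seteqP; split=> x /= /sA.
Qed.

Lemma finite_set_size T (A : set T) : finite_set A -> exists n, set_size A n.
Proof.
move=> /finite_seqP[s ->]; exists (size (undup s)), (undup s).
by split=> // [|x]; rewrite ?undup_uniq // mem_undup.
Qed.

Lemma set_size_image T U (f : T -> U) (A : set T) n :
  (forall x y, A x -> A y -> f x = f y -> x = y) ->
  set_size A n -> set_size (f @` A) n.
Proof.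
move=> inj [s [us ss sA]]; exists (map f s); split.
- by rewrite map_inj_in_uniq // => x y /sA Ax /sA Ay; apply: inj.
- by rewrite size_map.
move=> y; split=> [[x /sA xs <-]|/mapP[x /sA xs ->]]; first exact: map_f.
by exists x.
Qed.

Lemma set_size_fibers T U (f : T -> U) (A : set T) (t : seq U) (m : U -> nat) :
  uniq t -> (forall x, A x -> f x \in t) ->
  (forall y, y \in t -> set_size (A `&` [set x | f x = y]) (m y)) ->
  set_size A (\sum_(y <- t) m y)%N.
Proof.
move=> ut At fib.
pose sf y := if pselect (y \in t) is left yt then projT1 (cid (fib y yt)) else [::].
have sfP y : y \in t -> [/\ uniq (sf y), size (sf y) = m y &
    forall x, (A `&` [set x | f x = y]) x <-> x \in sf y].
  by rewrite /sf; case: pselect => // yt _; case: cid.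
pose s := undup (flatten [seq sf y | y <- t]).
have sA x : A x <-> x \in s.
  rewrite mem_undup; split=> [Ax|/flattenP[_ /mapP[y /sfP[_ _ H] ->] /H[]//]].
  apply/flattenP; exists (sf (f x)); first by apply/map_f/At.
  by have [_ _ H] := sfP _ (At x Ax); apply/H.
exists s; split=> //; first exact: undup_uniq.
have us : uniq s := undup_uniq _.
rewrite -sum1_size.
transitivity (\sum_(x <- s) \sum_(y <- t) (f x == y))%N.
  rewrite !big_seq; apply: eq_bigr => x /sA/At xt.
  rewrite (bigD1_seq (f x)) //= eqxx big1 // => y.
  by rewrite eq_sym => /negbTE->.
rewrite exchange_big /= !big_seq; apply: eq_bigr => y yt.
have [us' <- H] := sfP _ yt.
transitivity (\sum_(x <- s | f x == y) 1)%N; first by rewrite [RHS]big_mkcond.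
rewrite sum1_count -size_filter; apply/perm_size/uniq_perm; rewrite ?filter_uniq //.
move=> x; rewrite mem_filter; apply/andP/idP => [[/eqP fx /sA Ax]|/H[Ax fx]].
  exact/H.
by split; [apply/eqP|apply/sA].
Qed.

Lemma set_size_sum T U (f : T -> U) (A : set T) N (t : seq U) (m : U -> nat) :
  set_size A N -> uniq t -> (forall x, A x -> f x \in t) ->
  (forall y, y \in t -> set_size (A `&` [set x | f x = y]) (m y)) ->
  (N = \sum_(y <- t) m y)%N.
Proof. by move=> AN ut At fib; apply: set_size_uniq AN _; apply: set_size_fibers fib. Qed.

Lemma set_size_fibration T U (f : T -> U) (A : set T) (B : set U) n m :
  set_size B n -> (forall x, A x -> B (f x)) ->
  (forall y, B y -> set_size (A `&` [set x | f x = y]) m) ->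
  set_size A (n * m).
Proof.
move=> [t [ut <- tB]] AB fib.
have <- : (\sum_(y <- t) m = size t * m)%N.
  by rewrite big_const_seq count_predT iter_addn_0 mulnC.
apply: (@set_size_fibers _ _ f) => // [x /AB/tB //|y /tB]; exact: fib.
Qed.

Lemma set_size_gt0 T (A : set T) n x : set_size A n -> A x -> (0 < n)%N.
Proof. by move=> [[|y s] [_ <- sA]] /sA. Qed.

End SetSize.

Lemma set_size_ncard (T : choiceType) n : set_size [set: T] n -> ncard T = n.
Proof.
move=> H; have fin := set_size_finite H; apply: set_size_uniq H.
exists (fset_set [set: T]); split=> // x; by rewrite in_fset_set // in_setT.
Qed.

(** * Convergence of infinite products *)

Section Multipliable.
Variables (I : choiceType) (A : set I) (f : I -> {fps rat}) (w : I -> rat) (l : I -> nat).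
Hypothesis l_gt0 : forall a, A a -> (0 < l a)%N.
Hypothesis fE : forall a, A a -> f a = fps_geom (w a) (l a).

Lemma fps_prodE Z : is_fps_prod A f Z -> fps_prod A f = Z.
Proof.
move=> HZ; apply: xget_unique => // Z' HZ'; apply/fpsP => n.
have [J JA JP] := HZ n; have [J' JA' JP'] := HZ' n.
have sub : [set` (J `|` J')%fset] `<=` A.
  by move=> x; rewrite /= in_fsetU => /orP[/JA|/JA'].
by rewrite -(JP (J `|` J')%fset) ?fsubsetUl // -(JP' (J `|` J')%fset) ?fsubsetUr.
Qed.

Let sig n := [set a | A a /\ w a <> 0 /\ (l a <= n)%N].

(** Adjoining to a finite subproduct a new factor of length [n] adds [w a] to coefficient [n],
    because constant terms are 1. Once this coefficient is stable, [w a] must vanish. *)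
Lemma multipliable_finite n : fps_multipliable A f ->
  finite_set [set a | A a /\ w a <> 0 /\ l a = n].
Proof.
move=> [Z HZ]; have [J JA JP] := HZ n.
apply: (@sub_finite_set _ _ [set` J]); last exact: finite_fset.
move=> a [Aa [wa la]] /=; apply/negPn/negP => aJ; apply: wa.
have JaA : [set` (a |` J)%fset] `<=` A.
  by move=> x; rewrite /= !inE => /predU1P[->|/JA].
have := JP _ (fsubsetU1 a J) JaA; rewrite -(JP J) ?fsubset_refl //.
have JE : \prod_(i <- J) f i = \prod_(i <- J) fps_geom (w i) (l i).
  by rewrite !big_seq; apply: eq_bigr => i /JA/fE.
rewrite big_fsetU1 // JE fE // fpsEM.
case: n la {JP} => [|n] la; first by have := l_gt0 Aa; rewrite la.
rewrite big_ord_recr big_ord_recl /= dvdn0 div0n mul1r subn0 subnn.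
rewrite -[X in _ * X]/(coefs _ 0%N) fps_prod_geom0 mulr1 la dvdnn divnn /= expr1.
rewrite [\sum_(i < n) _]big1; last first.
  by move=> i _; rewrite /bump leq0n add1n gtnNdvd ?ltnS ?ltn_ord // mul0r.
by rewrite addr0 -[X in _ = X]addr0 => /addrI.
Qed.

Lemma fps_prod_upto n (J J' : {fset I}) : [set` J'] `<=` A -> (J `<=` J')%fset ->
  (forall a, sig n a -> a \in J) ->
  fps_eq_upto n (\prod_(i <- J') f i) (\prod_(i <- J) f i).
Proof.
move=> J'A JJ' sJ; pose f' i := if i \in J then f i else 1.
have -> : \prod_(i <- J) f i = \prod_(i <- J') f' i.
  rewrite -(big_fset_incl _ JJ') => [|x _ /negbTE xJ]; last by rewrite /f' xJ.
  by rewrite !big_seq; apply: eq_bigr => i iJ; rewrite /f' iJ.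
have : forall i, i \in (J' : seq I) -> A i by move=> i /J'A.
elim: (J' : seq I) => [|i s IH] sA; first by rewrite !big_nil.
rewrite !big_cons; apply: fps_eq_upto_mul; last first.
  by apply: IH => j js; apply: sA; rewrite inE js orbT.
have Ai : A i by apply: sA; rewrite mem_head.
rewrite /f'; case: ifP => // /negbT iJ; rewrite fE //; apply: fps_geom_upto.
have [ln|ln] := leqP (l i) n; last by left.
right; split; last exact: l_gt0.
by apply: contrapT => wi; move/negP: iJ; apply; apply: sJ.
Qed.

Lemma fin_sig n : (forall m, finite_set [set a | A a /\ w a <> 0 /\ l a = m]) ->
  finite_set (sig n).
Proof.
move=> fin; elim: n => [|n IH].
  by apply: sub_finite_set (fin 0%N) => a [Aa [wa]]; rewrite leqn0 => /eqP.
apply: (@sub_finite_set _ _ (sig n `|` [set a | A a /\ w a <> 0 /\ l a = n.+1])).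
  move=> a [Aa [wa]]; rewrite leq_eqVlt => /orP[/eqP la|ln]; first by right.
  by left.
by rewrite finite_setU.
Qed.

Lemma finite_multipliable :
  (forall n, finite_set [set a | A a /\ w a <> 0 /\ l a = n]) ->
  fps_multipliable A f /\
  forall n (J : {fset I}), [set` J] `<=` A -> (forall a, sig n a -> a \in J) ->
    fps_eq_upto n (fps_prod A f) (\prod_(i <- J) fps_geom (w i) (l i)).
Proof.
move=> fin; have fs n := fin_sig n fin.
(* Coefficient [n] already has its final value on the factors of nonzero weight and length at most
   [n]. *)
pose Z : {fps rat} := Fps (fun n => (\prod_(i <- fset_set (sig n)) f i) n).
have sub n : [set` fset_set (sig n)] `<=` A.
  by move=> x; rewrite /= in_fset_set // => /set_mem[].
have sin n a : sig n a -> a \in fset_set (sig n).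
  by move=> H; rewrite in_fset_set //; apply/mem_set.
have HZ : is_fps_prod A f Z.
  move=> n; exists (fset_set (sig n)) => // J sJ JA.
  by apply: (fps_prod_upto JA sJ (sin n)).
split=> [|n J JA sJ]; first by exists Z.
rewrite (fps_prodE HZ) => i ile.
have -> : \prod_(i <- J) fps_geom (w i) (l i) = \prod_(i <- J) f i.
  by rewrite !big_seq; apply: eq_bigr => j /JA/fE.
rewrite /Z /=; symmetry; apply: (fps_prod_upto (n := i)) => //; last exact: sin.
apply/fsubsetP => a; rewrite in_fset_set // => /set_mem[Aa [wa la]].
by apply: sJ; split=> //; split=> //; apply: leq_trans ile.
Qed.

End Multipliable.

(** * Comparison of two Euler products along a map of their indices *)

Section EulerCompare.
Variables (I J : choiceType) (A : set I) (B : set J).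
Variables (f : I -> {fps rat}) (l : I -> nat).
Variables (g : J -> {fps rat}) (w : J -> rat) (m : J -> nat) (phi : I -> J).
Hypothesis l_gt0 : forall a, A a -> (0 < l a)%N.
Hypothesis m_gt0 : forall b, B b -> (0 < m b)%N.
Hypothesis fE : forall a, A a -> f a = fps_geom 1 (l a).
Hypothesis gE : forall b, B b -> g b = fps_geom (w b) (m b).
Hypothesis phiB : forall a, A a -> B (phi a).
Hypothesis phi_dvd : forall a, A a -> (m (phi a) %| l a)%N.
Hypothesis phi_sum : forall b k, B b -> (0 < k)%N -> exists s : seq I,
  [/\ uniq s, forall a, [/\ A a, phi a = b & (l a %| k * m b)%N] <-> a \in s &
      (\sum_(a <- s) l a)%:R = (m b)%:R * w b ^+ k].

Let natr_neq0 n : (0 < n)%N -> n%:R != 0 :> rat.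
Proof. by rewrite Num.Theory.pnatr_eq0 -lt0n. Qed.

Let w_phi a : A a -> w (phi a) <> 0.
Proof.
move=> Aa w0; have /dvdnP[k lE] := phi_dvd Aa.
have k0 : (0 < k)%N by have := l_gt0 Aa; rewrite lE muln_gt0 => /andP[].
have [s [us sP]] := phi_sum (phiB Aa) k0.
rewrite w0 expr0n eqn0Ngt k0 mulr0 (big_rem a) /=; last first.
  by apply/sP; split=> //; rewrite -lE.
by apply/eqP/natr_neq0; rewrite addn_gt0 l_gt0.
Qed.

Let w_dvd b k : B b -> w b <> 0 -> (0 < k)%N ->
  exists a, [/\ A a, phi a = b & (l a %| k * m b)%N].
Proof.
move=> Bb wb k0; have [[|a s] [us sP sE]] := phi_sum Bb k0; last first.
  by exists a; apply/sP; rewrite mem_head.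
move/eqP: sE; rewrite big_nil eq_sym mulf_eq0 expf_eq0 k0 (negbTE (natr_neq0 (m_gt0 Bb))).
by move/eqP: wb => /negbTE->.
Qed.

Let finA n := finite_set [set a | A a /\ (1 : rat) <> 0 /\ l a = n].
Let finB n := finite_set [set b | B b /\ w b <> 0 /\ m b = n].

Let finAB : (forall n, finA n) -> forall n, finB n.
Proof.
(* By [phi_sum] with [k = 1], an index [b] of nonzero weight has some [a] above it with [l a]
   dividing [m b]; by [phi_dvd] the two lengths are equal. *)
move=> fA n; apply: (@sub_finite_set _ _ (phi @` [set a | A a /\ (1 : rat) <> 0 /\ l a = n])).
  move=> b [Bb [wb mb]]; have [a [Aa pa la]] := w_dvd Bb wb (isT : (0 < 1)%N).
  exists a => //; split=> //; split; first by apply/eqP; rewrite oner_eq0.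
  by apply/eqP; rewrite eqn_dvd -mb -{2}pa phi_dvd // andbT -[m b]mul1n.
exact: finite_image (fA n).
Qed.

Let finBA : (forall n, finB n) -> forall n, finA n.
Proof.
move=> fB n.
have fsB := fin_sig (A := B) (w := w) (l := m) n fB.
apply: (@sub_finite_set _ _
  (\bigcup_(b in [set b | B b /\ w b <> 0 /\ (m b <= n)%N])
     [set a | [/\ A a, phi a = b & (l a %| n)%N]])).
  move=> a [Aa [_ la]]; exists (phi a); last by split=> //; rewrite la.
  split; first exact: phiB.
  split; first exact: w_phi.
  by rewrite -la dvdn_leq ?l_gt0 ?phi_dvd.
apply: bigcup_finite => // b [Bb [wb mb]].
have [n0|] := posnP n; first by have := m_gt0 Bb; rewrite ltnNge (leq_trans mb) // n0.
move=> n0; have [s [_ sP _]] := phi_sum Bb n0.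
apply: (@sub_finite_set _ _ [set` s]) => // a [Aa pa la]; apply/sP; split=> //.
by rewrite dvdn_mulr.
Qed.

(** In degree [i] the first logarithmic derivative is the sum of the [l a] that divide [i]. Grouped
    by [b = phi a], only those [b] with [i = k * m b] occur, and [phi_sum] turns each group into the
    term of [b] in the second one. *)
Theorem euler_product_eq :
  (fps_multipliable A f <-> fps_multipliable B g) /\ fps_prod A f = fps_prod B g.
Proof.
have mA := @multipliable_finite _ A f (fun=> 1) l l_gt0 fE.
have mB := @multipliable_finite _ B g w m m_gt0 gE.
have fmA := @finite_multipliable _ A f (fun=> 1) l l_gt0 fE.
have fmB := @finite_multipliable _ B g w m m_gt0 gE.
have iff : fps_multipliable A f <-> fps_multipliable B g.
  split=> H; first by have [] := fmB (finAB (fun n => mA n H)).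
  by have [] := fmA (finBA (fun n => mB n H)).
(* When neither family is multipliable, both sides are the default value 1 of [fps_prod]. *)
split=> //; have [HA|nA] := pselect (fps_multipliable A f); last first.
  have nB : ~ fps_multipliable B g by move/iff.
  rewrite /fps_prod !xgetPN // => Z HZ; [apply: nB|apply: nA]; by exists Z.
have fA n := mA n HA; have fB n := mB n (iff.1 HA).
have [_ uA] := fmA fA; have [_ uB] := fmB fB.
apply/fpsP => n.
have sA := fin_sig n fA; have sB := fin_sig n fB.
set SA := [set a | _] in sA; set SB := [set b | _] in sB.
pose JA := fset_set SA; pose JB := fset_set SB.
have JAP a : (a \in JA) = `[< SA a >] by rewrite in_fset_set.
have JBP b : (b \in JB) = `[< SB b >] by rewrite in_fset_set.
rewrite (uA n JA) //; first last.
- by move=> a Sa; rewrite JAP; apply/asboolP.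
- by move=> a; rewrite /= JAP => /asboolP[].
rewrite (uB n JB) //; first last.
- by move=> a Sa; rewrite JBP; apply/asboolP.
- by move=> a; rewrite /= JBP => /asboolP[].
have lA a : a \in (JA : seq I) -> (0 < l a)%N by rewrite JAP => /asboolP[Aa _]; apply: l_gt0.
have lB b : b \in (JB : seq J) -> (0 < m b)%N by rewrite JBP => /asboolP[Bb _]; apply: m_gt0.
have tA := @fps_theta_prod rat _ _ (fun=> 1) l lA.
have tB := @fps_theta_prod rat _ _ w m lB.
suff S : fps_eq_upto n (\sum_(a <- JA) fps_lambert (1 : rat) (l a))
    (\sum_(b <- JB) fps_lambert (w b) (m b)).
  apply: (fps_theta_inj_upto tA tB _ _ S (leqnn n)).
    by rewrite !fps_prod_geom0.
  by rewrite fpsE_sum big1.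
move=> i le; rewrite !fpsE_sum.
have [->|i0] := posnP i; first by rewrite [LHS]big1 // [RHS]big1.
transitivity ((\sum_(a <- JA | (l a %| i)%N) l a)%N%:R : rat).
  rewrite natr_sum [RHS]big_mkcond; apply: eq_bigr => a _ /=.
  by rewrite i0 expr1n mulr1.
have -> : (\sum_(a <- JA | l a %| i) l a =
    \sum_(b <- JB) \sum_(a <- JA | (l a %| i) && (phi a == b)) l a)%N.
  rewrite (exchange_big_dep (fun a => l a %| i)%N) //=; last by move=> b a _ /andP[].
  rewrite big_seq_cond [RHS]big_seq_cond; apply: eq_bigr => a /andP[].
  rewrite JAP => /asboolP[Aa [_ la]] ai.
  rewrite (eq_bigl (fun b => b == phi a)) => [|b]; last by rewrite ai /= eq_sym.
  have inB : phi a \in JB.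
    rewrite JBP; apply/asboolP; split; first exact: phiB.
    split; first exact: w_phi.
    by apply: leq_trans la; rewrite dvdn_leq ?l_gt0 ?phi_dvd.
  by rewrite big_const_seq count_uniq_mem ?fset_uniq // inB /= addn0.
rewrite natr_sum !big_seq; apply: eq_bigr => b; rewrite JBP => /asboolP[Bb [wb mb]].
rewrite /= i0 /=; case: ifPn => [/dvdnP[k iE]|ndvd]; last first.
  rewrite big1_seq // => a /andP[/andP[ai /eqP pa]]; rewrite JAP => /asboolP[Aa _].
  by case/negP: ndvd; rewrite -pa (dvdn_trans (phi_dvd Aa)).
have k0 : (0 < k)%N by move: i0; rewrite iE muln_gt0 => /andP[].
have [s [us sP sE]] := phi_sum Bb k0.
rewrite iE mulnK ?m_gt0 // -sE -big_filter; rewrite (perm_big s) //.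
apply: uniq_perm => // [|a]; first by rewrite filter_uniq.
rewrite mem_filter -iE; apply/idP/idP => [/andP[/andP[ai /eqP pa]]|/sP[Aa pa]].
  by rewrite JAP => /asboolP[Aa _]; apply/sP; rewrite -iE.
rewrite -iE => la; rewrite la pa eqxx /= JAP; apply/asboolP; split=> //.
split; first by apply/eqP; rewrite oner_eq0.
by rewrite (leq_trans _ le) // dvdn_leq.
Qed.

End EulerCompare.

(** * Trees and axes of hyperbolic elements *)

Lemma natminP (A : set nat) : A !=set0 ->
  A (natmin A) /\ forall m, A m -> (natmin A <= m)%N.
Proof.
move=> [n An]; rewrite /natmin.
apply: (@xgetPex _ _ [set n | A n /\ forall m, A m -> (n <= m)%N]).
have ex : exists n, `[< A n >] by exists n; apply/asboolP.
exists (ex_minn ex); case: ex_minnP => k /asboolP Ak kmin; split=> // m Am.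
by apply: kmin; apply/asboolP.
Qed.

Lemma natmin_eq (A : set nat) n : A n -> (forall m, A m -> (n <= m)%N) -> natmin A = n.
Proof.
move=> An nmin; have [Am mmin] := natminP (ex_intro _ n An).
by apply/eqP; rewrite eqn_leq mmin // nmin.
Qed.

Section Reduced.
Variable T : graph.
Implicit Types (e f : edge T) (s p q : seq (edge T)) (x y z : vert T).

Definition nonback e f := (src f == tgt e) && (f != einv e).

Definition acyclic := forall e s, path nonback e s -> tgt (last e s) <> src e.
Definition connected := forall x y, exists p, is_path x p y.

Definition reduced p := if p is e :: s then path nonback e s else true.

Lemma nonback_inv e f : nonback (einv f) (einv e) = nonback e f.
Proof.
by rewrite /nonback src_einv tgt_einv einvK [tgt e == _]eq_sym [einv e == f]eq_sym.
Qed.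

Lemma is_path_cat x y z p q : is_path x p y -> is_path y q z -> is_path x (p ++ q) z.
Proof. by elim: p x => [x /= ->|e p IH x /= [-> /IH H] /H]. Qed.

Lemma is_path_rcons x p e : is_path x p (src e) -> is_path x (rcons p e) (tgt e).
Proof. by rewrite -cats1 => /is_path_cat; apply. Qed.

Lemma is_path_rev x p y : is_path x p y -> is_path y (rev (map (@einv T) p)) x.
Proof.
elim: p x => [x //|e p IH x /= [<- /IH H]].
by rewrite rev_cons -tgt_einv; apply: is_path_rcons; rewrite src_einv.
Qed.

Lemma reduced_is_path e s : path nonback e s -> is_path (src e) (e :: s) (tgt (last e s)).
Proof.
elim: s e => [|f s IH] e //= /andP[/andP[/eqP fe _] /IH]; rewrite /= fe.
by move=> [_ H].
Qed.

Lemma is_path_cons x e s y : is_path x (e :: s) y -> src e = x /\ tgt (last e s) = y.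
Proof. by elim: s e x => [|f s IH] e x /= [-> //] /IH[]. Qed.

Lemma is_path_reduce x p y : is_path x p y ->
  exists q, [/\ is_path x q y, (size q <= size p)%N & reduced q].
Proof.
elim: p x => [|e p IH] x /=; first by move=> ->; exists [::].
move=> [ex /IH[[|f q] [qP le red]]]; first by exists [:: e].
have [fe _] := is_path_cons qP.
have [fE|nfe] := eqVneq f (einv e).
  exists q; split; first by move: qP => /= [_]; rewrite fE tgt_einv ex.
    by rewrite (leq_trans _ (leqW le)) //= leqnSn.
  by move: red; case: (q) => //= g r /andP[].
by exists [:: e, f & q]; split=> //; rewrite /= /nonback fe eqxx nfe.
Qed.

Lemma reduced_rev e s : path nonback e s ->
  path nonback (einv (last e s)) (rev (map (@einv T) (belast e s))).
Proof.
rewrite -map_rev path_map rev_path => H; rewrite (eq_path (e' := nonback)) //.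
by move=> f g; rewrite /= nonback_inv.
Qed.

Lemma last_rev_belast e s : last (einv (last e s)) (rev (map (@einv T) (belast e s))) = einv e.
Proof. by case: s => [|f s] //=; rewrite rev_cons last_rcons. Qed.

Section Tree.
Hypothesis T_acyclic : acyclic.
Hypothesis T_connected : connected.

(** At the first place where the two paths diverge, going back along one and out along the other is
    a closed path without backtracking. *)
Lemma reduced_uniq e s f t : path nonback e s -> path nonback f t ->
  src e = src f -> tgt (last e s) = tgt (last f t) -> e :: s = f :: t.
Proof.
have diverge e' s' f' t' : path nonback e' s' -> path nonback f' t' ->
    src e' = src f' -> tgt (last e' s') = tgt (last f' t') -> f' = e'.
  move=> es ft se te; apply/eqP/negPn/negP => nef.
  have := reduced_rev es; set u := rev _ => uP.
  case: (@T_acyclic (einv (last e' s')) (u ++ f' :: t')).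
    by rewrite cat_path uP last_rev_belast /= /nonback tgt_einv einvK se eqxx nef.
  by rewrite last_cat /= src_einv -te.
elim: s e f t => [|e' s IH] e f t es ft se te.
  have ? := diverge _ _ _ _ es ft se te; subst f.
  case: t ft te => // g t /= /andP[/andP[/eqP fg _] gt] te.
  by case: (T_acyclic gt); rewrite -te -fg.
have ? := diverge _ _ _ _ es ft se te; subst f.
move: es => /= /andP[/andP[/eqP es _] e's].
case: t ft te => [_ /= te|g t /= /andP[/andP[/eqP eg _] gt] te].
  by case: (T_acyclic e's); rewrite te -es.
by congr (_ :: _); apply: IH => //; rewrite es eg.
Qed.

Lemma reduced_path_uniq x y p q : reduced p -> reduced q ->
  is_path x p y -> is_path x q y -> p = q.
Proof.
case: p q => [|e s] [|f t] //= rp rq.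
- by move=> <- /is_path_cons[fx tx]; case: (T_acyclic rq); rewrite fx.
- by move=> + xy; rewrite -xy => /is_path_cons[fx tx]; case: (T_acyclic rp); rewrite fx.
move=> /is_path_cons[ex ey] /is_path_cons[fx fy].
by apply: reduced_uniq; rewrite ?ex ?ey.
Qed.

Lemma dist_reduced x p y : reduced p -> is_path x p y -> dist x y = size p.
Proof.
move=> rp xpy; apply: natmin_eq; first by exists p.
move=> _ [q /is_path_reduce[q' [xq'y le rq']] <-].
by rewrite (reduced_path_uniq rp rq' xpy xq'y).
Qed.

Lemma ex_reduced x y : exists p, [/\ is_path x p y, reduced p & size p = dist x y].
Proof.
have [p /is_path_reduce[q [xqy _ rq]]] := T_connected x y.
by exists q; split=> //; rewrite (dist_reduced rq xqy).
Qed.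

Lemma dist_le_size x p y : is_path x p y -> (dist x y <= size p)%N.
Proof. by move=> /is_path_reduce[q [xqy le rq]]; rewrite (dist_reduced rq xqy). Qed.

Lemma dist_triangle x y z : (dist x z <= dist x y + dist y z)%N.
Proof.
have [p [xpy _ <-]] := ex_reduced x y; have [q [yqz _ <-]] := ex_reduced y z.
by rewrite -size_cat; apply: dist_le_size; apply: is_path_cat yqz.
Qed.

Lemma dist_sym x y : dist x y = dist y x.
Proof.
suff le (u v : vert T) : (dist u v <= dist v u)%N by apply/eqP; rewrite eqn_leq !le.
have [p [vpu _ <-]] := ex_reduced v u.
by rewrite -(size_map (@einv T)) -size_rev; apply/dist_le_size/is_path_rev.
Qed.

End Tree.

End Reduced.

Arguments nonback {T}.

Section Chain.
Variable T : graph.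
Implicit Types (p : nat -> edge T) (i n : nat).

Definition chain p := forall i, nonback (p i) (p i.+1).

(** The edge [p i] is left out because it is the head argument of [path nonback]. *)
Definition segment p i n := [seq p (i + j)%N | j <- iota 1 n].

Lemma segmentS p i n : segment p i n.+1 = p i.+1 :: segment p i.+1 n.
Proof.
rewrite /segment /= addn1; congr (_ :: _).
by rewrite -[2%N]/(1 + 1)%N iotaDl -map_comp; apply: eq_map => j /=; rewrite addnA addn1.
Qed.

Lemma chain_segment p i n : chain p -> path nonback (p i) (segment p i n).
Proof. by move=> cp; elim: n i => [|n IH] i //; rewrite segmentS /= cp IH. Qed.

Lemma last_segment p i n : last (p i) (segment p i n) = p (i + n)%N.
Proof. by elim: n i => [|n IH] i; rewrite ?addn0 // segmentS /= IH addSnnS. Qed.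

Lemma chain_src p i : chain p -> src (p i.+1) = tgt (p i).
Proof. by move=> /(_ i)/andP[/eqP]. Qed.

Lemma chain_dist p i n : acyclic T -> chain p -> dist (src (p i)) (src (p (i + n)%N)) = n.
Proof.
move=> ac cp; case: n => [|n]; first by rewrite addn0 (@dist_reduced T ac _ [::]).
rewrite addnS chain_src // -last_segment.
rewrite (@dist_reduced T ac _ (p i :: segment p i n)) ?size_map ?size_iota //.
  by rewrite /= size_map size_iota.
- exact: chain_segment.
exact/reduced_is_path/chain_segment.
Qed.

End Chain.

(** * Rays translated by a group element *)

Section Axis.
Variables (G : groupType) (T : graph) (a : action G T).
Implicit Types (g h : G) (p q : nat -> edge T).
Local Notation eact := (eact a).
Local Notation vact := (vact a).

Lemma vactVK g : cancel (vact g) (vact g^-1%g).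
Proof. by move=> x; rewrite -vactM mulVg vact1. Qed.

Lemma eactVK g : cancel (eact g) (eact g^-1%g).
Proof. by move=> x; rewrite -eactM mulVg eact1. Qed.

Lemma nonback_eact g e f : nonback (eact g e) (eact g f) = nonback e f.
Proof.
rewrite /nonback src_eact tgt_eact einv_eact.
by rewrite (inj_eq (can_inj (vactVK g))) (inj_eq (can_inj (eactVK g))).
Qed.

Lemma path_nonback_eact g e s :
  path nonback (eact g e) (map (eact g) s) = path nonback e s.
Proof. by rewrite path_map; apply: eq_path => f f' /=; apply: nonback_eact. Qed.

Lemma is_path_act g x s y : is_path x s y -> is_path (vact g x) (map (eact g) s) (vact g y).
Proof.
elim: s x => [x /= ->|e s IH x /= [<- /IH]] //.
by rewrite src_eact -tgt_eact.
Qed.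

(** A half-axis of [g], directed along its translation. The period [m] turns out to be the
    translation length, so having such a ray characterizes hyperbolic elements. *)
Definition axis_ray g m p :=
  [/\ (0 < m)%N, chain p & forall i, p (m + i)%N = eact g (p i)].

Lemma axis_ray_expE g m p k i : axis_ray g m p ->
  p (k * m + i)%N = eact (g ^+ k)%g (p i).
Proof.
move=> [_ _ gp]; elim: k => [|k IH]; first by rewrite eact1.
by rewrite mulSn -addnA gp IH expgS eactM.
Qed.

Lemma axis_ray_exp g m p k : (0 < k)%N -> axis_ray g m p ->
  axis_ray (g ^+ k)%g (k * m) p.
Proof.
move=> k0 r; have [m0 cp _] := r; split=> // [|i]; first by rewrite muln_gt0 k0.
exact: axis_ray_expE.
Qed.

Lemma axis_ray_shift g m p n : axis_ray g m p ->
  axis_ray g m (fun i => p (n + i)%N).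
Proof.
move=> [m0 cp gp]; split=> // i; first by rewrite addnS.
by rewrite addnCA gp.
Qed.

Lemma chain_eact h p : chain p -> chain (fun i => eact h (p i)).
Proof. by move=> cp i; rewrite nonback_eact. Qed.

Lemma axis_ray_conj g m p h : axis_ray g m p ->
  axis_ray (h * g * h^-1)%g m (fun i => eact h (p i)).
Proof.
move=> [m0 cp gp]; split=> // [|i]; first exact: chain_eact.
by rewrite gp -!eactM -mulgA mulVg mulg1.
Qed.

(** The translates of the path by the powers of [g] fit together; each junction is a translate of
    the last step of the path, into [g e]. *)
Lemma axis_ray_of_path g e s : path nonback e (rcons s (eact g e)) ->
  axis_ray g (size s).+1
    (fun i => eact (g ^+ (i %/ (size s).+1))%g (nth e (e :: s) (i %% (size s).+1))).
Proof.
set m := (size s).+1 => es; split=> // [i|i]; last first.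
  by rewrite divnDl ?dvdnn // divnn /= modnDl expgS eactM.
have rm : (i %% m < m)%N by rewrite ltn_mod.
have := divn_eq i m; move: (i %% m)%N (i %/ m)%N rm => r n rm ->.
rewrite -addnS divnMDl // modnMDl.
have : nonback (nth e (e :: s) r) (nth e (rcons s (eact g e)) r).
  have := pathP e es r; rewrite size_rcons => /(_ rm).
  by rewrite -rcons_cons nth_rcons /= -/m rm.
rewrite nth_rcons; move: rm; rewrite ltnS leq_eqVlt => /predU1P[->|rm].
  by rewrite ltnn eqxx divnn modnn addn1 expgSr eactM nonback_eact.
by rewrite rm divn_small ?ltnS // modn_small ?ltnS // addn0 nonback_eact.
Qed.

Hypothesis T_acyclic : acyclic T.
Hypothesis T_connected : connected T.

Let triangle := dist_triangle T_acyclic T_connected.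
Let dsym := dist_sym T_acyclic T_connected.

Lemma dist_act g x y : dist (vact g x) (vact g y) = dist x y.
Proof.
have le h u v : (dist (vact h u) (vact h v) <= dist u v)%N.
  have [p [uv _ <-]] := ex_reduced T_acyclic T_connected u v.
  rewrite -(size_map (eact h)); apply: dist_le_size => //; exact: is_path_act.
apply/eqP; rewrite eqn_leq le /=.
by rewrite -{1}(vactVK g x) -{1}(vactVK g y) le.
Qed.

Lemma axis_ray_src g m p i : axis_ray g m p -> vact g (src (p i)) = src (p (i + m)%N).
Proof. by move=> [_ _ gp]; rewrite addnC gp src_eact. Qed.

Lemma axis_ray_dist g m p i : axis_ray g m p ->
  dist (src (p i)) (vact g (src (p i))) = m.
Proof. by move=> r; rewrite (axis_ray_src _ r) chain_dist //; case: r. Qed.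

(* Compare the displacements of the powers of [g] at [z] and on the ray. *)
Lemma axis_ray_displacement g m p z : axis_ray g m p -> (m <= dist z (vact g z))%N.
Proof.
move=> r; set d := dist z _; rewrite leqNgt; apply/negP => dm.
set x := src (p 0%N); set D := dist x z.
have dk k : (dist z (vact (g ^+ k)%g z) <= k * d)%N.
  elim: k => [|k IH]; first by rewrite vact1 (@dist_reduced T T_acyclic _ [::]).
  apply: leq_trans (triangle _ (vact g z) _) _.
  by rewrite expgS vactM dist_act mulSn leq_add2l.
(* The triangle inequality gives [k * m <= k * d + 2 * D] for every [k > 0]; if [d < m], this fails
   as soon as [k] exceeds [2 * D]. *)
pose k := (D + D).+1.
have : (k * m <= D + (k * d + D))%N.
  rewrite -(axis_ray_dist 0%N (axis_ray_exp (isT : (0 < k)%N) r)) -/x.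
  apply: leq_trans (triangle _ z _) _; rewrite leq_add2l.
  apply: leq_trans (triangle _ (vact (g ^+ k)%g z) _) _; apply: leq_add => //.
  by rewrite dist_act dsym.
rewrite addnCA -leq_subLR -mulnBr leqNgt => /negP; apply.
by apply: (@leq_trans k); rewrite // leq_pmulr // subn_gt0.
Qed.

Lemma axis_ray_hyperbolic g m p : axis_ray g m p -> hyperbolic a g.
Proof.
move=> r x gx; have := axis_ray_displacement x r.
rewrite gx (@dist_reduced T T_acyclic _ [::]) //= leqn0; case: r => /[swap] _ /[swap] _.
by case: m.
Qed.

Lemma axis_ray_length g m p : axis_ray g m p -> translation_length a g = m.
Proof.
move=> r; apply: natmin_eq; first by (exists (src (p 0%N))); rewrite ?(axis_ray_dist _ r).
by move=> _ [x _ <-]; apply: axis_ray_displacement r.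
Qed.

Lemma axis_ray_axis g m p i : axis_ray g m p -> axis a g (src (p i)).
Proof. by move=> r; rewrite /axis /= (axis_ray_length r) (axis_ray_dist _ r). Qed.

Lemma is_path_rcons_inv (x : vert T) s (e : edge T) y :
  is_path x (rcons s e) y -> is_path x s (src e).
Proof. by elim: s x => [x /= [-> _] //|f s IH x /= [-> /IH]]. Qed.

(* A vertex of minimal displacement lies on the axis: otherwise moving it one
   step towards its image would decrease its displacement by two. *)
Lemma hyperbolic_axis_ray (x0 : vert T) g : hyperbolic a g ->
  exists p, axis_ray g (translation_length a g) p.
Proof.
move=> hyp; pose D : set nat := range (fun x => dist x (vact g x)); rewrite /translation_length -/D.
have [[x _ xE] Dmin] : D (natmin D) /\ forall m, D m -> (natmin D <= m)%N.
  by apply: natminP; exists (dist x0 (vact g x0)), x0.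
have [[|e s] [xq rq sq]] := ex_reduced T_acyclic T_connected x (vact g x).
  by case: (hyp x).
rewrite -xE -sq; have [ex gex] := is_path_cons xq.
have gs : path nonback e (rcons s (eact g e)).
  rewrite rcons_path (rq : path nonback e s) /nonback src_eact ex gex eqxx /=; apply/eqP.
  (* For a path of one edge, backtracking would mean that [g] inverts this edge. *)
  case/lastP: s xq rq sq gex => [|s f] xq rq sq gex.
    by apply/eqP/no_inversion.
  rewrite last_rcons => gE; have gte : vact g (tgt e) = src f.
    by rewrite -tgt_eact gE tgt_einv.
  have := Dmin _ (ex_intro2 _ _ (tgt e) Logic.I erefl).
  rewrite gte -xE -sq; apply/negP; rewrite -ltnNge /= size_rcons.
  have : is_path (tgt e) s (src f).
    by apply: (@is_path_rcons_inv _ _ f (vact g x)); move: xq => /= [].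
  by move=> /(dist_le_size T_acyclic) le; rewrite ltnS (leq_trans le) // leqnSn.
by eexists; apply: axis_ray_of_path gs.
Qed.

(** From a common vertex [x], both rays start with the unique reduced path from [x] to [g x], and
    [g] repeats it. *)
Lemma axis_ray_agree g m p q i j : axis_ray g m p -> axis_ray g m q ->
  src (p i) = src (q j) -> forall k, p (i + k)%N = q (j + k)%N.
Proof.
move=> rp rq pq.
have [m0 cp gp] := rp; have [_ cq gq] := rq.
have seg : p i :: segment p i m.-1 = q j :: segment q j m.-1.
  apply: (reduced_uniq T_acyclic) => //; try exact: chain_segment.
  rewrite !last_segment -!chain_src // -!addnS prednK //.
  by rewrite -(axis_ray_src _ rp) -(axis_ray_src _ rq) pq.
have small r : (r < m)%N -> p (i + r)%N = q (j + r)%N.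
  case: r => [_|r rm]; first by rewrite !addn0; case: seg.
  case: seg => _ /(congr1 (fun s => nth (p i) s r)).
  have r1 : (r < m.-1)%N by rewrite -ltnS prednK.
  by rewrite !(nth_map 0%N) ?size_iota // nth_iota.
move=> k; rewrite (divn_eq k m) !(addnCA _ (_ * _)%N).
by rewrite (axis_ray_expE _ _ rp) (axis_ray_expE _ _ rq) small // ltn_mod.
Qed.

Lemma axis_ray_eq g m n p q : axis_ray g m p -> axis_ray g n q -> p 0%N = q 0%N -> p = q.
Proof.
move=> rp rq pq; have mn : m = n by rewrite -(axis_ray_length rp) (axis_ray_length rq).
subst n; apply/funext => k.
by have := axis_ray_agree rp rq (congr1 (@src T) pq) k.
Qed.

(* If the two rays did not meet, the shortest path joining them would extend to
   a reduced path from a point of one ray to its image, longer than [m]. *)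
Lemma axis_ray_meet g m n p q : axis_ray g m p -> axis_ray g n q ->
  exists i j, forall k, p (i + k)%N = q (j + k)%N.
Proof.
move=> rp rq; have mn : n = m by rewrite -(axis_ray_length rp) (axis_ray_length rq).
subst n; have [m0 cp gp] := rp; have [_ cq gq] := rq.
pose D : set nat := [set d | exists i j, dist (src (q j)) (src (p i)) = d].
have [] : D (natmin D) /\ forall d, D d -> (natmin D <= d)%N.
  by apply: natminP; exists (dist (src (q 0%N)) (src (p 0%N))), 0%N, 0%N.
set d := natmin D => -[i' [j' dE]] Dmin.
(* Moving both points by [g] keeps their distance and makes [i] positive, so that the edge
   [p (i - 1)] entering [y] exists. *)
pose i := (i' + m)%N; pose j := (j' + m)%N.
have {}dE : dist (src (q j)) (src (p i)) = d.
  by rewrite -!(axis_ray_src _ rp) -!(axis_ray_src _ rq) dist_act.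
have i0 : (0 < i)%N by rewrite addn_gt0 m0 orbT.
set x := src (q j) in dE *; set y := src (p i) in dE *.
have [[|e s] [xs rs sd]] := ex_reduced T_acyclic T_connected x y.
  by exists i, j; apply: (axis_ray_agree rp rq).
exfalso; have [ex sy] := is_path_cons xs; set f := last e s in sy.
have lt_d : (dist x (src f) < d)%N.
  move: xs; rewrite lastI => /is_path_rcons_inv /(dist_le_size T_acyclic) le.
  by rewrite -dE -sd /= ltnS (leq_trans le) // size_belast.
have off k : src f <> src (p k).
  move=> fk; have : D (dist x (src f)) by exists k, j; rewrite fk.
  by move=> /Dmin; rewrite leqNgt lt_d.
set back := rev (map (@einv T) (belast (eact g e) (map (eact g) s))).
set r := segment p i m.-1.
have gf : last (eact g e) (map (eact g) s) = eact g f by rewrite last_map.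
have P : path nonback e (s ++ (p i :: r) ++ einv (eact g f) :: back).
  rewrite cat_path (rs : path nonback e s) -/f cat_path /= chain_segment // last_segment.
  have := @reduced_rev T (eact g e) (map (eact g) s).
  rewrite gf path_nonback_eact => -> //; rewrite !andbT.
  apply/andP; split; apply/andP; split; try (apply/eqP).
  - by rewrite sy.
  - by move=> pf; apply: (off i.+1); rewrite chain_src // pf tgt_einv.
  - rewrite src_einv tgt_eact sy -chain_src // -addnS prednK // /y.
    by rewrite -(axis_ray_src _ rp).
  (* The last edge of the period is [g (p (i - 1))]. If it were [g f], the source of [f] would be on
     the ray and nearer to [x] than the minimum allows. *)
  have -> : (i + m.-1 = m + i.-1)%N.
    by rewrite addnC -[in LHS](prednK i0) addnS -addSn prednK.
  rewrite gp => /(can_inj (@einvK T)).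
  by move=> /(can_inj (eactVK g)) fE; apply: (off i.-1); rewrite fE.
have := axis_ray_dist j rq; rewrite -/x.
rewrite (@dist_reduced T T_acyclic x (e :: s ++ (p i :: r) ++ einv (eact g f) :: back)) //.
  rewrite /= size_cat /= size_cat /= size_rev size_map size_belast size_map.
  rewrite size_map size_iota.
  by move: m0; clear; lia.
have -> : vact g x = tgt (last e (s ++ (p i :: r) ++ einv (eact g f) :: back)).
  by rewrite last_cat last_cat /= -gf last_rev_belast tgt_einv src_eact ex.
by rewrite -{1}ex; apply: reduced_is_path.
Qed.

End Axis.

(** * Primitive roots of hyperbolic elements *)

Section Primitive.
Variables (G : groupType) (T : graph) (a : action G T).
Implicit Types (g h z : G) (p q : nat -> edge T).
Local Notation eact := (eact a).
Local Notation vact := (vact a).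
Local Notation axis_ray := (axis_ray a).

(** The vertex [x] need not be on the axis: fixing one forward orbit of [g] is all that the matrix
    argument uses. *)
Definition axis_free := forall g h x, hyperbolic a g ->
  (forall i, vact h (vact (g ^+ i)%g x) = vact (g ^+ i)%g x) -> h = 1%g.

Hypothesis T_acyclic : acyclic T.
Hypothesis T_connected : connected T.
Hypothesis a_free : axis_free.

Lemma axis_ray_fix g m p h : axis_ray g m p ->
  (forall i, vact h (src (p i)) = src (p i)) -> h = 1%g.
Proof.
move=> r hp; apply: (a_free (axis_ray_hyperbolic T_acyclic T_connected r)
  (x := src (p 0%N))) => i.
case: i => [|i]; first by rewrite expg0 vact1.
by rewrite (axis_ray_src _ (axis_ray_exp (isT : (0 < i.+1)%N) r)) hp.
Qed.

Lemma axis_ray_inj g m p h k : axis_ray g m p ->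
  (forall i, eact h (p i) = eact k (p i)) -> h = k.
Proof.
move=> r hk; apply: (mulgI k^-1%g); rewrite mulVg; apply: (axis_ray_fix r) => i.
by rewrite -src_eact eactM hk eactVK.
Qed.

(** A power of [g] carries any edge of the ray into the tail where [z] is known to be a shift, and
    [z] commutes with this power. *)
Lemma axis_ray_translate g m p z i j : axis_ray g m p -> commute z g -> (i <= j)%N ->
  (forall k, eact z (p (i + k)%N) = p (j + k)%N) ->
  forall k, eact z (p k) = p (j - i + k)%N.
Proof.
move=> r zg ij zp k; have [m0 _ _] := r.
have le : (i <= i * m)%N by rewrite leq_pmulr.
apply: (can_inj (eactVK a (g ^+ i)%g)).
rewrite -eactM -(commuteX i zg) eactM.
rewrite -!(axis_ray_expE _ _ r) -[in LHS](subnKC le) -addnA zp; congr p.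
by move: le ij; clear; lia.
Qed.

(** The root [h] realizes the least positive shift of [p] by a group element. Division with
    remainder makes every other shift a multiple of it, and freeness makes the element a power of
    [h]. *)
Lemma primitive_root g m p : axis_ray g m p -> exists h l,
  [/\ axis_ray h l p, primitive_hyperbolic a h &
      forall g' m', axis_ray g' m' p -> exists2 r, (0 < r)%N & m' = (r * l)%N /\ g' = (h ^+ r)%g].
Proof.
move=> rg; have [m0 cp gp] := rg.
pose D : set nat := [set n | (0 < n)%N /\ exists h, forall i, p (n + i)%N = eact h (p i)].
have [] : D (natmin D) /\ forall d, D d -> (natmin D <= d)%N.
  by apply: natminP; exists m; split=> //; exists g.
set l := natmin D => -[l0 [h hp]] Dmin.
have rh : axis_ray h l p by [].
have dvd g' m' : axis_ray g' m' p -> exists2 r, (0 < r)%N & m' = (r * l)%N /\ g' = (h ^+ r)%g.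
  move=> rg'; have [m'0 _ g'p] := rg'; have mE := divn_eq m' l.
  have r0 : (m' %% l = 0)%N.
    apply/eqP; rewrite -leqn0 leqNgt; apply/negP => r0.
    have : D (m' %% l)%N.
      split=> //; exists ((h ^+ (m' %/ l))^-1 * g')%g => i.
      by rewrite eactM -g'p {3}mE -addnA (axis_ray_expE _ _ rh) eactVK.
    by move=> /Dmin; rewrite leqNgt ltn_mod l0.
  rewrite r0 addn0 in mE.
  exists (m' %/ l)%N; first by rewrite lt0n; apply: contraTN m'0 => /eqP q0; rewrite mE q0.
  split=> //; apply: (axis_ray_inj rh) => i.
  by rewrite -g'p -(axis_ray_expE _ _ rh) -mE.
exists h, l; split=> //; split; first exact: axis_ray_hyperbolic rh.
(* If [h = k ^ r], then [k] commutes with [h] and its ray meets [p]; it therefore shifts [p] by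
   [l / r], below the minimum. *)
move=> k r r1 hE; have khyp : hyperbolic a k.
  move=> x kx; apply: (axis_ray_hyperbolic T_acyclic T_connected rh (x := x)).
  by rewrite hE; elim: (r) => [|n IH]; rewrite ?expg0 ?vact1 // expgS vactM IH.
have [q rk] := hyperbolic_axis_ray T_acyclic T_connected (src (p 0%N)) khyp.
set m' := translation_length a k in rk.
have rhq := axis_ray_exp (ltnW r1) rk; rewrite -hE in rhq.
have lE : l = (r * m')%N.
  by rewrite -(axis_ray_length T_acyclic T_connected rhq)
    (axis_ray_length T_acyclic T_connected rh).
have [i [j pq]] := axis_ray_meet T_acyclic T_connected rh rhq.
have [m'0 _ kq] := rk.
have kp : forall n, eact k (p n) = p (m' + i - i + n)%N.
  apply: (axis_ray_translate rh) => [||n]; rewrite ?leq_addl //.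
    by rewrite hE; apply/commuteX.
  by rewrite pq -kq addnCA -pq addnA [(i + m')%N]addnC.
have : D m' by split=> //; exists k => n; rewrite kp addnK.
move=> /Dmin; apply/negP; rewrite -ltnNge lE.
by rewrite -[X in (X < _)%N]mul1n ltn_pmul2r.
Qed.

Lemma primitive_ray_exp g m p h l : axis_ray g m p -> axis_ray h l p ->
  primitive_hyperbolic a h -> exists2 r, (0 < r)%N & m = (r * l)%N /\ g = (h ^+ r)%g.
Proof.
move=> rg rh [_ prim]; have [k [n [rk _ root]]] := primitive_root rg.
have [r r0 [lE hE]] := root _ _ rh.
have r1 : r = 1%N.
  by apply/eqP; rewrite eqn_leq r0 andbT leqNgt; apply/negP => /(prim k); apply.
by move: lE hE; rewrite r1 mul1n expg1 => -> ->; apply: root.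
Qed.

End Primitive.

(** * Prime cycles and periodic sequences *)

Section Words.
Variable A : weighted_graph.
Implicit Types (c d : seq (edge A)) (x : edge A) (u : nat -> edge A).

(** In terms of periodic sequences, rotation becomes a shift, a power of a path has the same
    sequence, and a path is prime when its length is the least period. *)
Definition unroll x c i := nth x c (i %% size c).

Lemma unroll_period x c k i : unroll x c (k * size c + i) = unroll x c i.
Proof. by rewrite /unroll modnMDl. Qed.

Lemma unroll_def x y c : c != [::] -> unroll x c = unroll y c.
Proof.
by case: c => // e s _; apply/funext => i; apply: set_nth_default; rewrite ltn_mod.
Qed.

Lemma nth_unroll x c i : (i < size c)%N -> nth x c i = unroll x c i.
Proof. by move=> lt; rewrite /unroll modn_small. Qed.

Lemma eq_unroll x c d : size c = size d -> unroll x c =1 unroll x d -> c = d.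
Proof.
move=> cd eq; apply: (@eq_from_nth _ x) => // i lt.
by rewrite !nth_unroll -?cd.
Qed.

Lemma unroll_mkseq x u n : (0 < n)%N -> (forall i, u (n + i)%N = u i) ->
  unroll x (mkseq u n) = u.
Proof.
move=> n0 un; apply/funext => i; rewrite /unroll size_mkseq nth_mkseq ?ltn_mod //.
rewrite [in RHS](divn_eq i n); elim: (i %/ n)%N => [|k IH] //.
by rewrite mulSn -addnA un.
Qed.

Definition wadj (e e' : edge A) := tgt e == src e'.

Lemma closed_pathE x c : closed_path c <->
  c != [::] /\ forall i, wadj (unroll x c i) (unroll x c i.+1).
Proof.
rewrite /closed_path; split=> -[c0 cP]; split=> //; case: c c0 cP => // e s _.
  move=> /= /(pathP x) H i; set m := (size s).+1.
  have rm : (i %% m < m)%N by rewrite ltn_mod.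
  have := H (i %% m)%N; rewrite size_rcons => /(_ rm).
  rewrite -rcons_cons nth_rcons /= -/m rm nth_rcons /unroll /= -/m.
  rewrite -[in X in _ -> X]addn1 -[((i + 1) %% m)%N]modnDml addn1.
  move: (i %% m)%N rm => r; rewrite ltnS leq_eqVlt => /predU1P[->|rm].
    by rewrite ltnn eqxx modnn.
  by rewrite rm modn_small.
move=> H; apply/(pathP x) => i; rewrite size_rcons => lt.
rewrite -rcons_cons nth_rcons /= lt nth_rcons.
have := H i; rewrite /unroll /= modn_small //.
move: lt; rewrite ltnS leq_eqVlt => /predU1P[->|rm].
  by rewrite ltnn eqxx modnn.
by rewrite rm modn_small.
Qed.

Definition period u n := forall i, u (n + i)%N = u i.

Lemma period_mul u n k : period u n -> period u (k * n).
Proof. by move=> un; elim: k => [|k IH] i //; rewrite mulSn -addnA un. Qed.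

Lemma period_gcd u m n : (0 < m)%N -> period u m -> period u n -> period u (gcdn m n).
Proof.
move=> m0 um un i; have [km kn E _] := egcdnP n m0.
by rewrite -(period_mul kn un) addnA -E period_mul.
Qed.

Lemma unroll_flatten x d r : (0 < r)%N -> unroll x (flatten (nseq r d)) = unroll x d.
Proof.
case: (posnP (size d)) => [/size0nil->|d0 r0].
  by move=> _; congr (unroll x); elim: r.
have sz n : size (flatten (nseq n d)) = (n * size d)%N.
  by elim: n => //= n IH; rewrite size_cat IH mulSn.
apply/funext => i; rewrite /unroll sz.
have : (i %% (r * size d) < r * size d)%N by rewrite ltn_mod muln_gt0 r0.
have -> : (i %% size d = (i %% (r * size d)) %% size d)%N by rewrite modn_dvdm // dvdn_mull.
move: (i %% _)%N => {r0}{}i; elim: r i => [|r IH] i //= lt.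
rewrite nth_cat; case: ltnP => il; first by rewrite modn_small.
rewrite IH; last by rewrite ltn_subLR // -mulSn.
by rewrite -[in RHS](subnKC il) modnDl.
Qed.

Lemma closed_path_neq0 c : closed_path c -> (0 < size c)%N.
Proof. by case; rewrite -size_eq0 lt0n. Qed.

(** The gcd of [n] and the length is again a period, so [c] is a power of its initial part of that
    length; primality makes this part all of [c]. *)
Lemma prime_path_period x c n : prime_path c -> period (unroll x c) n -> (size c %| n)%N.
Proof.
move=> [cc cprime] un; have s0 := closed_path_neq0 cc.
pose g := gcdn (size c) n.
have g0 : (0 < g)%N by rewrite gcdn_gt0 s0.
have ug : period (unroll x c) g.
  by apply: period_gcd => // i; rewrite -[X in (X + i)%N]mul1n unroll_period.
pose d := mkseq (unroll x c) g.
have ud : unroll x d = unroll x c by apply: unroll_mkseq.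
have cd : closed_path d.
  apply/(closed_pathE x); rewrite ud; split; first by rewrite -size_eq0 size_mkseq -lt0n.
  by have /(closed_pathE x)[] := cc.
have /dvdnP[r rE] := dvdn_gcdl (size c) n; rewrite -/g in rE.
have r0 : (0 < r)%N by move: s0; rewrite rE muln_gt0 => /andP[].
have cE : c = flatten (nseq r d).
  apply: (@eq_unroll x); last by rewrite unroll_flatten // ud.
  have sz k : size (flatten (nseq k d)) = (k * size d)%N.
    by elim: k => //= k IH; rewrite size_cat IH mulSn.
  by rewrite sz size_mkseq.
have r1 : r = 1%N.
  by apply/eqP; rewrite eqn_leq r0 andbT leqNgt; apply/negP => /(cprime d r cd).
by rewrite rE r1 mul1n dvdn_gcdr.
Qed.

Lemma period_prime_path x c : closed_path c ->
  (forall n, period (unroll x c) n -> (size c %| n)%N) -> prime_path c.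
Proof.
move=> cc cper; split=> // d r cd r1 cE; have s0 := closed_path_neq0 cd.
have : (size c %| size d)%N.
  apply: cper => i; rewrite cE unroll_flatten ?(ltnW r1) //.
  by rewrite -[X in (X + i)%N]mul1n unroll_period.
have -> : size c = (r * size d)%N.
  by rewrite cE; elim: (r) => //= n IH; rewrite size_cat IH mulSn.
by move=> /(dvdn_leq s0); rewrite leqNgt ltn_Pmull.
Qed.

Lemma prime_path_exists u n : (0 < n)%N -> period u n ->
  (forall i, wadj (u i) (u i.+1)) ->
  exists c, prime_path c /\ forall x, unroll x c = u.
Proof.
move=> n0 un uadj; pose D : set nat := [set k | (0 < k)%N /\ period u k].
have [] : D (natmin D) /\ forall k, D k -> (natmin D <= k)%N.
  by apply: natminP; exists n.
set l := natmin D => -[l0 ul] lmin.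
have cu x : unroll x (mkseq u l) = u by apply: unroll_mkseq.
exists (mkseq u l); split=> //; apply: (@period_prime_path (u 0%N)).
  by apply/(closed_pathE (u 0%N)); rewrite cu -size_eq0 size_mkseq -lt0n.
move=> k; rewrite cu size_mkseq => uk.
have g0 : (0 < gcdn l k)%N by rewrite gcdn_gt0 l0.
have /lmin le : D (gcdn l k) by split=> //; apply: period_gcd.
have -> : l = gcdn l k by apply/eqP; rewrite eqn_leq le dvdn_leq ?dvdn_gcdl.
exact: dvdn_gcdr.
Qed.

Lemma unroll_rot x k c : (k <= size c)%N -> unroll x (rot k c) =1 (fun i => unroll x c (k + i)%N).
Proof.
move=> kc i; rewrite /unroll size_rot /rot nth_cat size_drop.
case: (posnP (size c)) => [c0|c0].
  by move: kc; rewrite c0 leqn0 => /eqP ->; rewrite (size0nil c0) /= !nth_nil.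
have lt : (i %% size c < size c)%N by rewrite ltn_mod.
rewrite -[((k + i) %% _)%N]modnDmr; move: (i %% _)%N lt => {}i lt.
case: ltnP => le; first by rewrite nth_drop modn_small // -ltn_subRL.
have ki : (size c <= k + i)%N by rewrite -leq_subLR.
have E : ((k + i) %% size c = i - (size c - k))%N.
  rewrite -[in LHS](subnKC ki) modnDl modn_small; move: kc ki le lt; clear; lia.
by rewrite E nth_take //; move: kc ki le lt; clear; lia.
Qed.

Lemma rot_classP x c d : c != [::] ->
  rot_class c d <-> size d = size c /\ exists k, forall i, unroll x d i = unroll x c (k + i)%N.
Proof.
move=> c0; have s0 : (0 < size c)%N by rewrite lt0n size_eq0.
split=> [[k _ <-]|[dc [k dk]]].
  rewrite size_rot; split=> //; have [kc|kc] := leqP k (size c).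
    by exists k => i; rewrite unroll_rot.
  by exists 0%N => i; rewrite rot_oversize // ltnW.
exists (k %% size c)%N => //; apply: (@eq_unroll x); first by rewrite size_rot.
move=> i; rewrite unroll_rot ?(ltnW (ltn_pmod _ _)) // dk.
by rewrite {2}(divn_eq k (size c)) -addnA unroll_period.
Qed.

Lemma rot_class_refl c : rot_class c c.
Proof. by exists 0%N; rewrite ?rot0. Qed.

(** Agreement of tails spreads to the whole sequences by periodicity, and the length of each path is
    then a period of the other. *)
Lemma prime_path_agree x c d i j : prime_path c -> prime_path d ->
  (forall k, unroll x c (i + k)%N = unroll x d (j + k)%N) ->
  size c = size d /\ exists k, forall n, unroll x d n = unroll x c (k + n)%N.
Proof.
move=> pc pd cd.
have sub c' d' i' j' : prime_path c' -> prime_path d' ->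
    (forall k, unroll x c' (i' + k)%N = unroll x d' (j' + k)%N) ->
    exists k, forall n, unroll x d' n = unroll x c' (k + n)%N.
  move=> _ [cd' _] cd''; have s0 := closed_path_neq0 cd'.
  have le : (j' <= j' * size d')%N by rewrite leq_pmulr.
  exists (i' + (j' * size d' - j'))%N => n.
  by rewrite -addnA cd'' addnA subnKC // unroll_period.
have dvd c' d' i' j' : prime_path c' -> prime_path d' ->
    (forall k, unroll x c' (i' + k)%N = unroll x d' (j' + k)%N) ->
    (size d' %| size c')%N.
  move=> pc' pd' /sub -/(_ pc' pd')[k dk]; apply: (prime_path_period (x := x) pd') => n.
  by rewrite !dk addnCA -[X in (X + _)%N]mul1n unroll_period.
have dc k : unroll x d (j + k)%N = unroll x c (i + k)%N by rewrite cd.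
split; last exact: sub pc pd cd.
by apply/eqP; rewrite eqn_dvd (dvd d c j i) // (dvd c d i j).
Qed.

Lemma rot_class_eq x c d i j : prime_path c -> prime_path d ->
  (forall k, unroll x c (i + k)%N = unroll x d (j + k)%N) -> rot_class c = rot_class d.
Proof.
move=> pc pd cd.
have sub c' d' i' j' : prime_path c' -> prime_path d' ->
    (forall k, unroll x c' (i' + k)%N = unroll x d' (j' + k)%N) -> rot_class d' `<=` rot_class c'.
  move=> pc' pd' /(prime_path_agree pc' pd')[sz [k dk]] b.
  have [[c0 _] _] := pc'; have [[d0 _] _] := pd'.
  move=> /(rot_classP x b d0)[bd [n bn]]; apply/(rot_classP x _ c0).
  by split; [rewrite sz|exists (k + n)%N => m; rewrite bn dk addnA].
by apply/seteqP; split; [apply: (sub d c j i)|apply: (sub c d i j)] => // k; rewrite cd.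
Qed.

Lemma prime_path_rot c d : prime_path c -> rot_class c d ->
  prime_path d /\ rot_class d = rot_class c.
Proof.
move=> pc; have [cc _] := pc; have [c0 _] := cc.
have [x _] : exists x : edge A, true by case: (c) c0 => // y; exists y.
move=> /(rot_classP x d c0)[dc [k dk]].
have /(closed_pathE x)[_ cadj] := cc.
have s0 := closed_path_neq0 cc.
have cd : closed_path d.
  apply/(closed_pathE x); split; first by rewrite -size_eq0 dc -lt0n.
  by move=> i; rewrite !dk addnS.
have pd : prime_path d.
  apply: (period_prime_path (x := x) cd) => n un; rewrite dc.
  apply: (prime_path_period (x := x) pc) => i.
  have le : (k <= k * size c)%N by rewrite leq_pmulr.
  rewrite -(unroll_period _ _ k) -[RHS](unroll_period _ _ k).
  by rewrite -(subnKC le) -!addnA [(_ + (n + i))%N]addnCA -!dk un.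
split=> //; apply: (@rot_class_eq x _ _ 0 k) => // i; rewrite add0n dk.
Qed.

End Words.

Lemma set_size_ext (T : eqType) (A B : set T) n :
  (forall x, A x <-> B x) -> set_size A n -> set_size B n.
Proof. by move=> AB; have -> // : B = A by apply/seteqP; split=> x /AB. Qed.

Lemma set_size_inj_preimage (T : choiceType) (U : eqType) (f : T -> U) (A : set T) n :
  (forall x y, A x -> A y -> f x = f y -> x = y) ->
  set_size (f @` A) n -> set_size A n.
Proof.
move=> finj [s [us <- sA]].
have [A0|/set0P[x0 Ax0]] := eqVneq A set0.
  exists [::]; rewrite A0; split=> //; case: (s) sA => // u r sA.
  by have [x] : (f @` A) u; [apply/sA; rewrite mem_head|rewrite A0].
pose g u := xget x0 [set x | A x /\ f x = u].
have gP u : u \in s -> A (g u) /\ f (g u) = u.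
  move=> /sA[x Ax fx].
  by apply: (@xgetPex _ x0 [set x | A x /\ f x = u]); exists x.
exists (map g s); split=> [||x]; last split=> [Ax|/mapP[u /gP[Ag _] -> //]].
- by rewrite map_inj_in_uniq // => u v /gP[_ {2}<-] /gP[_ {2}<-] ->.
- by rewrite size_map.
have fx : f x \in s by apply/sA; exists x.
by apply/mapP; exists (f x) => //; have [Ag /finj ->] := gP _ fx.
Qed.

(** * Lifting paths from the quotient graph of groups *)

Section Quotient.
Variables (G : groupType) (T : graph) (a : action G T).
Implicit Types (g h z : G) (p q : nat -> edge T) (e f : edge T) (x y : vert T).
Local Notation eact := (eact a).
Local Notation vact := (vact a).

Definition eproj e : qedge a := SigSub (mem_set (imageT (eorbit a) e)).
Definition vproj x : qvert a := SigSub (mem_set (imageT (vorbit a) x)).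

Lemma eprojP e f : eproj e = eproj f <-> exists g, eact g e = f.
Proof.
split=> [/(congr1 val) /= ef|[g gef]].
  by have := eorbit_refl a f; rewrite -ef => -[g _ ge]; exists g.
by apply: val_inj; rewrite /= [RHS](@eorbit_eq _ _ a e) //; exists g.
Qed.

Lemma vprojP x y : vproj x = vproj y <-> exists g, vact g x = y.
Proof.
split=> [/(congr1 val) /= ef|[g gef]].
  by have := vorbit_refl a y; rewrite -ef => -[g _ ge]; exists g.
by apply: val_inj; rewrite /= [RHS](@vorbit_eq _ _ a x) //; exists g.
Qed.

Lemma proj_elift E : eproj (elift E) = E.
Proof. by apply: val_inj; rewrite /= elift_orbit. Qed.

Lemma vproj_vlift X : vproj (vlift X) = X.
Proof. by apply: val_inj; rewrite /= vlift_orbit. Qed.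

Lemma qsrc_proj e : qsrc (eproj e) = vproj (src e).
Proof. by apply: val_inj; rewrite /= src_eorbit. Qed.

Lemma qtgt_proj e : qtgt (eproj e) = vproj (tgt e).
Proof. by apply: val_inj; rewrite /= tgt_eorbit. Qed.

Lemma qinv_proj e : qinv (eproj e) = eproj (einv e).
Proof. by apply: val_inj; rewrite /= einv_eorbit. Qed.

Definition vstabilizer x : set G := [set g | vact g x = x].
Definition estabilizer e : set G := [set g | eact g e = e].

Lemma estabilizer_sub e : estabilizer e `<=` vstabilizer (src e).
Proof. by move=> g /= ge; rewrite /vstabilizer /= -src_eact ge. Qed.

Lemma set_size_vcoset x y g n : vact g x = y ->
  set_size (vstabilizer y) n -> set_size (vstabilizer x) n.
Proof.
move=> gxy H; apply: set_size_ext (set_size_image (f := fun h => (g^-1 * h * g)%g) _ H).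
  move=> h; split=> [[k ky <-]|hx]; first by rewrite /vstabilizer /= !vactM gxy ky -gxy vactVK.
  exists (g * h * g^-1)%g; rewrite /vstabilizer /=.
    by rewrite !vactM -gxy vactVK hx.
  by rewrite !mulgA mulVg mul1g mulgVK.
by move=> h k _ _ /mulIg /mulgI.
Qed.

Lemma set_size_ecoset e f n : eproj e = eproj f ->
  set_size (estabilizer f) n -> set_size (estabilizer e) n.
Proof.
move=> /eprojP[g gef] H; apply: set_size_ext (set_size_image (f := fun h => (g^-1 * h * g)%g) _ H).
  move=> h; split=> [[k kf <-]|he]; first by rewrite /estabilizer /= !eactM gef kf -gef eactVK.
  exists (g * h * g^-1)%g; rewrite /estabilizer /=.
    by rewrite !eactM -gef eactVK he.
  by rewrite !mulgA mulVg mul1g mulgVK.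
by move=> h k _ _ /mulIg /mulgI.
Qed.

Lemma set_size_transporter_r e f n : eproj e = eproj f ->
  set_size (estabilizer f) n -> set_size [set g | eact g e = f] n.
Proof.
move=> /eprojP[g gef] H; apply: set_size_ext (set_size_image (f := fun h => (h * g)%g) _ H).
  move=> h; split=> [[k kf <-]|hef /=]; first by rewrite /= eactM gef.
  by exists (h * g^-1)%g; rewrite ?mulgVK // /estabilizer /= eactM -{1}gef eactVK.
by move=> h k _ _ /mulIg.
Qed.

Lemma set_size_transporter e f n : eproj e = eproj f ->
  set_size (estabilizer e) n -> set_size [set g | eact g e = f] n.
Proof.
move=> /eprojP[g gef] H; apply: set_size_ext (set_size_image (f := fun h => (g * h)%g) _ H).
  move=> h; split=> [[k kf <-]|hef /=]; first by rewrite /= eactM kf.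
  exists (g^-1 * h)%g; rewrite ?mulgA ?mulgV ?mul1g // /estabilizer /=.
  by rewrite eactM hef -gef eactVK.
by move=> h k _ _ /mulgI.
Qed.

Hypothesis stab_finite : forall x, finite_set (vstabilizer x).

Lemma estab_size e : exists2 n, (0 < n)%N & set_size (estabilizer e) n.
Proof.
have [n nP] := finite_set_size (sub_finite_set (@estabilizer_sub e) (stab_finite (src e))).
by exists n => //; apply: (set_size_gt0 (x := 1%g) nP); rewrite /estabilizer /= eact1.
Qed.

(** Orbit-stabilizer: the stabilizer of [src f0] acts transitively on the edges in the orbit of [f0]
    that leave this vertex. *)
Lemma set_size_star f0 n m : set_size (vstabilizer (src f0)) n ->
  set_size (estabilizer f0) m ->
  exists2 k, set_size [set f | src f = src f0 /\ eproj f = eproj f0] k & n = (k * m)%N.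
Proof.
move=> Hn Hm; set F := [set f | _].
have FE : F = (fun g => eact g f0) @` vstabilizer (src f0).
  apply/seteqP; split=> [f [fs /esym /eprojP[g gf]]|_ [g gx <-]].
    by exists g => //; rewrite /vstabilizer /= -src_eact gf.
  by rewrite /F /= src_eact; split=> //; apply/esym/eprojP; exists g.
have [k Hk] : exists k, set_size F k.
  by rewrite FE; apply/finite_set_size/finite_image/stab_finite.
exists k => //; apply: set_size_uniq Hn _.
apply: (set_size_fibration (f := fun g => eact g f0) Hk).
  by move=> g gx; rewrite FE; exists g.
move=> f [fs pf]; apply: set_size_ext (set_size_transporter (esym pf) Hm) => g.
split=> [/= gf|[]//]; split=> //.
by rewrite /vstabilizer /= -src_eact gf.
Qed.

Lemma set_size_subg (H : groupClosed G) n :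
  set_size [set g | g \in H] n -> set_size [set: subg H] n.
Proof.
move=> Hn; apply: (set_size_inj_preimage (f := val)) => [x y _ _ /val_inj //|].
apply: set_size_ext Hn => g; split=> [/= gH|[x _ <-]]; last exact: valP.
by exists (exist _ g gH).
Qed.

Local Notation A := (assoc_weighted_graph (quotient_gog a)).

(** The weight is defined at the chosen lifts; other lifts have conjugate stabilizers and give the
    same orders. *)
Lemma weight_proj f n m : set_size (vstabilizer (src f)) n ->
  set_size (estabilizer f) m -> weight (w := A) (eproj f) = n%:R / m%:R.
Proof.
move=> Hn Hm; rewrite /weight /=; congr (_%:R / _%:R); apply/set_size_ncard/set_size_subg.
  have /vprojP[g gx] : vproj (vlift (qsrc (eproj f))) = vproj (src f).
    by rewrite vproj_vlift qsrc_proj.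
  apply: set_size_ext (set_size_vcoset gx Hn) => h.
  by split=> /eqP.
have /set_size_ecoset/(_ Hm) H : eproj (elift (eproj f)) = eproj f by rewrite proj_elift.
by apply: set_size_ext H => h; split=> /eqP.
Qed.

Lemma set_size_proj_star e E : tgt (eproj e : edge A) = src E ->
  exists2 k, set_size [set f | src f = tgt e /\ eproj f = E] k & weight (w := A) E = k%:R.
Proof.
rewrite -[tgt _]/(qtgt (eproj e)) -[src _]/(qsrc E) qtgt_proj -{1}(proj_elift E) qsrc_proj.
move=> /esym/vprojP[g gE].
pose f := eact g (elift E).
have fE : eproj f = E by rewrite -(proj_elift E); apply/esym/eprojP; exists g.
have fs : src f = tgt e by rewrite src_eact.
have [n Hn] := finite_set_size (stab_finite (src f)).
have [m m0 Hm] := estab_size f.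
have [k Hk nk] := set_size_star Hn Hm; exists k; first by rewrite -fs -fE.
have := weight_proj Hn Hm; rewrite fE => ->; rewrite nk natrM mulfK //.
by rewrite Num.Theory.pnatr_eq0 -lt0n.
Qed.

(** The weight of [E] counts its lifts leaving [tgt e]. Exactly when [E] is the inverse of the
    projection of [e], one of them is the forbidden edge [einv e]: this is the [- 1] in
    [weight2]. *)
Lemma set_size_nonback e E : tgt (eproj e : edge A) = src E ->
  exists2 k, set_size [set f | nonback e f /\ eproj f = E] k &
    weight2 (A := A) (eproj e) E = k%:R.
Proof.
move=> /set_size_proj_star[k Hk wE]; rewrite /weight2.
have -> : (E == einv (eproj e : edge A)) = (E == eproj (einv e)).
  by rewrite -qinv_proj.
case: eqP => [EE|nE]; last first.
  exists k => //; apply: set_size_ext Hk => f; rewrite /nonback /=.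
  split=> [[-> fE]|[/andP[/eqP-> _]]] //; split=> //; rewrite eqxx /=.
  by apply/eqP => fe; apply: nE; rewrite -fE fe.
have [s [us sk sP]] := Hk.
have es : einv e \in s by apply/sP; rewrite /= src_einv.
exists k.-1; last by rewrite wE -sk; case: (s) es => // f r _; rewrite /= -natr1 addrK.
exists (rem (einv e) s); split; first exact: rem_uniq.
  by rewrite size_rem // sk.
move=> f; rewrite mem_rem_uniq // inE /nonback /=.
split=> [[/andP[/eqP fs nef] fE]|/andP[nef /sP[fs fE]]].
  by rewrite nef; apply/sP.
by rewrite fs eqxx.
Qed.

Lemma set_size_lifts (u : nat -> edge A) n i e :
  (forall j, wadj (u j) (u j.+1)) -> eproj e = u i ->
  exists2 k,
    set_size [set q | path nonback e q /\ map eproj q = [seq u (i + j)%N | j <- iota 1 n]] k &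
    k%:R = \prod_(j < n) weight2 (u (i + j)%N) (u (i + j).+1).
Proof.
move=> uadj; elim: n i e => [|n IH] i e eu.
  exists 1%N; last by rewrite big_ord0.
  exists [:: [::]]; split=> // q; rewrite inE /=.
  by split=> [[_]|/eqP->]; [case: q|split].
have uS : [seq u (i + j)%N | j <- iota 1 n.+1] =
    u i.+1 :: [seq u (i.+1 + j)%N | j <- iota 1 n].
  rewrite /= addn1; congr (_ :: _).
  by rewrite -[2%N]/(1 + 1)%N iotaDl -map_comp; apply: eq_map => j /=; rewrite addnA addn1.
have [k Hk kE] : exists2 k, set_size [set f | nonback e f /\ eproj f = u i.+1] k &
    weight2 (u i) (u i.+1) = k%:R.
  by rewrite -eu; apply: set_size_nonback; rewrite eu; apply/eqP/uadj.
pose P := \prod_(j < n) weight2 (u (i.+1 + j)%N) (u (i.+1 + j).+1).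
(* By induction every first lift has [P] continuations, so [P] is a natural number once a first lift
   exists. If [k = 0] the value of [k'] is irrelevant. *)
pose k' := xget 0%N [set k | k%:R = P].
have PE : \prod_(j < n.+1) weight2 (u (i + j)%N) (u (i + j).+1) = k%:R * P.
  rewrite big_ord_recl addn0 kE; congr (_ * _); apply: eq_bigr => j _.
  by rewrite /= /bump leq0n add1n addnS addSn.
exists (k * k')%N; last first.
  have [k0|k0] := posnP k; first by rewrite PE k0 !mul0r.
  have [[|f s] [_ sk sP]] := Hk; first by rewrite -sk in k0.
  have [_ fu] : nonback e f /\ eproj f = u i.+1 by apply/sP; rewrite mem_head.
  have [k'' _ k''E] := IH _ _ fu.
  have k'E : k'%:R = P by apply: (xgetI 0%N (P := [set k | k%:R = P]) k''E).
  by rewrite PE natrM k'E.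
apply: (set_size_fibration (f := head e) Hk).
  by move=> q []; rewrite uS; case: q => [|f q] //= /andP[ef _] [fu _].
move=> f [ef fu]; have [k'' Hk'' k''E] := IH _ _ fu.
have <- : k'' = k'.
  apply/eqP; rewrite -(Num.Theory.eqr_nat rat); apply/eqP; rewrite k''E; apply/esym.
  by apply: (xgetI 0%N (P := [set k | k%:R = P]) k''E).
apply: set_size_ext (set_size_image (f := cons f) _ Hk'') => [q|q r _ _ []//].
rewrite uS; split=> [[r [pr rE] <-]|].
  by split=> //; rewrite /= ef pr fu rE.
case: q => [|f' q] [[]] //= /andP[ef' pq] [f'u qE] ff'; subst f'.
by exists q.
Qed.

End Quotient.

(** * Counting translators of an edge *)

Section Zeta.
Variables (G : groupType) (T : graph) (a : action G T).
Implicit Types (g h z : G) (p q : nat -> edge T) (e f : edge T).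
Local Notation eact := (eact a).
Local Notation vact := (vact a).
Local Notation axis_ray := (axis_ray a).
Local Notation eproj := (eproj a).
Local Notation A := (assoc_weighted_graph (quotient_gog a)).

Hypothesis T_acyclic : acyclic T.
Hypothesis T_connected : connected T.
Hypothesis a_free : axis_free a.
Hypothesis stab_finite : forall x, finite_set (vstabilizer a x).
Variable x0 : vert T.

Lemma chain_inj p i j : chain p -> p i = p j -> i = j.
Proof.
move=> cp; wlog ij : i j / (i <= j)%N => [H pij|pij].
  by have [/H|/ltnW/H] := leqP i j; [apply|move=> ->].
have := chain_dist i (j - i) T_acyclic cp; rewrite subnKC // pij.
rewrite (@dist_reduced T T_acyclic _ [::]) //= => /esym/eqP.
by rewrite subn_eq0 => ji; apply/eqP; rewrite eqn_leq ij.
Qed.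

Lemma eproj_eact g e : eproj (eact g e) = eproj e.
Proof. by apply/esym/eprojP; exists g. Qed.

Lemma wadj_chain p i : chain p -> wadj (eproj (p i) : edge A) (eproj (p i.+1)).
Proof.
move=> cp; rewrite /wadj; apply/eqP; rewrite -[tgt _]/(qtgt (eproj (p i))).
by rewrite -[src _]/(qsrc (eproj (p i.+1))) qtgt_proj qsrc_proj chain_src.
Qed.

Lemma axis_ray_period g m p : axis_ray g m p -> period (fun i => eproj (p i) : edge A) m.
Proof. by move=> [_ _ gp] i; rewrite gp eproj_eact. Qed.

Section PeriodicWord.
Variables (N : nat) (e0 : edge T) (u : nat -> edge A).
Hypotheses (N_gt0 : (0 < N)%N) (e0u : eproj e0 = u 0%N).
Hypotheses (uN : period u N) (u_adj : forall j, wadj (u j) (u j.+1)).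

Definition translators : set G :=
  [set g | exists p, [/\ axis_ray g N p, p 0%N = e0 & forall i, eproj (p i) = u i]].

Definition ray_of g : nat -> edge T :=
  xget (fun=> e0) [set p | [/\ axis_ray g N p, p 0%N = e0 & forall i, eproj (p i) = u i]].

Lemma ray_ofP g : translators g ->
  [/\ axis_ray g N (ray_of g), ray_of g 0%N = e0 & forall i, eproj (ray_of g i) = u i].
Proof. exact: xgetPex. Qed.

(** A translator determines the first period of its ray, a reduced lift of [u]. Conversely, such a
    lift ends with an edge in the orbit of [e0]; the elements carrying [e0] there form a coset of
    its stabilizer, and each unrolls the lift to a ray. *)
Lemma set_size_translators s : set_size (estabilizer a e0) s ->
  exists2 k, set_size translators (k * s) &
    k%:R = \prod_(j < N) weight2 (u j) (u j.+1).
Proof.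
move=> Hs; have [k Hk kE] := set_size_lifts stab_finite N u_adj e0u.
exists k => //.
apply: (set_size_fibration (f := fun g => segment (ray_of g) 0 N) Hk).
  move=> g /ray_ofP[r r0 ru]; split.
    by rewrite -{1}r0; apply: chain_segment; case: r.
  by rewrite -map_comp; apply: eq_map => j /=; rewrite ru.
move=> q [qP qE]; have sq : size q = N by rewrite -(size_map eproj) qE size_map size_iota.
have lastq : eproj (last e0 q) = eproj e0.
  have -> : last e0 q = nth e0 q N.-1 by rewrite -sq nth_last.
  rewrite -(nth_map _ (eproj e0)) ?sq ?prednK // qE (nth_map 0%N) ?size_iota ?prednK //.
  by rewrite nth_iota ?prednK // add0n add1n prednK // e0u -{1}(addn0 N) uN.
apply: set_size_ext (set_size_transporter (esym lastq) Hs) => g; split=> [/= gE|]; last first.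
  move=> [/ray_ofP[r r0 ru] /= <-]; rewrite -{2}r0 last_segment add0n.
  by case: r => _ _ gr; rewrite -(addn0 N) gr r0.
case/lastP: q qP qE sq lastq gE => [|q f] qP qE sq _; first by have := N_gt0; rewrite -sq.
rewrite last_rcons => fE; rewrite -{}fE in qP qE *.
have r := axis_ray_of_path qP; set p := (fun _ => _) in r.
rewrite size_rcons in sq; rewrite sq in r.
have p0 : p 0%N = e0 by rewrite /p div0n mod0n expg0 eact1.
have pu i : eproj (p i) = u i.
  rewrite /p sq eproj_eact [in RHS](divn_eq i N) (period_mul _ uN).
  have : (i %% N < N)%N by rewrite ltn_mod.
  case: (i %% N)%N => [|j] jN; first by rewrite e0u.
  have jq : (j < size q)%N by rewrite -ltnS sq.
  have := congr1 (fun s => nth (u 0%N) s j) qE.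
  have jN' := ltnW jN; rewrite (nth_map e0) ?size_rcons ?sq // (nth_map 0%N) ?size_iota //.
  by rewrite nth_iota // add0n add1n nth_rcons jq.
have gU : translators g by exists p.
split=> //=; have [r' r'0 _] := ray_ofP gU.
have pp : ray_of g = p.
  by apply: (axis_ray_eq T_acyclic T_connected r' r); rewrite r'0 p0.
have : p 0%N :: segment p 0 N = e0 :: rcons q (eact g e0).
  apply: (reduced_uniq T_acyclic) => //.
  - by apply: chain_segment; case: r.
  - by rewrite p0.
  by rewrite last_segment last_rcons; case: r => _ _ gp; rewrite add0n -(addn0 N) gp p0.
by rewrite pp => -[].
Qed.

End PeriodicWord.

Lemma primitive_conj h z : primitive_hyperbolic a h ->
  primitive_hyperbolic a (z * h * z^-1)%g.
Proof.
move=> [hyp prim]; split=> [x zx|k r r1 kE].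
  by apply: (hyp (vact z^-1 x)%g); rewrite -[in RHS]zx -!vactM !mulgA mulVg mul1g.
apply: (prim (z^-1 * k * z)%g r r1).
have -> : h = (z^-1 * (z * h * z^-1) * z)%g by rewrite !mulgA mulVg mul1g mulgVK.
rewrite {}kE; elim: (r) => [|n IH]; first by rewrite !expg0 mulg1 mulVg.
by rewrite !expgS -IH !mulgA mulgK.
Qed.

Lemma primitive_ray_uniq h h' m m' p : axis_ray h m p -> axis_ray h' m' p ->
  primitive_hyperbolic a h -> primitive_hyperbolic a h' -> h = h'.
Proof.
move=> r r' ph [_ ph'].
have [k k0 [_ hE]] := primitive_ray_exp T_acyclic T_connected a_free r' r ph.
suff k1 : k = 1%N by rewrite hE k1 expg1.
by apply/eqP; rewrite eqn_leq k0 andbT leqNgt; apply/negP => /(ph' h); apply.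
Qed.

Lemma conj_classP g h : conj_class g h <-> exists z, h = (z * g * z^-1)%g.
Proof.
split=> [[z _ <-]|[z ->]]; first by exists z^-1%g; rewrite invgK conjgE mulgA.
by exists z^-1%g; rewrite // conjgE invgK mulgA.
Qed.

Lemma conj_class_eq g h : conj_class g h -> conj_class h = conj_class g.
Proof.
move=> /conj_classP[z ->]; apply/seteqP; split=> k /conj_classP[w ->]; apply/conj_classP.
  by exists (w * z)%g; rewrite invgM !mulgA.
by exists (w * z^-1)%g; rewrite invgM invgK !mulgA mulgVK mulgVK.
Qed.

Lemma conj_class_refl g : conj_class g g.
Proof. by apply/conj_classP; exists 1%g; rewrite invg1 mulg1 mul1g. Qed.

Definition class_length (C : set G) := translation_length a (xget 1%g C).

Lemma class_lengthE g m p : axis_ray g m p -> class_length (conj_class g) = m.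
Proof.
move=> r; rewrite /class_length.
have : conj_class g (xget 1%g (conj_class g)) by apply: (xgetI _ (conj_class_refl g)).
move=> /conj_classP[z ->].
exact: (axis_ray_length T_acyclic T_connected (axis_ray_conj z r)).
Qed.

(* The prime cycle [D] of the quotient lifts to the axis of [C]; the axis may
   wind several times around [D]. *)
Definition covers (C : set G) (D : set (seq (edge A))) := exists h m p c,
  [/\ C = conj_class h, axis_ray h m p, prime_path c, D = rot_class c &
      forall (x : edge A) i, unroll x c i = eproj (p i)].

Definition cycle_of (C : set G) : set (seq (edge A)) := xget set0 (covers C).

(** After a translation, rays of conjugate elements share a tail, and the projection forgets the
    translation. *)
Lemma covers_fun C D D' : covers C D -> covers C D' -> D = D'.
Proof.
move=> [h [m [p [c [CE r pc -> cp]]]]] [h' [m' [p' [c' [CE' r' pc' -> cp']]]]].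
have : conj_class h h' by rewrite -CE CE'; apply: conj_class_refl.
move=> /conj_classP[z hE]; have rz := axis_ray_conj z r; rewrite -hE in rz.
have [i [j pp']] := axis_ray_meet T_acyclic T_connected rz r'.
apply: (@rot_class_eq A (eproj (p 0%N)) _ _ i j) => // k.
by rewrite cp cp' -pp' eproj_eact.
Qed.

Lemma cycle_ofE C D : covers C D -> cycle_of C = D.
Proof. by move=> CD; apply: xget_unique => // D' /covers_fun; apply. Qed.

Lemma primitive_covers C : primitive_classes a C -> exists2 D, prime_cycles D & covers C D.
Proof.
move=> [h [hyp _] <-]; have [p r] := hyperbolic_axis_ray T_acyclic T_connected x0 hyp.
have [m0 cp _] := r.
have [c [pc cE]] := prime_path_exists m0 (axis_ray_period r) (fun i => wadj_chain i cp).
exists (rot_class c); first by exists c.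
by exists h, (translation_length a h), p, c; split=> // x i; rewrite cE.
Qed.

Lemma cycle_ofP C : primitive_classes a C -> prime_cycles (cycle_of C) /\ covers C (cycle_of C).
Proof. by move=> /primitive_covers[D pD CD]; rewrite (cycle_ofE CD). Qed.

Definition cycle_rep (D : set (seq (edge A))) : seq (edge A) := xget [::] D.

Lemma cycle_repP D : prime_cycles D -> prime_path (cycle_rep D) /\ rot_class (cycle_rep D) = D.
Proof.
move=> [c pc <-]; apply: prime_path_rot => //; apply: xgetI; exact: rot_class_refl.
Qed.

Lemma cycle_of_dvd C : primitive_classes a C ->
  (size (cycle_rep (cycle_of C)) %| class_length C)%N.
Proof.
move=> /cycle_ofP[pD [h [m [p [c [CE r pc DE cp]]]]]].
have [pd dE] := cycle_repP pD; set d := cycle_rep _ in pd dE *.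
have c0 : c != [::] by case: pc => -[].
have : rot_class c d by rewrite -DE -dE; apply: rot_class_refl.
move=> /(@rot_classP A (eproj (p 0%N)) c d c0)[-> _].
rewrite CE (class_lengthE r); apply: (@prime_path_period A (eproj (p 0%N)) _ _ pc) => i.
by rewrite !cp (axis_ray_period r).
Qed.

(** * The count over one prime cycle *)

Section OverCycle.
Variables (D : set (seq (edge A))) (k : nat) (x : edge A).
Hypotheses (pD : prime_cycles D) (k_gt0 : (0 < k)%N).
Let d := cycle_rep D.
Let u := unroll x d.
Let l := size d.
Let N := (k * l)%N.
Let e0 : edge T := elift (u 0%N).

Let pd : prime_path d := (cycle_repP pD).1.
Let dE : rot_class d = D := (cycle_repP pD).2.
Let l_gt0 : (0 < l)%N := closed_path_neq0 pd.1.
Let N_gt0 : (0 < N)%N. Proof. by rewrite muln_gt0 k_gt0. Qed.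
Let e0u : eproj e0 = u 0%N. Proof. exact: proj_elift. Qed.
Let ul : period u l.
Proof. by move=> i; rewrite -[X in (X + i)%N]mul1n /u unroll_period. Qed.
Let uN : period u N. Proof. exact: period_mul. Qed.
Let u_adj j : wadj (u j) (u j.+1).
Proof. by have /(closed_pathE x)[_] := pd.1. Qed.

Local Notation U := (translators N e0 u).
Local Notation ray g := (ray_of N e0 u g).

Definition root_class g : set G := xget set0 [set C | exists h m,
  [/\ C = conj_class h, primitive_hyperbolic a h & axis_ray h m (ray g)]].

Lemma root_classP g : U g -> exists h m,
  [/\ root_class g = conj_class h, primitive_hyperbolic a h & axis_ray h m (ray g)].
Proof.
move=> /ray_ofP[r _ _]; have [h [m [rh ph _]]] := primitive_root T_acyclic T_connected a_free r.
apply: (@xgetPex _ set0 [set C | exists h m,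
  [/\ C = conj_class h, primitive_hyperbolic a h & axis_ray h m (ray g)]]).
by exists (conj_class h), h, m.
Qed.

Lemma root_classE g h m : U g -> primitive_hyperbolic a h -> axis_ray h m (ray g) ->
  root_class g = conj_class h.
Proof.
move=> /root_classP[h' [m' [-> ph' rh']]] ph rh.
by rewrite (primitive_ray_uniq rh' rh).
Qed.

Lemma translators_ray g p : axis_ray g N p -> p 0%N = e0 -> (forall i, eproj (p i) = u i) ->
  U g /\ ray g = p.
Proof.
move=> r p0 pu; have Ug : U g by exists p.
split=> //; have [r' r'0 _] := ray_ofP Ug.
by apply: (axis_ray_eq T_acyclic T_connected r' r); rewrite r'0 p0.
Qed.

Lemma base_ray C : primitive_classes a C -> cycle_of C = D -> exists h m p,
  [/\ C = conj_class h, primitive_hyperbolic a h, axis_ray h m p, p 0%N = e0 &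
      forall i, eproj (p i) = u i].
Proof.
move=> pC CD; have [_] := cycle_ofP pC; rewrite CD => -[h [m [p [c [CE r pc DE cp]]]]].
have c0 : c != [::] by case: pc => -[].
have : rot_class c d by rewrite -DE -dE; apply: rot_class_refl.
move=> /(@rot_classP A x c d c0)[_ [j dj]].
have pj i : eproj (p (j + i)%N) = u i by rewrite -(cp x) -dj.
have /eprojP[z ze] : eproj (p (j + 0)%N) = eproj e0 by rewrite pj e0u.
exists (z * h * z^-1)%g, m, (fun i => eact z (p (j + i)%N)); split=> //.
- by rewrite CE; apply/esym/conj_class_eq/conj_classP; exists z.
- apply: primitive_conj; case: pC => h' ph'; rewrite CE => hh'.
  have /conj_classP[w ->] : conj_class h' h by rewrite hh'; apply: conj_class_refl.
  exact: primitive_conj.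
- exact/axis_ray_conj/axis_ray_shift.
by move=> i; rewrite eproj_eact.
Qed.

(** These translators are the conjugates [z h^r z^-1], where [z] carries to [e0] one of the [m / l]
    edges [p (i * l)] in a period of [h]. Each such edge leaves a coset of the stabilizer for [z],
    and distinct [z] give distinct conjugates. *)
Lemma set_size_root_class h m p s : primitive_hyperbolic a h -> axis_ray h m p ->
  p 0%N = e0 -> (forall i, eproj (p i) = u i) -> (m %| N)%N ->
  set_size (estabilizer a e0) s ->
  set_size (U `&` [set g | root_class g = conj_class h]) (m %/ l * s).
Proof.
move=> ph rh p0 pu /dvdnP[r NE] Hs; have [m0 cp hp] := rh.
have lm : (l %| m)%N.
  by apply: (@prime_path_period A x _ _ pd) => i; rewrite -/u -!pu (axis_ray_period rh).
have r0 : (0 < r)%N by move: N_gt0; rewrite NE muln_gt0 => /andP[].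
pose g0 := (h ^+ r)%g.
have rg0 : axis_ray g0 N p by rewrite NE; apply: axis_ray_exp.
have hg0 : commute h g0 by apply: commuteX.
pose Z : set G := [set z | exists2 i, (i < m %/ l)%N & eact z (p (i * l)%N) = e0].
have HZ : set_size Z (m %/ l * s).
  have HI : set_size [set i | (i < m %/ l)%N] (m %/ l).
    by exists (iota 0 (m %/ l)); split; rewrite ?iota_uniq ?size_iota // => i; rewrite mem_iota.
  have HB := set_size_image (f := fun i => p (i * l)%N) _ HI.
  apply: (set_size_fibration (f := fun z => eact z^-1%g e0) (HB _)).
  - by move=> i j _ _ /(chain_inj cp)/eqP; rewrite eqn_pmul2r // => /eqP.
  - by move=> z [i im zi]; exists i; rewrite // -zi eactVK.
  move=> _ [i im <-]; have pe : eproj (p (i * l)%N) = eproj e0.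
    by rewrite pu e0u -[(i * l)%N]addn0 (period_mul _ ul).
  apply: set_size_ext (set_size_transporter_r pe Hs) => z; split=> [ze|[_ /= <-]].
    by split; [exists i|rewrite /= -ze eactVK].
  by rewrite /= -eactM mulgV eact1.
have Zray z i : eact z (p (i * l)%N) = e0 ->
    U (z * g0 * z^-1)%g /\ ray (z * g0 * z^-1)%g = (fun j => eact z (p (i * l + j)%N)).
  move=> zi; apply: translators_ray; first exact/axis_ray_conj/axis_ray_shift.
    by rewrite addn0.
  by move=> j; rewrite eproj_eact pu (period_mul _ ul).
apply: set_size_ext (set_size_image (f := fun z => (z * g0 * z^-1)%g) _ HZ); last first.
  move=> z w [i im zi] [j jm wj] zw.
  have [_ rz] := Zray _ _ zi; have [_ rw] := Zray _ _ wj; rewrite -zw rz in rw.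
  pose y := (w^-1 * z)%g.
  have yg0 : commute y g0.
    rewrite /commute /y; apply: (mulgI w); apply: (mulIg z^-1%g).
    by rewrite !mulgA mulgV mul1g zw mulgK.
  have yp n : eact y (p (i * l + n)%N) = p (j * l + n)%N.
    by rewrite /y eactM (congr1 (@^~ n) rw) eactVK.
  have lt i' : (i' < m %/ l)%N -> (i' * l < m)%N by rewrite -{2}(divnK lm) ltn_pmul2r.
  (* A nontrivial shift of [p] would be a multiple of the translation length [m] of the primitive
     [h], but here it is smaller than [m]. *)
  have fix1 y' n n' : commute y' g0 -> (n <= n')%N -> (n' < m)%N ->
      (forall k, eact y' (p (n + k)%N) = p (n' + k)%N) -> y' = 1%g.
    move=> yg nn' n'm yP; have := axis_ray_translate rg0 yg nn' yP.
    have [->|n0] := posnP (n' - n)%N => yP'.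
      by apply: (axis_ray_inj T_acyclic T_connected a_free rg0) => j'; rewrite yP' eact1.
    have ry : axis_ray y' (n' - n) p by split.
    have [r' r'0 [nE _]] := primitive_ray_exp T_acyclic T_connected a_free ry rh ph.
    have : (m <= n' - n)%N by rewrite nE leq_pmull.
    by rewrite leqNgt (leq_ltn_trans (leq_subr _ _)).
  suff : y = 1%g by move=> /(congr1 (fun v => w * v)%g); rewrite /y mulgA mulgV mul1g mulg1.
  have [ij|/ltnW ji] := leqP (i * l) (j * l); first exact: (fix1 _ _ _ yg0 ij (lt _ jm)).
  suff : y^-1%g = 1%g by move=> /(congr1 (fun v => v^-1)%g); rewrite invgK invg1.
  apply: (fix1 _ _ _ _ ji (lt _ im)) => [|n]; last by rewrite -yp eactVK.
  exact/commute_sym/commuteV/commute_sym.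
move=> g; split=> [[z [i im zi] <-]|[Ug /= gC]].
  have [Uz rz] := Zray _ _ zi; split=> //=.
  rewrite (root_classE Uz (primitive_conj z ph) (m := m)); last first.
    rewrite rz; apply: axis_ray_conj; exact: axis_ray_shift.
  by apply/conj_class_eq/conj_classP; exists z.
have [rg rg0' rgu] := ray_ofP Ug.
have [h' [m' [h'C ph' rh']]] := root_classP Ug.
have [z h'E] : exists z, h' = (z * h * z^-1)%g.
  by apply/conj_classP; rewrite -gC h'C; apply: conj_class_refl.
have mm' : m' = m.
  by rewrite -(class_lengthE rh') -h'C gC (class_lengthE rh).
have gE : g = (z * g0 * z^-1)%g.
  have [r' r'0 [NE' ->]] := primitive_ray_exp T_acyclic T_connected a_free rg rh' ph'.
  have -> : r' = r by apply/eqP; rewrite -(eqn_pmul2r m0) -NE -mm' -NE'.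
  rewrite h'E /g0; elim: (r) => [|n IH]; first by rewrite !expg0 mulg1 mulgV.
  by rewrite !expgS IH !mulgA mulgVK.
have rz : axis_ray g N (fun i => eact z (p i)) by rewrite gE; apply: axis_ray_conj.
have [i [j ij]] := axis_ray_meet T_acyclic T_connected rg rz.
have le : (i <= i * N)%N by rewrite leq_pmulr.
set b := (j + (i * N - i))%N.
(* Powers of [g] on the left of [z] and of [h] on the right do not change the conjugate. They are
   chosen so that [w] carries a tail of [p] starting within its first period exactly onto the ray of
   [g]. *)
pose w := (g^-1 ^+ i * z * h ^+ (b %/ m))%g.
have wray n : ray g n = eact w (p (b %% m + n)%N).
  apply: (can_inj (eactVK a (g ^+ i)%g)).
  rewrite -(axis_ray_expE _ _ rg) -{1}(subnKC le) -addnA ij addnA -/b /w.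
  rewrite -eactM !mulgA expVgn mulgV mul1g eactM -(axis_ray_expE _ _ rh).
  by rewrite addnA -divn_eq.
have wE : g = (w * g0 * w^-1)%g.
  have c1 : commute g (g^-1 ^+ i)%g by rewrite expVgn; apply/commuteV/commuteX.
  have c2 : commute (h ^+ (b %/ m))%g g0 by apply/commute_sym/commuteX/commute_sym.
  apply: (mulIg w); rewrite mulgVK /w -!mulgA c2.
  have gz : (z * g0 = g * z)%g by rewrite gE mulgVK.
  by rewrite [(z * (g0 * _))%g]mulgA gz !mulgA c1.
have lb : (l %| b %% m)%N.
  by apply: (@prime_path_period A x _ _ pd) => n; rewrite -/u -pu -(eproj_eact w) -wray rgu.
exists w; last by rewrite -wE.
exists ((b %% m) %/ l)%N; last by rewrite divnK // -(addn0 (b %% m)%N) -wray.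
by rewrite ltn_divRL // divnK // ltn_mod.
Qed.

Lemma path_weight_exp :
  \prod_(j < N) weight2 (u j) (u j.+1) = path_weight d ^+ k.
Proof.
have -> : path_weight d = \prod_(j < l) weight2 (u j) (u j.+1).
  rewrite /path_weight (big_nth (x, x)) size_zip size_rot minnn big_mkord.
  apply: eq_bigr => j _; rewrite nth_zip ?size_rot //=.
  by rewrite (nth_unroll x (ltn_ord j)) (nth_unroll x) ?size_rot // unroll_rot.
rewrite /N; elim: (k) => [|n IH]; first by rewrite big_ord0.
rewrite mulSn exprS -IH -!(big_mkord xpredT (fun j => weight2 (u j) (u j.+1))).
rewrite (big_cat_nat (n := l)) ?leq_addr //=; congr (_ * _).
rewrite -{1}[l]add0n big_addn addKn; apply: eq_bigr => j _.
by rewrite addnC -addnS !ul.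
Qed.

Lemma primitive_class_length C : primitive_classes a C -> (0 < class_length C)%N.
Proof.
move=> [h [hyp _] <-]; have [p r] := hyperbolic_axis_ray T_acyclic T_connected x0 hyp.
by rewrite (class_lengthE r); case: r.
Qed.

(* Count the translators of [e0], up to the stabilizer of [e0], in two ways:
   by the paths they generate and by the conjugacy classes of their roots. *)
Lemma sum_class_length : exists t : seq (set G),
  [/\ uniq t,
      forall C, [/\ primitive_classes a C, cycle_of C = D & (class_length C %| N)%N] <-> C \in t &
      (\sum_(C <- t) class_length C)%:R = l%:R * path_weight d ^+ k].
Proof.
have [s s0 Hs] := estab_size stab_finite e0.
have [K HK KE] := set_size_translators N_gt0 e0u uN u_adj Hs.
have [n [t [ut _ tP]]] : exists n, set_size (root_class @` U) n.
  exact/finite_set_size/finite_image/(set_size_finite HK).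
have tE C : [/\ primitive_classes a C, cycle_of C = D & (class_length C %| N)%N] <-> C \in t.
  split=> [[pC CD CN]|/tP[g Ug <-]].
    have [h [m [p [CE ph rh p0 pu]]]] := base_ray pC CD.
    rewrite CE (class_lengthE rh) in CN.
    have H := set_size_root_class ph rh p0 pu CN Hs.
    move: CN => /dvdnP[r NE].
    have r0 : (0 < r)%N by move: N_gt0; rewrite NE muln_gt0 => /andP[].
    have rN : axis_ray (h ^+ r)%g N p by rewrite NE; apply: axis_ray_exp.
    have [Ug rg] := translators_ray rN p0 pu.
    apply/tP; exists (h ^+ r)%g => //; rewrite CE.
    by apply: (root_classE Ug ph (m := m)); rewrite rg.
  have [h [m [-> ph rh]]] := root_classP Ug.
  have [rg rg0 rgu] := ray_ofP Ug.
  split; first by exists h.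
    apply: cycle_ofE; exists h, m, (ray g), d; split=> // y i.
    by rewrite rgu /u (@unroll_def A y x) //; case: pd => -[].
  have [r _ [-> _]] := primitive_ray_exp T_acyclic T_connected a_free rg rh ph.
  by rewrite (class_lengthE rh) dvdn_mull.
exists t; split=> //.
have KsE : (K * s = \sum_(C <- t) (class_length C %/ l * s))%N.
  apply: (set_size_sum (f := root_class) HK ut) => [g Ug|C /tE[pC CD CN]].
    by apply/tP; exists g.
  have [h [m [p [CE ph rh p0 pu]]]] := base_ray pC CD.
  rewrite CE (class_lengthE rh) in CN *.
  exact: set_size_root_class ph rh p0 pu CN Hs.
have -> : (\sum_(C <- t) class_length C = l * K)%N.
  have -> : K = (\sum_(C <- t) (class_length C %/ l))%N.
    by apply/eqP; rewrite -(eqn_pmul2r s0) KsE big_distrl.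
  rewrite big_distrr /= !big_seq; apply: eq_bigr => C /tE[pC CD _].
  by rewrite mulnC divnK // /l /d -CD cycle_of_dvd.
by rewrite natrM KE path_weight_exp.
Qed.

End OverCycle.

Theorem zeta_eq :
  (selberg_multipliable a <-> bass_ihara_multipliable A) /\
  selberg_zeta a = bass_ihara_zeta A.
Proof.
apply: (@euler_product_eq _ _ _ _ _ class_length _
  (fun D => path_weight (cycle_rep D)) (fun D => size (cycle_rep D)) cycle_of).
- exact: primitive_class_length.
- by move=> D /cycle_repP[[cc _] _]; apply: closed_path_neq0.
- move=> C pC; rewrite -fps_geom_inv ?primitive_class_length //.
  by rewrite rmorph1 mul1r.
- move=> D pD; rewrite -fps_geom_inv //.
  by have [[cc _] _] := cycle_repP pD; apply: closed_path_neq0.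
- by move=> C /cycle_ofP[].
- exact: cycle_of_dvd.
move=> D k pD k0; have [[[c0 _] _] _] := cycle_repP pD.
have [x _] : exists x : edge A, true by case: (cycle_rep D) c0 => // y; exists y.
exact: (sum_class_length x pD k0).
Qed.

Lemma axis_centralizer_trivial g : hyperbolic a g -> axis_centralizer a g = [set 1%g].
Proof.
move=> /(hyperbolic_axis_ray T_acyclic T_connected x0)[p r].
apply/seteqP; split=> [h [fix_h _]|_ ->].
  apply: (axis_ray_fix T_acyclic T_connected a_free r) => i.
  exact/fix_h/(axis_ray_axis T_acyclic T_connected i r).
by split; [move=> x _; apply: vact1|rewrite /commute mul1g mulg1].
Qed.

Theorem zeta_eq_centrally_rigid c : centrally_rigid a c ->
  (selberg_multipliable a <-> bass_ihara_multipliable A) /\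
  selberg_zeta a = bass_ihara_zeta A ^+ c.
Proof.
move=> rigid; have [iff zetaE] := zeta_eq; split=> //.
have [[g pg]|noprim] := pselect (exists g, primitive_hyperbolic a g).
  suff -> : c = 1%N by rewrite expr1.
  have := rigid g pg; rewrite (axis_centralizer_trivial pg.1) => c1.
  apply/card_eq_II; apply: card_eq_trans (card_set1 (x := 1%g : G)).
  by rewrite card_eq_sym.
(* Here rigidity does not constrain [c], but the product is empty and every power of 1 is 1. *)
rewrite -zetaE; suff -> : selberg_zeta a = 1 by rewrite expr1n.
have C0 : primitive_classes a = set0.
  by rewrite -subset0 => C [g pg _]; apply: noprim; exists g.
rewrite /selberg_zeta C0; apply: fps_prodE => n; exists fset0 => // J _ JA.
suff -> : J = fset0 by rewrite big_nil.
by apply/fsetP => C; rewrite inE; apply/negP => /JA.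
Qed.

End Zeta.

(** * The Bruhat-Tits tree *)

Lemma ord2E (j : 'I_2) : j = 0 \/ j = 1.
Proof. by case: j => -[|[|//]] ?; [left|right]; apply: val_inj. Qed.

Lemma det_mx22 (R : comNzRingType) (M : 'M[R]_2) :
  \det M = M 0 0 * M 1 1 - M 0 1 * M 1 0.
Proof.
rewrite (expand_det_row _ 0) big_ord_recl big_ord1 /cofactor !det_mx11 !mxE /=.
rewrite expr0 expr1 mul1r mulN1r mulrN.
by congr (_ * M _ _ - M _ _ * M _ _); apply: val_inj.
Qed.

Section FpsField.
Variable F : fieldType.
Local Notation O := {fps F}.
Implicit Types f g : O.

Definition fps_const f : F := f 0%N.

Fact fps_const_zmod_morphism : zmod_morphism fps_const.
Proof. by []. Qed.
Fact fps_const_monoid_morphism : monoid_morphism fps_const.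
Proof. by split=> // f g; rewrite /fps_const fpsEM big_ord1. Qed.
HB.instance Definition _ :=
  GRing.isZmodMorphism.Build O F fps_const fps_const_zmod_morphism.
HB.instance Definition _ :=
  GRing.isMonoidMorphism.Build O F fps_const fps_const_monoid_morphism.

Lemma fps_unit_const f : (f \is a GRing.unit) = (fps_const f != 0).
Proof. by apply/idP/idP => [/fps_ord_unit[]|/fps_unitE]. Qed.

Lemma fps_const0P f : fps_const f = 0 <-> exists g, f = fpsX * g.
Proof.
split=> [f0|[g ->]]; last by rewrite /fps_const fpsE_XM.
exists (Fps (fun n => f n.+1)); apply/fpsP => n; rewrite fpsE_XM.
by case: n.
Qed.

Lemma fps_ord_XM f n : fps_ord_is (fpsX * f) n.+1 <-> fps_ord_is f n.
Proof.
split=> [[fn lt]|[fn lt]]; split; rewrite ?fpsE_XM // in fn *.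
  by move=> m /(lt m.+1); rewrite fpsE_XM.
by case=> [|m] ltm; rewrite fpsE_XM // lt.
Qed.

Local Notation cmx := (map_mx fps_const).

Lemma const_mx0P m n (N : 'M[O]_(m, n)) : cmx N = 0 -> exists M, N = fpsX *: M.
Proof.
move=> N0; have ex i j : exists g, N i j = fpsX * g.
  by apply/fps_const0P; have /matrixP/(_ i j) := N0; rewrite !mxE.
exists (\matrix_(i, j) projT1 (cid (ex i j))); apply/matrixP => i j.
by rewrite !mxE; case: cid.
Qed.

(** A singular [B] is a column [u] times a row [v]. Then [A u] and [v C] are nonzero, and so is
    their product. *)
Lemma mulmx_rank1 (A B C : 'M[F]_2) :
  \det B = 0 -> A *m B != 0 -> B *m C != 0 -> A *m B *m C != 0.
Proof.
move=> dB; have : (\rank B < 2)%N.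
  rewrite ltn_neqAle rank_leq_row andbT -/(row_free B) row_free_unit unitmxE dB.
  by rewrite unitr0.
have [r [u [v BE]]] :
    exists r, exists u : 'M_(2, r), exists v : 'M_(r, 2), r = \rank B /\ B = u *m v.
  by exists (\rank B), (col_base B), (row_base B); rewrite mulmx_base.
case: BE => <- ->; case: r u v => [|[|//]] u v _.
  by rewrite thinmx0 mul0mx mulmx0 eqxx.
move=> Au vC.
have u0 : A *m u != 0 by apply: contraNneq Au => E; rewrite mulmxA E mul0mx.
have v0 : v *m C != 0 by apply: contraNneq vC => E; rewrite -mulmxA E mulmx0.
have [i ui] : exists i, (A *m u) i 0 != 0.
  apply/existsP; apply: contraNT u0; rewrite negb_exists => /forallP H.
  by apply/eqP/matrixP => i j; rewrite ord1 [RHS]mxE; apply/eqP; rewrite -[_ == _]negbK H.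
have [j vj] : exists j, (v *m C) 0 j != 0.
  apply/existsP; apply: contraNT v0; rewrite negb_exists => /forallP H.
  by apply/eqP/matrixP => i' j; rewrite ord1 [RHS]mxE; apply/eqP; rewrite -[_ == _]negbK H.
rewrite mulmxA -mulmxA; apply/eqP => /matrixP/(_ i j); rewrite [LHS]mxE big_ord1 [RHS]mxE => /eqP.
by rewrite mulf_eq0 (negbTE ui) (negbTE vj).
Qed.

(** A linear relation between the rows of the residue gives a combination of the rows of [N]
    divisible by [fpsX]; dividing it out splits off one edge of a path. *)
Lemma fps_mx_factor (N : 'M[O]_2) : \det (cmx N) = 0 ->
  exists B M : 'M[O]_2, N = B *m M /\ \det B = fpsX.
Proof.
move=> /eqP/det0P[v v0 vN].
have vE j : v 0 0 * fps_const (N 0 j) + v 0 1 * fps_const (N 1 j) = 0.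
  have /matrixP/(_ 0 j) := vN; rewrite !mxE big_ord_recl big_ord1 !mxE => <-.
  by rewrite (_ : lift ord0 ord0 = 1) //; apply: val_inj.
have [v1|v1] := eqVneq (v 0 1) 0.
  have v00 : v 0 0 != 0.
    apply: contraNneq v0 => v00; apply/eqP/matrixP => i j; rewrite ord1 mxE.
    by have [->|->] := ord2E j.
  have ex j : exists g, N 0 j = fpsX * g.
    apply/fps_const0P; have := vE j; rewrite v1 mul0r addr0 => /eqP.
    by rewrite mulf_eq0 (negbTE v00) => /eqP.
  pose m j := projT1 (cid (ex j)); have mE j : N 0 j = fpsX * m j by rewrite /m; case: cid.
  exists (\matrix_(i, j) (if i == j then (if i == 0 then fpsX else 1) else 0)).
  exists (\matrix_(i, j) (if i == 0 then m j else N i j)); split.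
    apply/matrixP => i j; rewrite mxE big_ord_recl big_ord1 !mxE.
    rewrite (_ : lift ord0 ord0 = 1) /=; last exact: val_inj.
    have [->|->] := ord2E i; rewrite /= ?mul0r ?addr0 ?add0r ?mul1r //.
  by rewrite det_mx22 !mxE /= mulr1 mulr0 subr0.
pose b := v 0 0 / v 0 1.
have ex j : exists g, N 1 j + fpsC b * N 0 j = fpsX * g.
  apply/fps_const0P.
  have -> : fps_const (N 1 j + fpsC b * N 0 j) = fps_const (N 1 j) + b * fps_const (N 0 j).
    by rewrite rmorphD rmorphM.
  apply: (mulfI v1).
  rewrite mulr0 -(vE j) mulrDr addrC mulrA; congr (_ * _ + _).
  by rewrite /b mulrC divfK.
pose m j := projT1 (cid (ex j)).
have mE j : N 1 j + fpsC b * N 0 j = fpsX * m j by rewrite /m; case: cid.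
exists (\matrix_(i, j) (if i == 0 then (j == 0)%:R else if j == 0 then - fpsC b else fpsX)).
exists (\matrix_(i, j) (if i == 0 then N 0 j else m j)); split.
  apply/matrixP => i j; rewrite mxE big_ord_recl big_ord1 !mxE.
  rewrite (_ : lift ord0 ord0 = 1) /=; last exact: val_inj.
  have [->|->] := ord2E i; rewrite /= ?mul1r ?mul0r ?addr0 //.
  by rewrite -mE mulNr addrC addrK.
by rewrite det_mx22 !mxE /= mul1r mul0r subr0.
Qed.
End FpsField.

Lemma scale_comm (K : fieldType) (c d : K) L : scale c (scale d L) = scale d (scale c L).
Proof. by rewrite !scale_scale mulrC. Qed.

Lemma scale_invK (K : fieldType) (c : K) L : c != 0 ->
  L = scale c^-1 (scale c L).
Proof. by move=> c0; rewrite scale_scale mulVf // scale1. Qed.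

(** * Paths of lattice classes as matrix products *)

Section Lattices.
Variables (F : fieldType) (K : fieldType) (iota : {rmorphism {fps F} -> K}).
Local Notation O := {fps F}.
Local Notation imx := (map_mx iota).
Local Notation cmx := (map_mx (@fps_const F)).
Implicit Types (h k : 'M[K]_2) (x y z : bt_vert iota).

Hypothesis iota_inj : injective iota.

Definition represents h x := h \in unitmx /\ val x = homothety_class (lattice iota h).

Lemma represents_ex x : exists h, represents h x.
Proof.
have /set_mem[_ [h hU ->] xE] := valP x; by exists h; split.
Qed.

Lemma represented_ex h : h \in unitmx -> exists x, represents h x.
Proof.
move=> hU.
have H : homothety_class (lattice iota h) \in [set homothety_class L | L in is_lattice iota].
  by apply/mem_set; exists (lattice iota h) => //; exists h.
by exists (SigSub H); split.
Qed.

Lemma represents_inj h x y : represents h x -> represents h y -> x = y.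
Proof. by move=> [_ hx] [_ hy]; apply: val_inj; rewrite hx hy. Qed.

Lemma imx_inj m n : injective (imx : 'M[O]_(m, n) -> 'M[K]_(m, n)).
Proof.
move=> M N /matrixP MN; apply/matrixP => i j; apply: iota_inj.
by have := MN i j; rewrite !mxE.
Qed.

Lemma imx_unit (N : 'M[O]_2) : \det N != 0 -> imx N \in unitmx.
Proof. by move=> dN; rewrite unitmxE det_map_mx unitfE -(rmorph0 iota) (inj_eq iota_inj). Qed.

Lemma represents_mul_unit h x (N : 'M[O]_2) : N \in unitmx ->
  represents (h *m imx N) x -> represents h x.
Proof.
move=> NU [+ xE]; rewrite unitmx_mul => /andP[hU _]; split=> //.
by rewrite xE lattice_mul_unit.
Qed.

Lemma represents_scale h x c : c != 0 -> represents (c *: h) x <-> represents h x.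
Proof.
move=> c0; have E : (c *: h \in unitmx) = (h \in unitmx).
  by rewrite !unitmxE detZ unitrM unitfE expf_neq0.
have cE : homothety_class (lattice iota (c *: h)) = homothety_class (lattice iota h).
  by rewrite -scale_lattice homothety_class_scale.
by rewrite /represents E cE.
Qed.

Lemma represents_eq h k x : represents h x -> represents k x ->
  exists c, exists2 U : 'M[O]_2, U \in unitmx & c != 0 /\ k = c *: (h *m imx U).
Proof.
move=> [hU hx] [kU kx].
have := homothety_class_refl (lattice iota k); rewrite -kx hx => -[c /= c0].
rewrite scale_lattice => E.
have [|U kE] := @lattice_subP _ _ iota k (c *: h); first by rewrite E.
have [|V hE] := @lattice_subP _ _ iota (c *: h) k; first by rewrite E.
exists c, U; last by rewrite kE scalemxAl.
suff /mulmx1_unit[] : V *m U = 1%:M by [].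
apply: imx_inj; rewrite map_mxM map_mx1; apply: (can_inj (mulKmx kU)).
by rewrite mulmxA -hE -kE mulmx1.
Qed.

(** [B] expresses the smaller lattice in the basis [h]. If its residue vanished, that lattice would
    lie in [fpsX] times the larger one, against the strict inclusion. *)
Lemma adj_mul h x y : represents h x -> bt_adj fpsX x y ->
  exists B : 'M[O]_2,
    [/\ represents (h *m imx B) y, fps_ord_is (\det B) 1 & cmx B != 0].
Proof.
move=> [hU xE] [L [L' [xL yL' lt lt']]].
move: xL; rewrite xE => -[c /= c0 LE].
have ci0 : c^-1 != 0 by rewrite invr_neq0.
have hE : lattice iota h = scale c^-1 L by rewrite -LE -scale_invK.
have [[k0 k0U L'E] yE] := bt_vertP yL'; pose k := c^-1 *: k0.
have kE : lattice iota k = scale c^-1 L' by rewrite L'E scale_lattice.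
have p1 : scale (iota fpsX) (lattice iota h) `<` lattice iota k.
  by rewrite hE kE scale_comm; apply: scale_proper.
have p2 : lattice iota k `<` lattice iota h by rewrite hE kE; apply: scale_proper.
have [B kB] := lattice_subP p2.1; exists B.
have [n [n' [dk nn' nU n'U]]] := lattice_proper_det iota_inj hU p1 p2.
have dB : \det B = n.
  apply: iota_inj; apply: (@mulfI _ (\det h)); first by rewrite -unitfE -unitmxE.
  by rewrite -det_map_mx -det_mulmx -kB dk.
rewrite -kB dB; split.
- apply/(represents_scale _ _ ci0); split=> //; by rewrite yE L'E.
- exact: fps_ord_nonunit nn' nU n'U.
apply/negP => /eqP/const_mx0P[M BE]; apply: p1.2.
rewrite kB BE map_mxZ -scalemxAr -scale_lattice.
by apply: scale_sub; apply: lattice_mulS.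
Qed.

Lemma mul_adj h x y (B : 'M[O]_2) : fps_ord_is (\det B) 1 ->
  represents h x -> represents (h *m imx B) y -> bt_adj fpsX x y.
Proof.
move=> oB [hU xE] [kU yE].
have hcan := can_inj (mulKmx hU).
have dB0 : fps_const (\det B) = 0 by apply: oB.2.
exists (lattice iota h), (lattice iota (h *m imx B)); split.
- by rewrite xE; apply: homothety_class_refl.
- by rewrite yE; apply: homothety_class_refl.
- have /fps_const0P[u dBE] := dB0.
  have uU : u \is a GRing.unit.
    by rewrite fps_unit_const; have := oB.1; rewrite dBE fpsE_XM.
  (* The adjugate inverts [B] up to a uniformizer and a unit. *)
  have XE : iota fpsX *: h = h *m imx B *m imx (u^-1 *: \adj B).
    rewrite -mulmxA -map_mxM -scalemxAr mul_mx_adj dBE scale_scalar_mx.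
    by rewrite mulrCA mulVr // mulr1 map_scalar_mx mul_mx_scalar.
  split; first by rewrite scale_lattice XE; apply: lattice_mulS.
  rewrite scale_lattice => /lattice_subP[N BE].
  have /imx_inj BE' : imx B = imx (fpsX *: N).
    by apply: hcan; rewrite BE map_mxZ -scalemxAl scalemxAr.
  by have := oB.1; rewrite BE' detZ exprS -mulrA expr1 !fpsE_XM eqxx.
split; first exact: lattice_mulS.
move=> /lattice_subP[N hE].
have /imx_inj NE : imx (B *m N) = imx 1%:M.
  by apply: hcan; rewrite map_mx1 mulmx1 map_mxM mulmxA -hE.
have /mulmx1_unit[+ _] := NE.
by rewrite unitmxE fps_unit_const dB0 eqxx.
Qed.

(** If the residues multiply to 0, then [B C] is [fpsX] times an integral matrix, which is
    invertible since [det (B C)] has order 2. Hence the second step returns to [x]. *)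
Lemma represents_back h x z (B : 'M[O]_2) (C : 'M[O]_2) :
  fps_ord_is (\det B) 1 -> fps_ord_is (\det C) 1 -> cmx B *m cmx C = 0 ->
  represents h x -> represents (h *m imx B *m imx C) z -> x = z.
Proof.
move=> oB oC BC0 hx hz.
have /const_mx0P[M ME] : cmx (B *m C) = 0 by rewrite map_mxM.
have oM : fps_ord_is (\det M) 0.
  have := fps_ordM oB oC; rewrite -det_mulmx ME detZ exprS expr1 -mulrA.
  by move=> /fps_ord_XM/fps_ord_XM.
have MU : M \in unitmx by rewrite unitmxE fps_unit_const; apply: oM.1.
have X0 : iota fpsX != 0 by rewrite -(rmorph0 iota) (inj_eq iota_inj) fpsX_neq0.
move: hz; rewrite -mulmxA -map_mxM ME map_mxZ -scalemxAr => /(represents_scale _ _ X0).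
by move=> /(represents_mul_unit MU); apply: represents_inj.
Qed.

(** A return to [x] would make [B C] an integral scalar [d] times an invertible matrix; the singular
    residue of [B] forces [fpsX] to divide [d], so the residue of [B C] would be 0. *)
Lemma represents_loop h x (B C : 'M[O]_2) :
  fps_ord_is (\det B) 1 -> cmx B *m cmx C != 0 ->
  represents h x -> ~ represents (h *m imx (B *m C)) x.
Proof.
move=> oB BC0 hx hBC; have [hU _] := hx.
have [c [U UU [c0 E]]] := represents_eq hx hBC.
have E' : imx (B *m C) = c *: imx U.
  by apply: (can_inj (mulKmx hU)); rewrite E scalemxAr.
have cE : c%:M = imx (B *m C *m invmx U).
  by rewrite map_mxM E' -scalemxAl -map_mxM mulmxV // map_mx1 scalemx1.
set P := B *m C *m invmx U in cE; pose d := P 0 0.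
have cd : c = iota d by have /matrixP/(_ 0 0) := cE; rewrite [LHS]mxE [RHS]mxE eqxx mulr1n.
have PE : B *m C = d *: U by apply: imx_inj; rewrite E' cd map_mxZ.
have : fps_const (\det (B *m C)) = 0.
  by rewrite det_mulmx rmorphM /= [X in X * _](oB.2 0%N) // mul0r.
rewrite PE detZ rmorphM rmorphXn => /eqP.
rewrite mulf_eq0 expf_eq0 /= => /orP[/eqP d0|/eqP U0].
  have dU : cmx (d *: U) = fps_const d *: cmx U := map_mxZ _ _ _.
  by move/eqP: BC0; apply; rewrite -map_mxM PE dU d0 scale0r.
by move: UU; rewrite unitmxE fps_unit_const U0 eqxx.
Qed.

Fixpoint reduced_walk x y (s : seq (bt_vert iota)) : Prop :=
  if s is z :: s' then [/\ bt_adj fpsX y z, z <> x & reduced_walk y z s'] else True.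

(* A path of length [n >= 1] goes from the class of [h] to that of [h B_1 ... B_n]
   with [B_i] of determinant a uniformizer; when the path is reduced, the product
   of the rank one residues of the [B_i] does not vanish. *)
Lemma reduced_walk_end h x y (B : 'M[O]_2) s :
  represents h x -> represents (h *m imx B) y -> fps_ord_is (\det B) 1 -> cmx B != 0 ->
  reduced_walk x y s ->
  exists C, represents (h *m imx (B *m C)) (last y s) /\ cmx B *m cmx C != 0.
Proof.
elim: s h x y B => [|z s IH] h x y B hx hy oB B0 /=.
  by move=> _; exists 1%:M; rewrite mulmx1 map_mx1 mulmx1.
move=> [yz zx red]; have [B2 [hz oB2 B20]] := adj_mul hy yz.
have [C [hC BC]] := IH _ _ _ _ hy hz oB2 B20 red.
exists (B2 *m C); split; first by rewrite map_mxM mulmxA.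
rewrite map_mxM mulmxA; apply: mulmx_rank1 => //.
  by rewrite det_map_mx; apply: oB2.2.
by apply/eqP => BB; apply: zx; rewrite (represents_back oB oB2 BB hx hz).
Qed.

Lemma reduced_walk_open x y s : bt_adj fpsX x y -> reduced_walk x y s -> last y s <> x.
Proof.
have [h hx] := represents_ex x; move=> xy red yx.
have [B [hy oB B0]] := adj_mul hx xy.
have [C [hC BC]] := reduced_walk_end hx hy oB B0 red.
by rewrite yx in hC; apply: represents_loop hC.
Qed.

Fixpoint walk x (s : seq (bt_vert iota)) y : Prop :=
  if s is z :: s' then bt_adj fpsX x z /\ walk z s' y else x = y.

(** Each factor of determinant [fpsX] split off [N] is one step and lowers the order of [det N] by
    one; at order 0 the two classes coincide. *)
Lemma walk_exists_integral n h x y (N : 'M[O]_2) : fps_ord_is (\det N) n ->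
  represents h x -> represents (h *m imx N) y -> exists s, walk x s y.
Proof.
elim: n h x N => [|n IH] h x N oN hx hy.
  exists [::]; apply: represents_inj hx _; apply: represents_mul_unit hy.
  by rewrite unitmxE fps_unit_const; apply: oN.1.
have [B [M [NE dB]]] : exists B M : 'M[O]_2, N = B *m M /\ \det B = fpsX.
  by apply: fps_mx_factor; rewrite det_map_mx; apply: oN.2.
have oB : fps_ord_is (\det B) 1 by rewrite dB; apply: fps_ordX.
have [z hz] : exists z, represents (h *m imx B) z.
  by apply: represented_ex; rewrite unitmx_mul hx.1 imx_unit // dB fpsX_neq0.
have [||s zs] := IH (h *m imx B) z M _ hz.
- by move: oN; rewrite NE det_mulmx dB => /fps_ord_XM.
- by rewrite -mulmxA -map_mxM -NE.
by exists (z :: s); split=> //; apply: mul_adj oB hx hz.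
Qed.

Hypothesis iota_frac : forall a : K, exists p q, q != 0 /\ a * iota q = iota p.

Lemma clear_denominators m n (M : 'M[K]_(m, n)) :
  exists s, exists2 N : 'M[O]_(m, n), s != 0 & iota s *: M = imx N.
Proof.
have ex (ij : 'I_m * 'I_n) : exists pq : O * O, pq.2 != 0 /\ M ij.1 ij.2 * iota pq.2 = iota pq.1.
  by have [p [q H]] := iota_frac (M ij.1 ij.2); exists (p, q).
pose f ij := projT1 (cid (ex ij)).
have fP ij : (f ij).2 != 0 /\ M ij.1 ij.2 * iota (f ij).2 = iota (f ij).1.
  by rewrite /f; case: cid.
exists (\prod_ij (f ij).2).
exists (\matrix_(i, j) ((f (i, j)).1 * \prod_(kl | kl != (i, j)) (f kl).2)).
  by apply/prodf_neq0 => ij _; have [] := fP ij.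
apply/matrixP => i j; rewrite !mxE (bigD1 (i, j)) //= !rmorphM /= mulrAC.
by rewrite [_ * M i j]mulrC (fP (i, j)).2.
Qed.

Lemma walk_exists x y : exists s, walk x s y.
Proof.
have [h hx] := represents_ex x; have [k ky] := represents_ex y.
have [s [N s0 NE]] := clear_denominators (invmx h *m k).
have is0 : iota s != 0 by rewrite -(rmorph0 iota) (inj_eq iota_inj).
have hN : h *m imx N = iota s *: k.
  by rewrite -NE -scalemxAr mulmxA mulmxV ?mul1mx // hx.1.
have hy : represents (h *m imx N) y by rewrite hN; apply/represents_scale.
have dN : \det N != 0.
  have := hy.1; rewrite unitmx_mul => /andP[_]; rewrite unitmxE det_map_mx unitfE.
  by rewrite -(rmorph0 iota) (inj_eq iota_inj).
by have [n oN] := fps_ordP dN; apply: walk_exists_integral oN hx hy.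
Qed.

End Lattices.

Section Tree.
Variable F : fieldType.
Local Notation T := (bruhat_tits_tree F).

Lemma bruhat_tits_connected : connected T.
Proof.
move=> x y.
have [s] := @walk_exists F (laurent F) _ (@laurent_iota_inj F) (@fractionP _) x y.
elim: s x => [|z s IH] x /=; first by move=> ->; exists [::].
move=> [xz /IH[p zpy]].
by exists ((SigSub (mem_set (xz : [set p | bt_adj fpsX p.1 p.2] (x, z))) : edge T) :: p).
Qed.

Lemma bruhat_tits_acyclic : acyclic T.
Proof.
move=> e s es; have /set_mem ae := valP e.
rewrite -[src e]/((val e).1).
have := @reduced_walk_open F (laurent F) _ (@laurent_iota_inj F) (val e).1 (val e).2
  [seq (val f).2 | f <- s] ae.
have -> : last (val e).2 [seq (val f).2 | f <- s] = tgt (last e s) :> vert T.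
  exact: (last_map (fun f : edge T => (val f).2)).
apply; elim: s e es {ae} => [|f s IH] e //= /andP[/andP[/eqP fe nef] fs].
have fe1 : (val f).1 = (val e).2 by [].
split; last by have := IH f fs; rewrite fe1.
  by have /set_mem := valP f; rewrite -fe1.
move=> fe2; move/eqP: nef; apply; apply: val_inj.
by rewrite [LHS]surjective_pairing fe1 fe2.
Qed.

End Tree.

(** * Stabilizers of axes *)

Lemma pigeonhole_fin (U : finType) (f : nat -> U) : exists i j, (i < j)%N /\ f i = f j.
Proof.
have /injectivePn[i [j ij fij]] : ~~ injectiveb (fun i : 'I_#|U|.+1 => f i).
  by apply/negP => /injectiveP /leq_card; rewrite card_ord ltnn.
have [lt|lt|/val_inj E] := ltngtP i j; [by exists i, j|by exists j, i|].
by rewrite E eqxx in ij.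
Qed.

Section PolyMatrix.
Variable F : finFieldType.
Implicit Types (A M : 'M[{poly F}]_2) (p q t u v w d P : {poly F}).

Lemma mx22_sqr (R : comNzRingType) (A : 'M[R]_2) : A *m A = \tr A *: A - (\det A)%:M.
Proof.
apply/matrixP => i j; rewrite det_mx22 !mxE /mxtrace !big_ord_recl !big_ord0.
rewrite (_ : lift ord0 ord0 = 1); last exact: val_inj.
rewrite -![ord0]/(0 : 'I_2) !addr0.
have [->|->] := ord2E i; have [->|->] := ord2E j; rewrite /= ?mulr1n ?mulr0n;
  move: (A 0 0) (A 0 1) (A 1 0) (A 1 1) => a b c d; ring.
Qed.

Lemma size_const_unit p : p \is a GRing.unit -> size p = 1%N.
Proof. by rewrite poly_unitE => /andP[/eqP]. Qed.

Lemma tr_expSS A n : \tr (A ^+ n.+2) = \tr A * \tr (A ^+ n.+1) - \det A * \tr (A ^+ n).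
Proof.
have -> : A ^+ n.+2 = \tr A *: A ^+ n.+1 - \det A *: A ^+ n.
  rewrite exprS exprS mulrA [A * A]mx22_sqr mulrBl -scalerAl -exprS.
  by congr (_ - _); apply: mul_scalar_mx.
by rewrite linearB /= !mxtraceZ.
Qed.

(** In the recurrence [tr_expSS] the first term dominates when [tr A] is not constant and [det A]
    is. *)
Lemma size_tr_exp A n : (1 < size (\tr A)%R)%N -> \det A \is a GRing.unit ->
  (size (\tr (A ^+ n)) < size (\tr (A ^+ n.+1)))%N.
Proof.
move=> t1 dU; have dsz := size_const_unit dU.
elim: n => [|n IH].
  rewrite expr0 expr1; apply: leq_ltn_trans t1.
  by rewrite mxtrace1 -polyC_natr size_polyC leq_b1.
have tn0 : \tr (A ^+ n.+1) != 0 by rewrite -size_poly_gt0 (leq_ltn_trans _ IH).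
have t0 : \tr A != 0 by rewrite -size_poly_gt0 ltnW.
have s1 : size (\tr A * \tr (A ^+ n.+1)) = (size (\tr A) + size (\tr (A ^+ n.+1))).-1.
  by rewrite size_mul.
have s2 : (size (\det A * \tr (A ^+ n))%R <= size (\tr (A ^+ n)))%N.
  by apply: leq_trans (size_polyMleq _ _) _; rewrite dsz.
rewrite tr_expSS size_polyDl ?s1; first by move: t1; clear; lia.
rewrite size_polyN; apply: leq_ltn_trans s2 _; apply: ltn_trans IH _.
by move: t1; clear; lia.
Qed.

Lemma size_tr_bounded A n : \det A \is a GRing.unit ->
  (forall i, (size (\tr (A ^+ i)) <= n)%N) -> (size (\tr A)%R <= 1)%N.
Proof.
move=> dU bound; rewrite leqNgt; apply/negP => t1.
have : (n.+1 <= size (\tr (A ^+ n.+1)))%N.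
  elim: {bound}n.+1 => // k IH; apply: leq_ltn_trans IH _; exact: size_tr_exp.
by rewrite ltnNge bound.
Qed.

(** By Cayley-Hamilton all powers of [A] lie in the span of [1] and [A] over the finite field, so
    two of them coincide. *)
Lemma finite_order_of_tr A : (size (\tr A)%R <= 1)%N -> \det A \is a GRing.unit ->
  exists i j, (i < j)%N /\ A ^+ i = A ^+ j.
Proof.
move=> /size1_polyC tE /size_const_unit dsz.
have dE : \det A = ((\det A)`_0)%:P by apply: size1_polyC; rewrite dsz.
set t := (\tr A)`_0 in tE; set d := (\det A)`_0 in dE.
have ex n : exists ab : F * F, A ^+ n = ab.1%:P *: 1 + ab.2%:P *: A.
  elim: n => [|n [[a b] E]]; first by exists (1, 0); rewrite expr0 /= scale0r scale1r addr0.
  exists (- (b * d), a + b * t); rewrite exprSr E /= mulrDl -!scalerAl mul1r.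
  rewrite [A * A]mx22_sqr tE dE -scalemx1 scalerBr !scalerA -[1%:M]/(1 : 'M_2).
  rewrite polyCN polyCD !polyCM scalerDl scaleNr.
  by rewrite addrC [_ *: A + _]addrC -!addrA; congr (_ + _); rewrite addrC.
pose f n := projT1 (cid (ex n)).
have fE n : A ^+ n = (f n).1%:P *: 1 + (f n).2%:P *: A by rewrite /f; case: cid.
have [i [j [ij fij]]] := pigeonhole_fin f.
by exists i, j; rewrite !fE fij.
Qed.

(** Over the fraction field the centralizer of a nonscalar [M] is spanned by [1] and [M]. The
    denominator [u] is a nonzero off-diagonal entry of [M], or else the difference of its diagonal
    entries. *)
Lemma commute_mx22 A M : A *m M = M *m A -> ~~ is_scalar_mx M ->
  exists u v w, u != 0 /\ u *: A = v%:M + w *: M.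
Proof.
move=> AM Ms.
have E i j : A i 0 * M 0 j + A i 1 * M 1 j = M i 0 * A 0 j + M i 1 * A 1 j.
  have /matrixP/(_ i j) := AM; rewrite !mxE !big_ord_recl !big_ord0.
  by rewrite (_ : lift ord0 ord0 = 1) ?addr0 //; apply: val_inj.
have e00 := E 0 0; have e01 := E 0 1; have e10 := E 1 0; have {E} e11 := E 1 1.
have fill u v w : u * A 0 0 = v + w * M 0 0 -> u * A 0 1 = w * M 0 1 ->
    u * A 1 0 = w * M 1 0 -> u * A 1 1 = v + w * M 1 1 -> u *: A = v%:M + w *: M.
  move=> *; apply/matrixP => i j; rewrite !mxE.
  by have [->|->] := ord2E i; have [->|->] := ord2E j; rewrite /= ?mulr1n ?mulr0n ?add0r.
have [b0|b0] := eqVneq (M 0 1) 0; last first.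
  exists (M 0 1), (M 0 1 * A 0 0 - A 0 1 * M 0 0), (A 0 1); split=> //; apply: fill; first ring.
  - by rewrite mulrC.
  - by move: e00; rewrite [M 0 0 * _]mulrC => /addrI.
  apply/eqP; rewrite -subr_eq0; apply/eqP.
  by move/eqP: e01; rewrite -subr_eq0 => /eqP e; rewrite -[RHS]oppr0 -{}e; ring.
have [c0|c0] := eqVneq (M 1 0) 0; last first.
  exists (M 1 0), (M 1 0 * A 0 0 - A 1 0 * M 0 0), (A 1 0); split=> //; apply: fill; first ring.
  - rewrite b0 mulr0 mulrC; apply: (addrI (A 0 0 * M 0 0)).
    by rewrite e00 b0 mul0r !addr0 mulrC.
  - by rewrite mulrC.
  apply/eqP; rewrite -subr_eq0; apply/eqP.
  by move/eqP: e10; rewrite -subr_eq0 => /eqP e; rewrite -[RHS]e; ring.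
have ad : M 0 0 - M 1 1 != 0.
  apply: contra Ms; rewrite subr_eq0 => /eqP ad; apply/is_scalar_mxP; exists (M 0 0).
  apply/matrixP => i j; rewrite mxE.
  by have [->|->] := ord2E i; have [->|->] := ord2E j.
exists (M 0 0 - M 1 1), ((M 0 0 - M 1 1) * A 0 0 - (A 0 0 - A 1 1) * M 0 0), (A 0 0 - A 1 1).
split=> //; apply: fill; first ring.
- move: e01; rewrite b0 mulr0 add0r mul0r addr0 mulr0 => e.
  by rewrite mulrBl -e; ring.
- move: e10; rewrite c0 mulr0 addr0 mul0r add0r mulr0 => e.
  by rewrite mulrBl -e; ring.
ring.
Qed.
(* [P / u] and [t - P / u] are inverse to each other up to a constant and are
   integral over [F[t]]: they are constants. *)
Lemma size_sum_of_factors u P Q t d : u != 0 -> d \is a GRing.unit ->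
  P + Q = u * t -> P * Q = u ^+ 2 * d -> (size t <= 1)%N.
Proof.
move=> u0 dU sPQ pPQ; have dsz := size_const_unit dU.
have d0 : d != 0 by rewrite -size_poly_gt0 dsz.
set g := gcdp P u; have g0 : g != 0 by rewrite gcdp_eq0 negb_and u0 orbT.
have PE : P = P %/ g * g by rewrite divpK // dvdp_gcdl.
have uE : u = u %/ g * g by rewrite divpK // dvdp_gcdr.
have cop : coprimep (P %/ g) (u %/ g) by rewrite coprimep_div_gcd // u0 orbT.
move: PE uE cop; set P1 := P %/ g; set u1 := u %/ g => PE uE cop.
have QE : Q = u * t - P by rewrite -sPQ addrC addKr.
have E1 : P1 * P1 = u1 * (t * P1 - u1 * d).
  apply: (mulfI (mulf_neq0 g0 g0)); apply/eqP; rewrite -subr_eq0; apply/eqP.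
  have : u ^+ 2 * d - P * Q = 0 by rewrite pPQ subrr.
  by rewrite QE PE uE => <-; ring.
have u1P : u1 %| P1 * P1 by rewrite E1 dvdp_mulr.
have u1d : u1 %| P1 by rewrite Gauss_dvdpl // coprimep_sym in u1P.
have u1s : size u1 = 1%N.
  by apply/eqP; rewrite -coprimepp; apply: coprimep_dvdr u1d cop.
have u1c : u1 = (u1`_0)%:P by apply: size1_polyC; rewrite u1s.
have e0 : u1 != 0 by rewrite -size_poly_gt0 u1s.
have Q1E : P1 * (u1 * t - P1) = u1 ^+ 2 * d.
  apply/eqP; rewrite -subr_eq0; apply/eqP.
  have : u1 * (t * P1 - u1 * d) - P1 * P1 = 0 by rewrite E1 subrr.
  by move=> <-; ring.
have s1 : size (u1 ^+ 2 * d) = 1%N.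
  by rewrite expr2 !size_mul ?mulf_neq0 // u1s dsz.
have n0 : P1 * (u1 * t - P1) != 0 by rewrite Q1E -size_poly_gt0 s1.
move: (n0); rewrite mulf_eq0 negb_or => /andP[P10 Q10].
set Q1 := u1 * t - P1 in Q1E Q10 *.
have : (size P1 + size Q1).-1 = 1%N by rewrite -size_mul // Q1E.
move: P10 Q10; rewrite -!size_poly_gt0 => P10 Q10 sE.
have nat_aux m n : (0 < m)%N -> (0 < n)%N -> (m + n).-1 = 1%N -> (m <= 1)%N /\ (n <= 1)%N by lia.
have [sP sQ] := nat_aux _ _ P10 Q10 sE.
have -> : size t = size (u1 * t).
  have [->|t0] := eqVneq t 0; first by rewrite mulr0.
  by rewrite size_mul // u1s.
by rewrite -[u1 * t](subrK P1) -/Q1 (leq_trans (size_polyD _ _)) // geq_max sQ.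
Qed.

Lemma coef_mul_lead p q m n : (size p <= m.+1)%N -> (size q <= n.+1)%N ->
  (p * q)`_(m + n) = p`_m * q`_n.
Proof.
move=> sp sq; have lt : (m < (m + n).+1)%N by rewrite ltnS leq_addr.
rewrite coefM (bigD1 (Ordinal lt)) //= addKn big1 ?addr0 // => -[i /= ilt].
rewrite -val_eqE /= => im; have [mi|mi] := ltnP m i.
  by rewrite nth_default ?mul0r // (leq_trans sp).
have {im mi}im : (i < m)%N by rewrite ltn_neqAle im.
rewrite [X in _ * X]nth_default ?mulr0 // (leq_trans sq) //.
by move: im; clear; lia.
Qed.

(* [x ^ 2 + a x y + b y ^ 2] is anisotropic, so leading terms do not cancel. *)
Lemma size_anisotropic (a b : F) u v w d :
  (forall c : F, c ^+ 2 - a * c + b != 0) -> size d = 1%N ->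
  u ^+ 2 * d = v ^+ 2 + a%:P * v * w + b%:P * w ^+ 2 ->
  (size v <= size u)%N /\ (size w <= size u)%N.
Proof.
move=> noroot dsz E; have d0 : d != 0 by rewrite -size_poly_gt0 dsz.
set D := maxn (size v) (size w).
suff : (D <= size u)%N by rewrite geq_max => /andP.
rewrite leqNgt; apply/negP => uD.
case DE : D uD => [//|m]; rewrite ltnS => um.
have vm : (size v <= m.+1)%N by rewrite -DE leq_maxl.
have wm : (size w <= m.+1)%N by rewrite -DE leq_maxr.
have : v`_m ^+ 2 + a * (v`_m * w`_m) + b * w`_m ^+ 2 = 0.
  transitivity ((v ^+ 2 + a%:P * v * w + b%:P * w ^+ 2)`_(m + m)).
    by rewrite !coefD -mulrA !coefCM !expr2 !coef_mul_lead.
  rewrite -E expr2; have [->|u0] := eqVneq u 0; first by rewrite !mul0r coef0.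
  rewrite nth_default // !size_mul ?mulf_neq0 // dsz.
  have nat_aux n : (n <= m)%N -> (0 < n)%N -> (((n + n).-1 + 1).-1 <= m + m)%N by lia.
  by apply: nat_aux; rewrite ?size_poly_gt0.
have [w0|w0] := eqVneq w`_m 0.
  rewrite w0 expr0n /= !mulr0 !addr0 => /eqP; rewrite sqrf_eq0 => /eqP v0.
  have drop p : (size p <= m.+1)%N -> p`_m = 0 -> (size p <= m)%N.
    move=> sp pm; apply/leq_sizeP => j; rewrite leq_eqVlt => /predU1P[<- //|mj].
    by rewrite nth_default // (leq_trans sp).
  have : (D <= m)%N by rewrite geq_max !drop.
  by rewrite DE ltnn.
move=> H; have /negP := noroot (- (v`_m / w`_m)); apply; apply/eqP.
apply: (mulIf (expf_neq0 2 w0)); rewrite mul0r -[RHS]H.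
rewrite sqrrN mulrN opprK !mulrDl expr_div_n divfK ?expf_neq0 //; congr (_ + _ + _).
by rewrite -mulrA; congr (_ * _); rewrite expr2 mulrA divfK.
Qed.

(** Writing [u A = v + w M] turns [u^2 det A] into the norm form of [M] at [(v, w)], with constant
    coefficients. If the form splits over [F], its two factors have sum [u tr A] and
    [size_sum_of_factors] applies; otherwise [v] and [w] have at most the degree of [u]. *)
Lemma size_tr_commute A M : A *m M = M *m A -> ~~ is_scalar_mx M ->
  \det A \is a GRing.unit -> \det M \is a GRing.unit -> (size (\tr M)%R <= 1)%N ->
  (size (\tr A)%R <= 1)%N.
Proof.
move=> AM Ms dA dM /size1_polyC tM.
have [u [v [w [u0 uA]]]] := commute_mx22 AM Ms.
have dME : \det M = ((\det M)`_0)%:P by apply: size1_polyC; rewrite size_const_unit.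
set a := (\tr M)`_0 in tM; set b := (\det M)`_0 in dME.
have trE : u * \tr A = v *+ 2 + w * a%:P.
  by rewrite -tM -!mxtraceZ uA mxtraceD mxtrace_scalar.
have detE : u ^+ 2 * \det A = v ^+ 2 + a%:P * v * w + b%:P * w ^+ 2.
  rewrite -detZ uA -tM -dME !det_mx22 !mxE /mxtrace !big_ord_recl !big_ord0.
  rewrite (_ : lift ord0 ord0 = 1); last exact: val_inj.
  rewrite -![ord0]/(0 : 'I_2) /= ?mulr1n ?mulr0n !addr0 !add0r.
  move: (M 0 0) (M 0 1) (M 1 0) (M 1 1) => *; ring.
have [[c cE]|noroot] := pselect (exists c, c ^+ 2 - a * c + b = 0).
  have bE : b = c * (a - c) by rewrite -[LHS]subr0 -cE; ring.
  apply: (@size_sum_of_factors u (v + c%:P * w) (v + (a - c)%:P * w) _ _ u0 dA).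
    by rewrite trE polyCB; ring.
  by rewrite detE bE polyCM polyCB; ring.
have [|sv sw] := @size_anisotropic a b u v w (\det A) _ (size_const_unit dA) detE.
  by move=> c; apply/eqP => cE; apply: noroot; exists c.
have [->|t0] := eqVneq (\tr A) 0; first by rewrite size_poly0.
have su : (size (u * \tr A)%R <= size u)%N.
  rewrite trE (leq_trans (size_polyD _ _)) // geq_max mulr2n.
  rewrite (leq_trans (size_polyD _ _)) ?geq_max ?sv //=.
  by rewrite mulrC mul_polyC (leq_trans (size_scale_leq _ _)).
move: su; rewrite size_mul //.
have nat_aux m n : (0 < m)%N -> ((m + n).-1 <= m)%N -> (n <= 1)%N by lia.
by apply: nat_aux; rewrite size_poly_gt0.
Qed.

End PolyMatrix.

Lemma finite_set_inj (T : choiceType) (U : finType) (f : T -> U) (A : set T) :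
  (forall x y, A x -> A y -> f x = f y -> x = y) -> finite_set A.
Proof.
move=> finj; have [n Hn] := finite_set_size (finite_finset (X := f @` A)).
exact: set_size_finite (set_size_inj_preimage finj Hn).
Qed.

Lemma fps_ord_factor (F : fieldType) (f : {fps F}) n : fps_ord_is f n ->
  exists2 u, u \is a GRing.unit & f = fpsX ^+ n * u.
Proof.
elim: n f => [|n IH] f fn.
  by exists f; rewrite ?expr0 ?mul1r // fps_unit_const; apply: fn.1.
have /fps_const0P[g fE] : fps_const f = 0 by apply: fn.2.
have [|u uU gE] := IH g; first by apply/fps_ord_XM; rewrite -fE.
by exists u; rewrite // fE gE exprS mulrA.
Qed.

(** * Degree bounds for vertex stabilizers *)

Section Stabilizer.
Variables (F : fieldType) (K : fieldType) (iota : {rmorphism {fps F} -> K}).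
Variable rho : {rmorphism {poly F} -> K}.
Local Notation O := {fps F}.
Local Notation imx := (map_mx iota).
Local Notation rmx := (map_mx rho).
Implicit Types (h k : 'M[K]_2) (N : 'M[{poly F}]_2).

Hypothesis iota_inj : injective iota.
Hypothesis iota_frac : forall a : K, exists p q, q != 0 /\ a * iota q = iota p.
Hypothesis rhoC : forall c, rho c%:P = iota (fpsC c).
Hypothesis rhoX : iota fpsX * rho 'X = 1.

(** As [rho] inverts the uniformizer, [r] is the reversed polynomial, with the leading coefficient
    of [f] as its constant term. Degree is thus minus valuation. *)
Lemma rho_rev (f : {poly F}) : f != 0 -> exists2 r : O, fps_const r != 0 &
  iota (fpsX ^+ (size f).-1) * rho f = iota r.
Proof.
move=> f0; set D := (size f).-1.
have sf : size f = D.+1 by rewrite /D prednK // size_poly_gt0.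
exists (\sum_(i < D.+1) fpsC f`_i * fpsX ^+ (D - i)).
  rewrite /fps_const fpsE_sum big_ord_recr -[X in X != 0]/(_ + _) [X in X + _]big1 => [|i _].
    rewrite add0r subnn fpsE_CM fpsE1 mulr1 -[X in _`_X]/(size f).-1 -lead_coefE.
    by rewrite lead_coef_eq0.
  by rewrite fpsE_CM -[fpsX ^+ _]mulr1 fpsE_XnM subn_gt0
    (ltn_ord i : (widen_ord (leqnSn D) i < D)%N) mulr0.
rewrite -{1}[f]coefK poly_def sf !rmorph_sum /= mulr_sumr; apply: eq_bigr => -[i /= lt] _.
rewrite -mul_polyC !rmorphM rhoC /= mulrCA !rmorphXn; congr (_ * _).
have -> : iota fpsX ^+ D = iota fpsX ^+ (D - i) * iota fpsX ^+ i by rewrite -exprD subnK.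
by rewrite -mulrA -exprMn rhoX expr1n mulr1.
Qed.

Lemma size_rho_integral (f : {poly F}) (s o : O) n : fps_ord_is s n ->
  rho f * iota s = iota o -> (size f <= n.+1)%N.
Proof.
move=> os fs; have [->|f0] := eqVneq f 0; first by rewrite size_poly0.
have [r r0 rE] := rho_rev f0; set D := (size f).-1 in rE.
have E : r * s = fpsX ^+ D * o.
  by apply: iota_inj; rewrite !rmorphM -rE -fs mulrA.
have or : fps_ord_is r 0 by split.
have := (fps_ordM or os).1; rewrite E add0n fpsE_XnM.
case: ltnP => [|le _]; first by rewrite eqxx.
by rewrite (leq_trans (leqSpred _)).
Qed.

Lemma homothety_unit (c : K) (a b : O) : fps_ord_is a 0 -> fps_ord_is b 0 ->
  iota b = c ^+ 2 * iota a -> exists d, c = iota d.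
Proof.
move=> oa ob E; have [p [q [q0 cq]]] := iota_frac c.
have iq0 : iota q != 0 by rewrite -(rmorph0 iota) (inj_eq iota_inj).
have E2 : p ^+ 2 * a = q ^+ 2 * b.
  by apply: iota_inj; rewrite !expr2 !rmorphM -cq E expr2; ring.
have [n oq] := fps_ordP q0.
have oqb := fps_ordM (fps_ordM oq oq) ob; rewrite -expr2 -E2 in oqb.
have p0 : p != 0.
  by apply/eqP => p0; have := oqb.1; rewrite p0 expr2 !mul0r fpsE0 eqxx.
have [m op] := fps_ordP p0.
have opa := fps_ordM (fps_ordM op op) oa; rewrite -expr2 in opa.
have mn : m = n by have := fps_ord_uniq opa oqb; lia.
have [u uU pE] := fps_ord_factor op; have [v vU qE] := fps_ord_factor oq.
exists (u / v); apply: (mulIf iq0); rewrite cq pE qE -rmorphM mn; congr (iota _).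
by rewrite mulrCA divrK.
Qed.

(** If [N h = c h U] with [U] integral and invertible, comparing determinants makes [c] integral. So
    [N = c h U h^-1] has no denominators beyond those of [h] and [h^-1], which bounds the degrees
    independently of [N]. *)
Lemma stabilizer_bound (x : bt_vert iota) : exists n, forall N, N \in unitmx ->
  class_act (rmx N) (val x) = val x -> forall i j, (size (N i j) <= n)%N.
Proof.
have [h hx] := represents_ex x; have [hU xE] := hx.
have [s [H s0 hH]] := clear_denominators iota_frac h.
have [s' [H' s'0 hH']] := clear_denominators iota_frac (invmx h).
have [n on] := fps_ordP (mulf_neq0 s0 s'0); exists n.+1 => N NU Nx i j.
have rU : rmx N \in unitmx by rewrite unitmxE det_map_mx rmorph_unit // -unitmxE.
have Nhx : represents (rmx N *m h) x.
  split; first by rewrite unitmx_mul rU.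
  by rewrite -Nx xE class_act_homothety mx_act_lattice.
have [c [U UU [c0 E]]] := represents_eq iota_inj hx Nhx.
have rN : rmx N = c *: (h *m imx U *m invmx h) by rewrite scalemxAl -E mulmxK.
have [d cd] : exists d, c = iota d.
  have := NU; rewrite unitmxE poly_unitE => /andP[/size_poly1P[e e0 dN] _].
  apply: (@homothety_unit c (\det U) (fpsC e)).
  - by split=> //; rewrite -[_ 0%N]/(fps_const _) -fps_unit_const -unitmxE.
  - by split.
  have dh : \det h != 0 by rewrite -unitfE -unitmxE.
  apply: (mulfI dh); rewrite -rhoC -dN -det_map_mx mulrC -det_mulmx E detZ det_mulmx.
  by rewrite det_map_mx mulrCA.
have NE : iota (s * s') *: rmx N = imx (d *: (H *m U *m H')).
  rewrite map_mxZ !map_mxM -hH -hH' rN cd rmorphM !scalerA.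
  by rewrite -!scalemxAl -!scalemxAr !scalerA; congr (_ *: _); ring.
apply: (size_rho_integral (o := (d *: (H *m U *m H')) i j) on).
by have /matrixP/(_ i j) := NE; rewrite mxE [(rmx N) i j]mxE [RHS]mxE mulrC.
Qed.

End Stabilizer.

Definition mx_code (F : finFieldType) n (N : 'M[{poly F}]_2) : {ffun 'I_2 * 'I_2 * 'I_n -> F} :=
  [ffun t : 'I_2 * 'I_2 * 'I_n => (N t.1.1 t.1.2)`_(nat_of_ord t.2)].

Lemma mx_code_inj (F : finFieldType) n (M N : 'M[{poly F}]_2) :
  (forall i j, (size (M i j) <= n)%N) -> (forall i j, (size (N i j) <= n)%N) ->
  mx_code n M = mx_code n N -> M = N.
Proof.
move=> Mn Nn /ffunP MN; apply/matrixP => i j; apply/polyP => k.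
have [kn|nk] := ltnP k n; first by have := MN (i, j, Ordinal kn); rewrite !ffunE.
by rewrite !nth_default // (leq_trans _ nk).
Qed.

Section ProjectiveAction.
Variables (F : finFieldType) (K : fieldType) (iota : {rmorphism {fps F} -> K}).
Variable rho : {rmorphism {poly F} -> K}.
Local Notation rmx := (map_mx rho).
Local Notation PGL := (pgl2 {poly F}).
Implicit Types (N : 'M[{poly F}]_2) (g h : PGL) (x : bt_vert iota).

Hypothesis iota_inj : injective iota.
Hypothesis iota_frac : forall a : K, exists p q, q != 0 /\ a * iota q = iota p.
Hypothesis rhoC : forall c, rho c%:P = iota (fpsC c).
Hypothesis rhoX : iota fpsX * rho 'X = 1.

Let bound := stabilizer_bound iota_inj iota_frac rhoC rhoX.

Lemma bt_stabilizer_finite x : finite_set [set g : PGL | bt_vact rho g x = x].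
Proof.
have [n nP] := bound x.
apply: (@finite_set_inj _ _ (fun g => mx_code n (repr g))) => g h /= gx hx gh.
have st (k : PGL) : bt_vact rho k x = x -> forall i j, (size ((repr k : 'M_2) i j) <= n)%N.
  by move=> /(congr1 val) kx; apply: nP => //; apply: gl_unit.
rewrite -[g]reprK -[h]reprK; congr (\pi_PGL _)%qT; apply: val_inj.
exact: (mx_code_inj (st _ gx) (st _ hx) gh).
Qed.

Lemma class_act_mul (A B : 'M[K]_2) X : class_act (A *m B) X = class_act A (class_act B X).
Proof.
apply/seteqP; split=> L.
  by move=> [M XM <-]; exists (mx_act B M); [exists M|rewrite mx_act_mul].
by move=> [_ [M XM <-] <-]; exists M; rewrite ?mx_act_mul.
Qed.

Lemma class_act1 X : class_act (1%:M : 'M[K]_2) X = X.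
Proof.
apply/seteqP; split=> L; first by move=> [M XM <-]; rewrite mx_act_scalar scale1.
by move=> XL; exists L; rewrite // mx_act_scalar scale1.
Qed.

Lemma pgl2_pi_exp (R : comUnitRingType) (a : gl2 R) n :
  (\pi_(pgl2 R)%qT a ^+ n)%g = \pi_(pgl2 R)%qT (a ^+ n)%g.
Proof.
elim: n => [|n IH] //; rewrite !expgS IH; exact: pi_pgl2_mul.
Qed.

Lemma gl2_mx_exp (R : comUnitRingType) (a : gl2 R) n : gl_mx (a ^+ n)%g = (gl_mx a ^+ n)%R.
Proof. by elim: n => [|n IH] //; rewrite expgS exprS -IH. Qed.

(* A power of [repr g] commutes with [repr h], since the conjugates of [repr h]
   by the powers of [repr g] all fix [x]; as [repr h] has finite order, so does
   [repr g] unless [repr h] is scalar. *)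
Lemma bt_axis_free g h x :
  (forall i, bt_vact rho h (bt_vact rho (g ^+ i)%g x) = bt_vact rho (g ^+ i)%g x) ->
  h = 1%g \/ exists2 n, (0 < n)%N & (g ^+ n)%g = 1%g.
Proof.
move=> hgx; have [n nP] := bound x.
set A : 'M[{poly F}]_2 := repr g; set M : 'M[{poly F}]_2 := repr h.
have AU : A \in unitmx := gl_unit _; have MU : M \in unitmx := gl_unit _.
have AU' : A \is a GRing.unit by [].
have rmxM (B C : 'M[{poly F}]_2) : rmx (B * C) = rmx B *m rmx C by apply: map_mxM.
have gx i : val (bt_vact rho (g ^+ i)%g x) = class_act (rmx (A ^+ i)) (val x).
  elim: i => [|i IH]; first by rewrite expg0 bt_vact1 expr0 map_mx1 class_act1.
  rewrite expgS bt_vactM -[LHS]/(class_act (rmx A) (val (bt_vact rho (g ^+ i)%g x))).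
  by rewrite IH exprS rmxM class_act_mul.
have stab_conj i : class_act (rmx (A ^- i * M * A ^+ i)) (val x) = val x.
  rewrite !rmxM !class_act_mul -gx.
  have -> : class_act (rmx M) (val (bt_vact rho (g ^+ i)%g x)) = val (bt_vact rho (g ^+ i)%g x).
    by have := congr1 val (hgx i).
  by rewrite gx -class_act_mul -rmxM mulVr ?unitrX // map_mx1 class_act1.
have unit_conj k : A ^- k * M * A ^+ k \in unitmx.
  by rewrite !unitmx_mul MU -!/(_ \is a GRing.unit) unitrV !unitrX.
have [i [j [ij]]] := pigeonhole_fin (fun i => mx_code n (A ^- i * M * A ^+ i)).
move=> /(mx_code_inj (nP _ (unit_conj i) (stab_conj i)) (nP _ (unit_conj j) (stab_conj j))) E.
pose k := (j - i)%N.
have kE : A ^+ j = A ^+ k * A ^+ i by rewrite -exprD subnK // ltnW.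
have AM : A ^+ k * M = M * A ^+ k.
  have AiU : A ^+ i \is a GRing.unit by rewrite unitrX.
  have AjU : A ^+ j \is a GRing.unit by rewrite unitrX.
  apply: (mulIr AiU); rewrite -[LHS]mulrA -[RHS]mulrA -kE -[M * A ^+ j](mulVKr AjU).
  by rewrite [A ^- j * _]mulrA -E kE -!mulrA [_ * (A ^- i * _)]mulVKr.
have dA : \det (A ^+ k) \is a GRing.unit.
  by rewrite -unitmxE -[_ \in _]/(_ \is a GRing.unit) unitrX.
have stab_exp l : class_act (rmx (M ^+ l)) (val x) = val x.
  elim: l => [|l IH]; first by rewrite expr0 map_mx1 class_act1.
  rewrite exprS rmxM class_act_mul IH.
  by have := congr1 val (hgx 0%N); rewrite expg0 bt_vact1.
(* All powers of [M] fix [x], so their entries, and hence their traces, have bounded degree. *)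
have trM : (size (\tr M)%R <= 1)%N.
  apply: (@size_tr_bounded _ M n) => [|l]; first by rewrite -unitmxE.
  rewrite /mxtrace (leq_trans (size_sum _ _ _)) //; apply/bigmax_leqP => r _.
  apply: nP => //; by rewrite -[_ \in _]/(_ \is a GRing.unit) unitrX.
have [/is_scalar_mxP[b bE]|Ms] := boolP (is_scalar_mx M).
  left; rewrite -[h]reprK; apply/eqP/pgl2_eqP; exists b; last by rewrite -/M bE scalemx1.
  have := MU; rewrite bE unitmxE det_scalar unitrX_pos //.
right; have trA : (size (\tr (A ^+ k))%R <= 1)%N by apply: (size_tr_commute AM Ms dA).
have [p [q [pq ApAq]]] := finite_order_of_tr trA dA.
exists (k * (q - p))%N; first by rewrite muln_gt0 !subn_gt0 ij.
have gE m : (g ^+ m)%g = \pi_PGL%qT (repr g ^+ m)%g by rewrite -pgl2_pi_exp reprK.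
have gg : (g ^+ (k * p) = g ^+ (k * q))%g.
  by rewrite !gE; congr (\pi_PGL _)%qT; apply: val_inj; rewrite /= !gl2_mx_exp !exprM.
rewrite mulnBr expgnFr ?leq_mul2l ?(ltnW pq) ?orbT // -gg mulgV //.
Qed.

End ProjectiveAction.

Section Modular.
Variables (F : finFieldType) (Gamma : groupClosed (pgl2 {poly F})).
Local Notation T := (bruhat_tits_tree F).
Local Notation K := (laurent F).
Let a : action (subg Gamma) T := res_action (bt_action F) Gamma.

Lemma polyK_X : FracField.tofrac fpsX * polyK 'X = 1 :> K.
Proof.
rewrite -[polyK _]/(horner_eval _ (map_poly _ 'X)) map_polyX /horner_eval hornerX.
rewrite mulfV //; apply/eqP => /eqP; rewrite tofrac_eq0; exact/negP/fpsX_neq0.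
Qed.

Lemma bruhat_tits_vertex : exists x : vert T, True.
Proof.
by have [x _] := @represented_ex F K (@FracField.tofrac {fps F}) 1%:M (unitmx1 _ _); exists x.
Qed.

Lemma bruhat_tits_stabilizer x : finite_set (vstabilizer a x).
Proof.
have fin := bt_stabilizer_finite (rho := @polyK F) (@laurent_iota_inj F) (@fractionP _)
  (@polyK_C F) polyK_X x.
have [|n Hn] := @finite_set_size _ (val @` vstabilizer a x).
  by apply: sub_finite_set fin => _ [g gx <-].
by apply: set_size_finite (set_size_inj_preimage _ Hn) => g h _ _ /val_inj.
Qed.

Lemma bruhat_tits_axis_free : axis_free a.
Proof.
move=> g h x hyp hgx.
have valX n : val (g ^+ n)%g = (val g ^+ n)%g.
  by elim: n => [|n IH] //; rewrite !expgS -IH.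
have [|hE|[n n0 gn]] := @bt_axis_free F K _ (@polyK F) (@laurent_iota_inj F) (@fractionP _)
  (@polyK_C F) polyK_X (val g) (val h) x.
- by move=> i; have := hgx i; rewrite /a /= valX.
- exact: val_inj.
(* Positive powers of [g] translate the same ray and are hyperbolic, so [g] has infinite order. *)
have [p r] := hyperbolic_axis_ray (@bruhat_tits_acyclic F) (@bruhat_tits_connected F) x hyp.
have := axis_ray_hyperbolic (@bruhat_tits_acyclic F) (@bruhat_tits_connected F)
  (axis_ray_exp n0 r) (x := x).
have -> : (g ^+ n = 1)%g by apply: val_inj; rewrite valX gn.
by rewrite vact1.
Qed.

End Modular.

Theorem theorem1p1 (F : finFieldType) (Gamma : groupClosed (pgl2 {poly F})) (c : nat) :
  let T : graph := bruhat_tits_tree F in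
  let a : action (subg Gamma) T := res_action (bt_action F) Gamma in
  let X : graph_of_groups := quotient_gog a in
  let A : weighted_graph := assoc_weighted_graph X in
  centrally_rigid a c ->
  (selberg_multipliable a <-> bass_ihara_multipliable A)
  /\ selberg_zeta a = bass_ihara_zeta A ^+ c.
Proof.
move=> T a X A rigid; have [x _] := bruhat_tits_vertex F.
exact: (zeta_eq_centrally_rigid (@bruhat_tits_acyclic F) (@bruhat_tits_connected F)
  (@bruhat_tits_axis_free F Gamma) (@bruhat_tits_stabilizer F Gamma) x rigid).
Qed.
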